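(* Let $n\in\{2,3\}$ and let $\Gamma\subset\mathbb{R}^{n-1}$ be non-empty and compact. Let $(\Gamma_j)_{j\in\mathbb{N}_0}$ be a sequence of bounded open subsets of $\mathbb{R}^{n-1}$ such that $\Gamma\subset\Gamma(\epsilon_j)\subset\Gamma_j\subset\Gamma(\eta_j)$ for some $0<\epsilon_j<\eta_j$, with $\eta_j\to0$ as $j\to\infty$. For each $j$ let $M_j$ be a pre-convex mesh on $\Gamma_j$ with mesh size $h_j$, and let $V_j^h$ be the space of piecewise constant functions on $M_j$. Let $t\in[-1/2,0]$ be such that $H^t_\Gamma$ is dense in $H^{-1/2}_\Gamma$ (which always holds for $t=-1/2$). If $h_j=o\big((\epsilon_j)^{-2t}\big)$ as $j\to\infty$, then BEM convergence holds, i.e. $V_j^h$ Mosco-converges to $H^{-1/2}_\Gamma$ in $H^{-1/2}(\mathbb{R}^{n-1})$.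
   Context: For $\epsilon>0$, $\Gamma(\epsilon)=\{x\in\mathbb{R}^{n-1}:\operatorname{dist}(x,\Gamma)<\epsilon\}$. Sobolev spaces: for $m\in\mathbb{N}$ and $s\in\mathbb{R}$, $H^s(\mathbb{R}^m)$ is the Hilbert space of tempered distributions $u$ whose Fourier transform $\hat u$ (with $\hat u(\xi)=(2\pi)^{-m/2}\int e^{-\mathrm{i}\xi\cdot x}u(x)\,dx$ for test functions) is locally integrable with $\|u\|_{H^s(\mathbb{R}^m)}^2=\int_{\mathbb{R}^m}(1+|\xi|^2)^s|\hat u(\xi)|^2\,d\xi<\infty$. For $F\subset\mathbb{R}^m$ closed, $H^s_F=\{u\in H^s(\mathbb{R}^m):\operatorname{supp}u\subset F\}$. Mosco convergence: closed subspaces $W_j$ of a Hilbert space $H$ Mosco-converge to a closed subspace $W$ of $H$ if (i) for every $w\in W$ there exist $w_j\in W_j$ with $\|w_j-w\|_H\to0$; and (ii) if $(W_{j_m})$ is a subsequence of $(W_j)$, $w_m\in W_{j_m}$ for $m\in\mathbb{N}$, and $w_m\rightharpoonup w$ weakly in $H$, then $w\in W$. Pre-convex mesh: a pre-convex mesh on a non-empty bounded open set $\Omega\subset\mathbb{R}^m$ is a finite collection $M=\{T_1,\dots,T_N\}$ of non-empty open subsets $T_l\subset\Omega$ whose convex hulls are pairwise disjoint, such that each $\partial T_l$ has zero $m$-dimensional Lebesgue measure and $\Omega$ is the interior of $\bigcup_{l=1}^N\overline{T_l}$. Its mesh size is $h=\max_l\operatorname{diam}(T_l)$. The space of piecewise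 constant functions on $M$ consists of the (a.e. equivalence classes of) functions that are constant on each $T_l$ and zero outside $\Omega$; it is a finite-dimensional subspace of $L^2(\mathbb{R}^m)\subset H^{-1/2}(\mathbb{R}^m)$. *)

(* Defs.v *)
From HB Require Import structures.
From mathcomp Require Import all_boot all_order all_algebra.
From mathcomp Require Import all_classical all_reals all_analysis.
From mathcomp Require Import complex.
Set Implicit Arguments.
Unset Strict Implicit.
Unset Printing Implicit Defensive.
Import Order.TTheory GRing.Theory Num.Theory Normc.
Import numFieldNormedType.Exports.
Local Open Scope classical_set_scope.
Local Open Scope ring_scope.

(* The sigma-algebra on R^m is the one generated by the coordinates, i.e. the
   Borel sigma-algebra. *)
Definition rV_display : measure_display.
Proof. exact. Qed.

Section rV_measurable.
Context (R : realType) (m : nat).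
Let coors : 'I_m -> 'rV[R]_m -> measurableTypeR R := fun i x => x ord0 i.

Let rV_set0 : g_sigma_preimage coors set0.
Proof. exact: sigma_algebra0. Qed.
Let rV_setC A : g_sigma_preimage coors A -> g_sigma_preimage coors (~` A).
Proof. exact: sigma_algebraC. Qed.
Let rV_bigcup (F : _^nat) : (forall i, g_sigma_preimage coors (F i)) ->
  g_sigma_preimage coors (\bigcup_i (F i)).
Proof. exact: sigma_algebra_bigcup. Qed.
HB.instance Definition _ := @isMeasurable.Build rV_display
  'rV[R]_m (g_sigma_preimage coors) rV_set0 rV_setC rV_bigcup.

Lemma measurable_coor (i : 'I_m) :
  measurable_fun [set: 'rV[R]_m] (fun x => x ord0 i : measurableTypeR R).
Proof.
move=> _ Y mY; rewrite setTI; apply: sub_sigma_algebra => /=.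
rewrite -bigcup_seq/=; exists i => /=; first by rewrite mem_index_enum.
by exists Y => //; rewrite setTI.
Qed.

Lemma measurable_fun_rVP d (T : measurableType d) (f : T -> 'rV[R]_m) :
  (forall i, measurable_fun [set: T] (fun t => f t ord0 i : measurableTypeR R)) ->
  measurable_fun [set: T] f.
Proof.
move=> mf.
suff H : g_sigma_preimage (fun i => coors i \o f) `<=` measurable.
  move=> _ A mA; rewrite g_sigma_preimage_comp in H.
  by apply: H; exists A.
apply: smallest_sub; first exact: sigma_algebra_measurable.
rewrite -bigcup_seq; apply: bigcup_sub => i Ii.
by move=> A [B mB <-]; exact: mf.
Qed.
End rV_measurable.

Section lebesgue_rV.
Context (R : realType).

Definition rV_cons m (p : measurableTypeR R * 'rV[R]_m) : 'rV[R]_m.+1 :=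
  \row_i (if unlift ord0 i is Some j then p.2 ord0 j else p.1).

Lemma measurable_rV_cons m : measurable_fun [set: _] (@rV_cons m).
Proof.
apply: measurable_fun_rVP => i; under eq_fun do rewrite mxE.
case: unliftP => [j _|_]; last exact: measurable_fst.
apply: (@measurableT_comp _ _ _ _ _ _
  (fun x : 'rV[R]_m => x ord0 j : measurableTypeR R)) => //.
exact: measurable_coor.
Qed.

Section step.
Context m (mu : {sigma_finite_measure set 'rV[R]_m -> \bar R}).

Let prod := ((@lebesgue_measure R) \x mu)%E.

Definition lebesgue_rV_step : set 'rV[R]_m.+1 -> \bar R :=
  pushforward prod (@rV_cons m).

HB.instance Definition _ := Measure.copy lebesgue_rV_step
  (measure_function_pushforward__canonical__measure_function_Measure prod
    (@measurable_rV_cons m)).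

Let behead (x : 'rV[R]_m.+1) : 'rV[R]_m := \row_j x ord0 (lift ord0 j).

Let measurable_behead : measurable_fun [set: _] behead.
Proof.
by apply: measurable_fun_rVP => i; under eq_fun do rewrite mxE; exact: measurable_coor.
Qed.

Let uncons (x : 'rV[R]_m.+1) : measurableTypeR R * 'rV[R]_m :=
  (x ord0 ord0, behead x).

Let measurable_uncons : measurable_fun [set: _] uncons.
Proof. by apply/measurable_fun_pairP; split => //=; exact: measurable_coor. Qed.

Let consK : cancel (@rV_cons m) uncons.
Proof.
move=> [x y]; rewrite /uncons mxE unlift_none; congr pair.
by apply/rowP => j; rewrite !mxE liftK.
Qed.

Let sigma_finite_step : sigma_finite setT lebesgue_rV_step.
Proof.
have /sigma_finiteP[F [TF ndF Foo]] := sigma_finiteT (@lebesgue_measure R).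
have /sigma_finiteP[G [TG ndG Goo]] := sigma_finiteT mu.
exists (fun n => uncons @^-1` (F n `*` G n)).
  apply/seteqP; split => // x _.
  have [i _ Fx] : (\bigcup_i F i) (uncons x).1 by rewrite -TF.
  have [j _ Gx] : (\bigcup_i G i) (uncons x).2 by rewrite -TG.
  exists (maxn i j) => //; split.
  - by move: Fx; apply: (subsetPset _ _ (ndF _ _ _)); exact: leq_maxl.
  - by move: Gx; apply: (subsetPset _ _ (ndG _ _ _)); exact: leq_maxr.
move=> n; have [mF Fn] := Foo n; have [mG Gn] := Goo n; split.
  rewrite -[X in measurable X]setTI; apply: measurable_uncons => //.
  exact: measurableX.
rewrite /lebesgue_rV_step /pushforward -comp_preimage.
rewrite (_ : _ \o _ = id); last by apply/funext => p; exact: consK.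
rewrite preimage_id /prod product_measure1E//.
by rewrite lte_mul_pinfty// ge0_fin_numE.
Qed.

HB.instance Definition _ := Measure_isSigmaFinite.Build _ _ _ lebesgue_rV_step
  sigma_finite_step.
End step.

(* Lebesgue measure on R^m.+1 is the image of the product of Lebesgue measure on
   R and Lebesgue measure on R^m. *)
Fixpoint lebesgue_rV m : {sigma_finite_measure set 'rV[R]_m -> \bar R} :=
  if m is m'.+1 then lebesgue_rV_step (lebesgue_rV m')
  else dirac (0 : 'rV[R]_0).
End lebesgue_rV.
Arguments lebesgue_rV : clear implicits.

Section schwartz.
Context (R : realType) (m : nat).
Local Notation X := 'rV[R]_m.
Local Notation C := R[i].
Local Notation Re := (@complex.Re R).
Local Notation Im := (@complex.Im R).

(* The norm of the library on 'rV[R]_m is the sup norm; distances, diameters and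
   Fourier variables use the Euclidean structure below. *)
Definition dotp (x y : X) : R := \sum_i x ord0 i * y ord0 i.
Definition enorm (x : X) : R := Num.sqrt (dotp x x).

(* The word al of coordinate indices lists the successive partial derivatives. *)
Definition pderiv (al : seq 'I_m) (g : X -> R) : X -> R :=
  foldr (fun i h x => 'D_(delta_mx ord0 i) h x) g al.

Definition cpderiv (al : seq 'I_m) (f : X -> C) (x : X) : C :=
  Complex (pderiv al (Re \o f) x) (pderiv al (Im \o f) x).

Definition smooth (g : X -> R) :=
  forall (al : seq 'I_m) (x : X), differentiable (pderiv al g) x.

Definition is_schwartz (f : X -> C) :=
  [/\ smooth (Re \o f), smooth (Im \o f) &
      forall (k : nat) (al : seq 'I_m), exists B : R,
        forall x, (1 + enorm x) ^+ k * normc (cpderiv al f x) <= B].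

Lemma pderiv0 al : pderiv al (cst 0) = cst 0.
Proof.
elim: al => //= i al ->; apply/funext => x; exact: derive_cst.
Qed.

Lemma pderiv_lin al (a b : R) (f g h : X -> R) :
  smooth f -> smooth g -> smooth h ->
  pderiv al (fun x => a * f x + b * g x + h x) =
  (fun x => a * pderiv al f x + b * pderiv al g x + pderiv al h x).
Proof.
move=> sf sg sh; elim: al => //= i al ->; apply/funext => x.
have df : derivable (pderiv al f) x (delta_mx ord0 i) by exact: diff_derivable.
have dg : derivable (pderiv al g) x (delta_mx ord0 i) by exact: diff_derivable.
have dh : derivable (pderiv al h) x (delta_mx ord0 i) by exact: diff_derivable.
rewrite (_ : (fun x => _) = a \*: pderiv al f + b \*: pderiv al g + pderiv al h)//.
rewrite deriveD//; last by apply: derivableD; apply: derivableZ.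
by rewrite deriveD ?deriveZ//; apply: derivableZ.
Qed.

Lemma smooth_lin (a b : R) (f g h : X -> R) :
  smooth f -> smooth g -> smooth h ->
  smooth (fun x => a * f x + b * g x + h x).
Proof.
move=> sf sg sh al x; rewrite pderiv_lin//.
rewrite (_ : (fun x => _) = a \*: pderiv al f + b \*: pderiv al g + pderiv al h)//.
by apply: differentiableD; [apply: differentiableD; apply: differentiableZ|].
Qed.

Let Re_lin (c : C) (f g : X -> C) : Re \o (c *: f + g) =
  fun x => Re c * (Re \o f) x
    + (- Im c) * (Im \o f) x + (Re \o g) x.
Proof.
apply/funext => x /=; rewrite -[(_ + _) x]/(c * f x + g x).
by case: c (f x) (g x) => [a b] [u v] [w z] /=; rewrite mulNr.
Qed.

Let Im_lin (c : C) (f g : X -> C) : Im \o (c *: f + g) =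
  fun x => Re c * (Im \o f) x
    + Im c * (Re \o f) x + (Im \o g) x.
Proof.
apply/funext => x /=; rewrite -[(_ + _) x]/(c * f x + g x).
by case: c (f x) (g x) => [a b] [u v] [w z] /=.
Qed.

Lemma cpderiv_lin al (c : C) (f g : X -> C) : is_schwartz f -> is_schwartz g ->
  cpderiv al (c *: f + g) = c *: cpderiv al f + cpderiv al g.
Proof.
move=> [rf jf _] [rg jg _]; apply/funext => x.
rewrite -[RHS]/(c * cpderiv al f x + cpderiv al g x).
rewrite /cpderiv Re_lin Im_lin !pderiv_lin//.
by case: c => a b; apply/eqP; rewrite eq_complex/= mulNr !eqxx.
Qed.

Definition schwartz_pred : {pred (X -> C)} := fun f => `[< is_schwartz f >].

Lemma schwartz_submod_closed : submod_closed schwartz_pred.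
Proof.
split=> [|c f g /asboolP Sf /asboolP Sg]; apply/asboolP.
  have z k : (k \o (0 : X -> C) = cst 0) -> smooth (k \o (0 : X -> C)).
    by move=> -> al x; rewrite pderiv0; exact: differentiable_cst.
  split; [exact: z|exact: z|move=> k al; exists 0 => x].
  rewrite /cpderiv (_ : _ \o _ = cst 0)// (_ : Im \o _ = cst 0)//.
  by rewrite pderiv0/= expr0n/= addr0 sqrtr0 mulr0.
have [rf jf bf] := Sf; have [rg jg bg] := Sg; split.
- by rewrite Re_lin; exact: smooth_lin.
- by rewrite Im_lin; exact: smooth_lin.
move=> k al; have [A hA] := bf k al; have [B hB] := bg k al.
exists (normc c * A + B) => x; rewrite cpderiv_lin//.
rewrite -[(_ + _) x]/(c * cpderiv al f x + cpderiv al g x).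
have k0 : 0 <= (1 + enorm x) ^+ k by rewrite exprn_ge0// addr_ge0// sqrtr_ge0.
rewrite (le_trans (ler_wpM2l k0 (le_normcD _ _)))// mulrDr lerD//.
rewrite normcM mulrCA ler_wpM2l//.
by case: c => a b /=; exact: sqrtr_ge0.
Qed.

Record schwartz := Schwartz {
  schwartz_fun :> X -> C ;
  schwartzP : schwartz_fun \in schwartz_pred }.

HB.instance Definition _ := [isSub for schwartz_fun].
HB.instance Definition _ := [Choice of schwartz by <:].
HB.instance Definition _ := GRing.isSubmodClosed.Build _ _ schwartz_pred
  schwartz_submod_closed.
HB.instance Definition _ := [SubChoice_isSubLmodule of schwartz by <:].
End schwartz.
Arguments schwartz : clear implicits.

Definition sdist (R : realType) (m : nat) : Type := schwartz R m -> R[i].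
HB.instance Definition _ (R : realType) (m : nat) :=
  GRing.Lmodule.copy (sdist R m) (schwartz R m -> R[i]).

Section tempered.
Context (R : realType) (m : nat).
Local Notation X := 'rV[R]_m.
Local Notation C := R[i].
Local Notation Re := (@complex.Re R).
Local Notation Im := (@complex.Im R).
Local Notation mu := (lebesgue_rV R m).
Local Notation S := (schwartz R m).
Local Notation D := (sdist R m).

Definition cintegral (f : X -> C) : C :=
  Complex (\int[mu]_x Re (f x)) (\int[mu]_x Im (f x)).

Definition cmeasurable (f : X -> C) :=
  measurable_fun [set: X] (Re \o f) /\ measurable_fun [set: X] (Im \o f).

Definition clocally_integrable (f : X -> C) := cmeasurable f /\
  forall K : set X, compact K -> (\int[mu]_(x in K) (normc (f x))%:E < +oo)%E.

Definition schwartz_norm (k : nat) (phi : S) : R :=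
  sup [set r | exists (al : seq 'I_m) (x : X), (size al <= k)%N /\
    r = (1 + enorm x) ^+ k * normc (cpderiv al phi x)].

(* Continuity for the Schwartz topology, defined by the increasing family of norms
   schwartz_norm k, means boundedness by one of them. *)
Definition tempered : set D := [set u | linear u /\
  exists (k : nat) (B : R), forall phi, normc (u phi) <= B * schwartz_norm k phi].

Definition regular_dist (f : X -> C) : D :=
  fun phi => cintegral (fun x => f x * phi x).

Definition fun_supp (phi : X -> C) : set X := closure [set x | phi x != 0].

Definition vanishes_on (u : D) (U : set X) :=
  forall phi : S, compact (fun_supp phi) -> fun_supp phi `<=` U -> u phi = 0.

(* The complement of the union of all open sets on which u vanishes. *)
Definition dist_supp (u : D) : set X :=
  [set x | forall U, open U -> U x -> ~ vanishes_on u U].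

Definition fourier (phi : X -> C) (xi : X) : C :=
  Complex ((2 * pi) `^ (- (m%:R / 2))) 0 *
  cintegral (fun x => Complex (cos (- dotp xi x)) (sin (- dotp xi x)) * phi x).

(* The Fourier transform of u is the distribution phi |-> u (fourier phi), and it
   is the locally integrable function f. The transform of a Schwartz function is a
   Schwartz function; psi is that function as an element of the space S. When f
   has a finite weighted norm (below), f * phi is integrable for all phi in S. *)
Definition is_fourier_transform (u : D) (f : X -> C) :=
  clocally_integrable f /\
  forall phi psi : S, psi =1 fourier phi -> u psi = regular_dist f phi.

(* Two transforms of u agree a.e.; the default value 0 is used when u has none. *)
Definition fourier_transform (u : D) : X -> C :=
  xget (fun=> 0) [set f | is_fourier_transform u f].

Definition sobolev_sqnorm (s : R) (u : D) : \bar R :=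
  (\int[mu]_xi ((1 + enorm xi ^+ 2) `^ s *
                normc (fourier_transform u xi) ^+ 2)%:E)%E.

Definition sobolev_norm (s : R) (u : D) : R :=
  Num.sqrt (fine (sobolev_sqnorm s u)).

Definition sobolev (s : R) : set D := [set u | [/\ tempered u,
  exists f, is_fourier_transform u f & (sobolev_sqnorm s u < +oo)%E]].

Definition sobolev_on (s : R) (F : set X) : set D :=
  [set u | sobolev s u /\ dist_supp u `<=` F].

End tempered.

(* The Hilbert space is the linear subspace H of V with the norm nrm; the values of
   nrm and of functionals outside H are irrelevant, hence the inclusions in H
   required by mosco_cvg. *)
Section mosco.
Context (R : realType) (V : lmodType R[i]) (H : set V) (nrm : V -> R).

Definition bounded_functional (l : V -> R[i]) :=
  (forall (a : R[i]) (u v : V), H u -> H v -> l (a *: u + v) = a * l u + l v) /\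
  exists B : R, forall u, H u -> normc (l u) <= B * nrm u.

Definition norm_cvg (w_ : nat -> V) (w : V) :=
  nrm (w_ j - w) @[j --> \oo] --> (0 : R).

Definition weak_cvg (w_ : nat -> V) (w : V) :=
  forall l, bounded_functional l ->
    normc (l (w_ j) - l w) @[j --> \oo] --> (0 : R).

Definition dense_in (A B : set V) :=
  forall w, B w -> forall e : R, 0 < e -> exists2 v, A v & nrm (v - w) < e.

Definition mosco_cvg (W_ : nat -> set V) (W : set V) :=
  [/\ forall j, W_ j `<=` H,
      W `<=` H,
      forall w, W w ->
        exists w_ : nat -> V, (forall j, W_ j (w_ j)) /\ norm_cvg w_ w &
      forall (sub : nat -> nat) (w_ : nat -> V) (w : V),
        {homo sub : i j / (i < j)%N} -> (forall j, W_ (sub j) (w_ j)) ->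
        H w -> weak_cvg w_ w -> W w].

End mosco.

Section mesh.
Context (R : realType) (m : nat).
Local Notation X := 'rV[R]_m.

Definition dist_to (x : X) (A : set X) : R := inf [set enorm (x - y) | y in A].

Definition neighborhood (A : set X) (e : R) : set X := [set x | dist_to x A < e].

Definition diam (A : set X) : R :=
  sup [set r | exists x y, [/\ A x, A y & r = enorm (x - y)]].

Definition convex_hull (A : set X) : set X :=
  \bigcap_(K in [set K : set X | convex_set K /\ A `<=` K]) K.

Record preconvex_mesh (Omega : set X) := PreconvexMesh {
  mesh_card : nat ;
  mesh_cell : 'I_mesh_card -> set X ;
  mesh_cell_nonempty : forall l, mesh_cell l !=set0 ;
  mesh_cell_open : forall l, open (mesh_cell l) ;
  mesh_cell_sub : forall l, mesh_cell l `<=` Omega ;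
  mesh_hull_disjoint : forall k l, k != l ->
    convex_hull (mesh_cell k) `&` convex_hull (mesh_cell l) = set0 ;
  mesh_boundary_null : forall l,
    lebesgue_rV R m (closure (mesh_cell l) `\` (mesh_cell l)°) = 0%E ;
  mesh_cover : Omega = (\bigcup_l closure (mesh_cell l))° }.

Definition mesh_size (Omega : set X) (M : preconvex_mesh Omega) : R :=
  \big[Num.max/0]_(l < mesh_card M) diam (mesh_cell (p := M) l).

(* L^2 functions are identified with the regular distributions they define; the
   a.e. classes are described by their Borel representatives. *)
Definition piecewise_constant (Omega : set X) (M : preconvex_mesh Omega) :
    set (sdist R m) :=
  [set u | exists f : X -> R[i],
    [/\ cmeasurable f,
        forall l x y, mesh_cell (p := M) l x -> mesh_cell (p := M) l y -> f x = f y,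
        forall x, ~ Omega x -> f x = 0 &
        u = regular_dist f]].

End mesh.

(* Main.v *)
(** Write <xi>^2 = 1 + |xi|^2. Every w in H^(-1/2)_Gamma is approximated by some v
    in H^t_Gamma, and v by its mollification v_e = v * rho_e with e = eps_j. By the
    support hypothesis v_e vanishes outside Gamma(eps_j), hence outside Gamma_j, and
    since t <= 0 Bessel's inequality gives |v_e|_(L^2) <= C e^t |v|_(H^t), while
    v_e -> v in H^(-1/2) by dominated convergence on the Fourier side. Replacing v_e
    by its mean on every cell leaves an error g with mean zero on the cells. Its
    H^(-1) norm is found by duality: with G the inverse transform of <xi>^(-2) times
    the transform of g, |g|_(H^(-1))^2 = int g G, and a Poincare inequality for G on
    the cells, whose convex hulls are disjoint, bounds this by C h |g|_(L^2)
    |g|_(H^(-1)). Interpolating with L^2, the H^(-1/2) norm of g is at most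
    C h^(1/2) |v_e|_(L^2) <= C (h e^(2t))^(1/2) |v|_(H^t) -> 0. Conversely, evaluation
    at a test function supported away from Gamma is a bounded functional on H^(-1/2)
    that vanishes on the j-th discrete space for all large j, so weak limits are
    supported in Gamma.

    All transforms are expressed with the cosine and sine transforms of real
    functions. Uniqueness of transforms and convolution formulas only need inversion
    for compactly supported smooth functions, obtained with Poisson kernels. *)

Require Import Defs.
From HB Require Import structures.
From mathcomp Require Import all_boot all_order all_algebra.
From mathcomp Require Import all_classical all_reals all_analysis.
From mathcomp Require Import measurable_realfun complex ring lra.
Set Implicit Arguments.
Unset Strict Implicit.
Unset Printing Implicit Defensive.
Import Order.TTheory GRing.Theory Num.Theory Normc.
Import numFieldNormedType.Exports.
Local Open Scope classical_set_scope.
Local Open Scope ring_scope.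

(** * Integration on R^m *)

(** Duality is forced by the only bound that survives mollification: the L2 norm of v_e, at the
    price e^t. A Poincare inequality for v_e itself would cost a whole derivative. The function G,
    in contrast, is smooth on all of R^m, so segments joining two points of a cell may leave the
    cell, and even the mesh, as long as they stay in the convex hull; cells may thus be
    disconnected. To have G smooth, its transform is first cut off to a ball, and the cut-off is
    removed by Fatou's lemma. Only upper bounds are taken from L2 theory, so the inequality half of
    Plancherel's theorem suffices, and constants such as a factor 2 from separating real and
    imaginary parts are harmless. The interpolation is the pointwise inequality <xi>^(-1) <= d/2 +
    <xi>^(-2)/(2d), with d an upper bound of the mesh size. The function v is chosen before j, so
    that |v|_(H^t) is a constant when h = o(e^(-2t)) is used. The Poisson weight exp(-sum |x_i|) is
    convenient because it and its transform are positive products of elementary functions of one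
    variable. *)

Section integrable_real.
Context d (T : measurableType d) (R : realType) (mu : {measure set T -> \bar R}).
Implicit Types f g k : T -> R.

Lemma Rintegrable_measurable f : mu.-integrable setT (EFin \o f) ->
  measurable_fun setT f.
Proof. by move=> /integrableP[/measurable_EFinP]. Qed.

Lemma Rintegrable_le f g : measurable_fun setT f ->
  (forall x, `|f x| <= g x) -> mu.-integrable setT (EFin \o g) ->
  mu.-integrable setT (EFin \o f).
Proof.
move=> mf fg ig; apply: le_integrable ig => //; first exact/measurable_EFinP.
by move=> x _; rewrite /= lee_fin (le_trans (fg x))// ler_norm.
Qed.

Lemma RintegrableM_bounded f k B : mu.-integrable setT (EFin \o f) ->
  measurable_fun setT k -> (forall x, `|k x| <= B) ->
  mu.-integrable setT (EFin \o (fun x => f x * k x)).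
Proof.
move=> fi mk kB; apply: (@Rintegrable_le _ (fun x => B * `|f x|)).
- by apply: measurable_funM => //; exact: Rintegrable_measurable.
- by move=> x; rewrite normrM mulrC ler_wpM2r.
- have := integrableZl (measurableT) B (integrable_norm fi).
  by apply: eq_integrable => // x _.
Qed.

Lemma RintegrableD f g : mu.-integrable setT (EFin \o f) ->
  mu.-integrable setT (EFin \o g) ->
  mu.-integrable setT (EFin \o (fun x => f x + g x)).
Proof. by move=> fi gi; exact: (integrableD measurableT fi gi). Qed.

Lemma RintegrableB f g : mu.-integrable setT (EFin \o f) ->
  mu.-integrable setT (EFin \o g) ->
  mu.-integrable setT (EFin \o (fun x => f x - g x)).
Proof. by move=> fi gi; exact: (integrableB measurableT fi gi). Qed.

Lemma RintegrableZ f c : mu.-integrable setT (EFin \o f) ->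
  mu.-integrable setT (EFin \o (fun x => c * f x)).
Proof. by move=> fi; exact: (integrableZl measurableT c fi). Qed.

Lemma ge0_Rintegrable f : measurable_fun setT f -> (forall x, 0 <= f x) ->
  (\int[mu]_x (f x)%:E < +oo)%E -> mu.-integrable setT (EFin \o f).
Proof.
move=> mf f0 fi; apply/integrableP; split; first exact/measurable_EFinP.
by under eq_integral do rewrite /= ger0_norm//.
Qed.

Lemma EFin_Rintegral f : mu.-integrable setT (EFin \o f) ->
  (\int[mu]_x f x)%:E = (\int[mu]_x (f x)%:E)%E.
Proof.
by move=> fi; rewrite /Rintegral fineK//; apply: integrable_fin_num.
Qed.

End integrable_real.

Section real_limits.
Context d (T : measurableType d) (R : realType) (mu : {measure set T -> \bar R}).

Lemma Rdominated_cvg (f_ : nat -> T -> R) (f g : T -> R) :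
  (forall n, measurable_fun setT (f_ n)) -> measurable_fun setT f ->
  (forall x, f_ n x @[n --> \oo] --> f x) ->
  mu.-integrable setT (EFin \o g) -> (forall n x, `|f_ n x| <= g x) ->
  \int[mu]_x f_ n x @[n --> \oo] --> \int[mu]_x f x.
Proof.
move=> mf_ mf ff gi fg.
have fi : mu.-integrable setT (EFin \o f).
  apply: Rintegrable_le gi => // x.
  have h : `|f_ n x| @[n --> \oo] --> `|f x| by apply: cvg_norm; exact: ff.
  rewrite -(cvg_lim _ h)//.
  by apply: limr_le; [apply/cvg_ex; exists `|f x|; exact: h|exact: nearW].
have := @dominated_convergence _ _ _ mu setT measurableT (fun n x => (f_ n x)%:E)
  (EFin \o f) (EFin \o g).
case.
- by move=> n; exact/measurable_EFinP.
- exact/measurable_EFinP.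
- by apply: aeW => x _; apply: cvg_EFin; [exact: nearW|exact: ff].
- exact: gi.
- by apply: aeW => x n _; rewrite /= lee_fin.
move=> _ _ /=; rewrite -(EFin_Rintegral fi) => /fine_cvgP[_].
exact.
Qed.

(** The way finiteness is inferred below: the damped or truncated integrals are bounded uniformly,
    but no integrable majorant of the limit is known beforehand. *)
Lemma fatou_bound (f_ : nat -> T -> R) (f : T -> R) (C : R) :
  (forall n, measurable_fun setT (f_ n)) -> (forall n x, 0 <= f_ n x) ->
  (forall x, f_ n x @[n --> \oo] --> f x) ->
  (forall n, (\int[mu]_x (f_ n x)%:E <= C%:E)%E) ->
  (\int[mu]_x (f x)%:E <= C%:E)%E.
Proof.
move=> mf_ f0 ff fC.
have := @fatou _ _ _ mu setT measurableT (fun n x => (f_ n x)%:E).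
have -> : (fun x => limn_einf (fun n => (f_ n x)%:E)) = EFin \o f.
  apply/funext => x; have h : (f_ n x)%:E @[n --> \oo] --> (f x)%:E.
    by apply: cvg_EFin; [exact: nearW|exact: ff].
  rewrite is_cvg_limn_einfE; last by apply/cvg_ex; exists (f x)%:E.
  exact/cvg_lim.
move=> H; apply: le_trans.
  apply: H; first by move=> n; exact/measurable_EFinP.
  by move=> n x _; rewrite lee_fin.
rewrite limn_einf_lim; apply: lime_le; first exact: is_cvg_einfs.
apply: nearW => n; apply: (@le_trans _ _ (\int[mu]_x (f_ n x)%:E)%E); last exact: fC.
by apply: ereal_inf_lbound; exists n => /=.
Qed.
End real_limits.

(** * Fubini's theorem for bounded kernels *)

Section measurable_slices.
Context d1 d2 d3 (T1 : measurableType d1) (T2 : measurableType d2)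
  (T3 : measurableType d3) (k : T1 * T2 -> T3).
Hypothesis mk : measurable_fun setT k.

Lemma measurable_slice1 x : measurable_fun setT (fun y => k (x, y)).
Proof. by apply: (measurableT_comp mk); exact: measurable_pair1. Qed.

Lemma measurable_slice2 y : measurable_fun setT (fun x => k (x, y)).
Proof. by apply: (measurableT_comp mk); exact: measurable_pair2. Qed.
End measurable_slices.

Section fubini_kernel.
Context d1 d2 (T1 : measurableType d1) (T2 : measurableType d2) (R : realType).
Context (m1 : {sigma_finite_measure set T1 -> \bar R}).
Context (m2 : {sigma_finite_measure set T2 -> \bar R}).
Variables (f : T1 -> R) (g : T2 -> R) (k : T1 * T2 -> R) (B : R).
Hypotheses (fi : m1.-integrable setT (EFin \o f))
  (gi : m2.-integrable setT (EFin \o g)) (mk : measurable_fun setT k)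
  (kB : forall z, `|k z| <= B).

Let F (z : T1 * T2) := f z.1 * g z.2 * k z.

Let mF : measurable_fun setT F.
Proof.
apply: measurable_funM => //; apply: measurable_funM.
- by apply: measurableT_comp => //; exact: Rintegrable_measurable fi.
- by apply: measurableT_comp => //; exact: Rintegrable_measurable gi.
Qed.

Let kNB z : `|k z| <= `|B|.
Proof. exact: le_trans (kB z) (ler_norm _). Qed.

Lemma integrable_kernel : (m1 \x m2)%E.-integrable setT (EFin \o F).
Proof.
apply/integrable12ltyP; first exact/measurable_EFinP.
pose a := (`|B| * (\int[m2]_y `|g y|))%R.
have ia : m1.-integrable setT (EFin \o (fun x => a * `|f x|)).
  apply: (@RintegrableZ _ _ _ _ (fun x => `|f x|)); exact: integrable_norm.
apply: (@le_lt_trans _ _ (\int[m1]_x (a * `|f x|)%:E)%E); last first.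
  exact: (integrable_lty measurableT ia).
apply: ge0_le_integral => //=.
- by move=> x _; exact: integral_ge0.
- apply: (@measurable_fun_fubini_tonelli_F _ _ _ _ _ m2 (fun z => `|(F z)%:E|%E)) => //.
  by apply: measurableT_comp => //; exact/measurable_EFinP.
- exact/measurable_EFinP/(Rintegrable_measurable ia).
move=> x _; apply: (@le_trans _ _ (\int[m2]_y (`|f x| * `|B| * `|g y|)%:E)%E).
  apply: ge0_le_integral => //=.
  - apply/measurable_EFinP; apply: measurableT_comp => //.
    exact: (measurable_slice1 mF).
  - apply/measurable_EFinP; apply: measurable_funM => //.
    by apply: measurableT_comp => //; exact: Rintegrable_measurable gi.
  move=> y _; rewrite lee_fin normrM normrM -mulrA -mulrA ler_wpM2l//.
  by rewrite mulrC ler_wpM2r.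
rewrite -(@EFin_Rintegral _ _ _ _ (fun y => `|f x| * `|B| * `|g y|)); last first.
  apply: (@RintegrableZ _ _ _ _ (fun x => `|g x|)); exact: integrable_norm.
rewrite RintegralZl//; last exact: integrable_norm.
by rewrite lee_fin /a -[leLHS]mulrA [leLHS]mulrC.
Qed.

Lemma integrable_kernel1 :
  m1.-integrable setT (EFin \o (fun x => f x * \int[m2]_y (g y * k (x, y)))).
Proof.
have := integrable_fubini_F integrable_kernel.
apply: eq_integrable => // x _ /=; rewrite /fubini_F /F /=.
under eq_integral do rewrite -mulrA.
rewrite -EFin_Rintegral; last first.
  apply: (@RintegrableZ _ _ _ _ (fun y => g y * k (x, y))).
  apply: RintegrableM_bounded gi _ (fun y => kB (x, y)).
  exact: measurable_slice1.
rewrite RintegralZl//.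
by apply: RintegrableM_bounded gi _ (fun y => kB (x, y)); exact: measurable_slice1.
Qed.
End fubini_kernel.

Section fubini_kernel_swap.
Context d1 d2 (T1 : measurableType d1) (T2 : measurableType d2) (R : realType).
Context (m1 : {sigma_finite_measure set T1 -> \bar R}).
Context (m2 : {sigma_finite_measure set T2 -> \bar R}).

(** Boundedness of [k] makes [f x * g y] the majorant on the product. The exchanges of cosine and
    sine transforms are instances of it. *)
Lemma fubini_kernel (f : T1 -> R) (g : T2 -> R) (k : T1 * T2 -> R) (B : R) :
  m1.-integrable setT (EFin \o f) -> m2.-integrable setT (EFin \o g) ->
  measurable_fun setT k -> (forall z, `|k z| <= B) ->
  \int[m1]_x (f x * \int[m2]_y (g y * k (x, y))) =
  \int[m2]_y (g y * \int[m1]_x (f x * k (x, y))).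
Proof.
move=> fi gi mk kB; rewrite /Rintegral; congr fine.
have ig x : m2.-integrable setT (EFin \o (fun y => g y * k (x, y))).
  by apply: RintegrableM_bounded gi _ (fun y => kB (x, y)); exact: measurable_slice1.
have jf y : m1.-integrable setT (EFin \o (fun x => f x * k (x, y))).
  by apply: RintegrableM_bounded fi _ (fun x => kB (x, y)); exact: measurable_slice2.
transitivity (\int[m1]_x \int[m2]_y (f x * g y * k (x, y))%:E)%E.
  apply: eq_integral => x _; rewrite EFinM (EFin_Rintegral (ig x)).
  rewrite -integralZl//; last exact: ig.
  by apply: eq_integral => y _; rewrite /= -EFinM mulrA.
rewrite [LHS](Fubini (integrable_kernel fi gi mk kB)) /=.
apply: eq_integral => y _; rewrite EFinM (EFin_Rintegral (jf y)).
rewrite -integralZl//; last exact: jf.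
by apply: eq_integral => x _; rewrite /= -EFinM mulrCA mulrA.
Qed.
End fubini_kernel_swap.

(** * Measurability for the coordinate sigma-algebra *)

Section rV_measurability.
Context (R : realType).

(** For [m = 0] the intersection is the whole space, while a ball of nonpositive radius is empty;
    hence the hypothesis on [e]. *)
Lemma coord_ball m (x : 'rV[R]_m) (e : R) : 0 < e -> ball x e =
  \bigcap_(i in [set: 'I_m]) [set y | ball (x ord0 i) e (y ord0 i)].
Proof.
move=> e0; apply/seteqP; split => y /=.
  by move=> [_ H] i _; apply: H.
move=> H; split => // i j; rewrite ord1; exact: H.
Qed.

Lemma measurable_rV_ball m (x : 'rV[R]_m) (e : R) : measurable (ball x e).
Proof.
have [e0|e0] := ltP 0 e; last first.
  rewrite (_ : ball x e = set0) ?measurable0//.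
  by apply/seteqP; split => y //= [e0']; rewrite ltNge e0 in e0'.
rewrite coord_ball//; apply: fin_bigcap_measurable => // i _.
rewrite -[X in measurable X]setTI.
apply: (@measurable_coor R m i measurableT [set z | ball (x ord0 i) e z]).
exact: measurable_ball.
Qed.

Lemma rat_dense_ball m (x : 'rV[R]_m) (e : R) : 0 < e ->
  exists q : 'rV[rat]_m, ball x e (\row_i ratr (q ord0 i)).
Proof.
move=> e0.
have H i : exists q : rat, `|x ord0 i - ratr q| < e.
  have : x ord0 i - e < x ord0 i + e by rewrite ltrD2l gtrN.
  move=> /rat_in_itvoo[q]; rewrite in_itv /= => /andP[q1 q2]; exists q.
  rewrite ltr_distl; apply/andP; split; lra.
exists (\row_i projT1 (cid (H i))); rewrite coord_ball// => i _ /=.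
by rewrite !mxE; case: cid.
Qed.

(** An open set is a countable union of sup-norm balls with rational centres and radii, and such
    balls are finite intersections of coordinate preimages. *)
Lemma open_rV_measurable m (U : set 'rV[R]_m) : open U -> measurable U.
Proof.
move=> oU.
pose B (p : 'rV[rat]_m * rat) : set 'rV[R]_m :=
  ball (\row_i ratr (p.1 ord0 i) : 'rV[R]_m) (ratr p.2 : R).
(* Balls that are not contained in [U] are replaced by the empty set, so that the union runs over a
   countable type. *)
pose F p := if `[< B p `<=` U >] then B p else set0.
rewrite (_ : U = \bigcup_p F p); last first.
  apply/seteqP; split => x; last first.
    by move=> [p _]; rewrite /F; case: asboolP => // pU; exact: pU.
  move=> Ux; have /nbhs_ballP[e /= e0 eU] := open_nbhs_nbhs (conj oU Ux).
  have : 0 < e / 2 by rewrite divr_gt0.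
  move=> /rat_in_itvoo[q]; rewrite in_itv /= => /andP[q0 qe].
  have [c xc] := rat_dense_ball x q0.
  exists (c, q) => //; rewrite /F; case: asboolP => [_|]; first exact: ball_sym.
  case=> y /= cy; apply: eU; apply: (@le_ball _ _ x (ratr q + ratr q)); first lra.
  exact: ball_triangle xc cy.
apply: countable_bigcupT_measurable; first exact: countableP.
by move=> p; rewrite /F; case: asboolP => _; [exact: measurable_rV_ball|exact: measurable0].
Qed.

Lemma continuous_rV_measurable m (f : 'rV[R]_m -> R) : continuous f ->
  measurable_fun setT (f : _ -> measurableTypeR R).
Proof.
move=> cf; apply: (measurability _ (RGenOpens.measurableE R)) => //.
move=> _ [_ [a [b ->] <-]]; rewrite setTI; apply: open_rV_measurable.
by apply: open_comp; [move=> x _; exact: cf|exact: interval_open].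
Qed.

Lemma measurable_lin m (s : R) (a : 'rV[R]_m) :
  measurable_fun setT (fun x : 'rV[R]_m => s *: x + a).
Proof.
apply: measurable_fun_rVP => i; under eq_fun do rewrite !mxE.
by apply: measurable_funD => //; apply: measurable_funM => //; exact: measurable_coor.
Qed.

Lemma measurable_coor_fun d (T : measurableType d) m (f : T -> 'rV[R]_m) i :
  measurable_fun setT f -> measurable_fun setT (fun t => f t ord0 i : measurableTypeR R).
Proof.
by move=> mf; apply: (measurableT_comp (measurable_coor i)).
Qed.

Lemma measurable_dotp d (T : measurableType d) m (f g : T -> 'rV[R]_m) :
  measurable_fun setT f -> measurable_fun setT g ->
  measurable_fun setT (fun t => dotp (f t) (g t)).
Proof.
move=> mf mg; apply: measurable_sum => i.
by apply: measurable_funM; exact: measurable_coor_fun.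
Qed.

Lemma measurable_enorm d (T : measurableType d) m (f : T -> 'rV[R]_m) :
  measurable_fun setT f -> measurable_fun setT (fun t => enorm (f t)).
Proof.
move=> mf; apply: (measurableT_comp (f := @Num.sqrt R)).
  by apply: continuous_measurable_fun; exact: sqrt_continuous.
exact: measurable_dotp.
Qed.
End rV_measurability.

(** * Tonelli by coordinates and affine changes of variables *)

Section lebesgue_rV_integral.
Context (R : realType).
Local Notation mu := (lebesgue_rV R).

Lemma integral_rVS m (f : 'rV[R]_m.+1 -> \bar R) : measurable_fun setT f ->
  (forall x, (0 <= f x)%E) ->
  (\int[mu m.+1]_x f x = \int[lebesgue_measure]_t \int[mu m]_y f (rV_cons (t, y)))%E.
Proof.
move=> mf f0.
rewrite (ge0_integral_pushforward (measurable_rV_cons (m := m)))//=.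
rewrite preimage_setT fubini_tonelli1//.
exact: (measurableT_comp mf (measurable_rV_cons (m := m))).
Qed.

Lemma integral_rV0 (f : 'rV[R]_0 -> \bar R) : measurable_fun setT f ->
  (\int[mu 0%N]_x f x = f 0%R)%E.
Proof. by move=> mf; rewrite integral_dirac// diracT mul1e. Qed.

(** The image of Lebesgue measure under the affine map, multiplied by [|s|], gives half-open
    intervals their length; uniqueness identifies it with Lebesgue measure. *)
Lemma lebesgue_affine (s a : R) (f : R -> \bar R) : s != 0 ->
  measurable_fun setT f -> (forall x, (0 <= f x)%E) ->
  (\int[lebesgue_measure]_x f (s * x + a)%R = (`|s|^-1)%:E * \int[lebesgue_measure]_x f x)%E.
Proof.
move=> s0 mf f0.
pose phi := (fun x => s * x + a) : measurableTypeR R -> measurableTypeR R.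
have mphi : measurable_fun setT phi.
  by apply: measurable_funD => //; exact: measurable_funM.
have sn0 : 0 <= `|s| by [].
pose P := measure_function_pushforward__canonical__measure_function_Measure
  (@lebesgue_measure R) mphi.
have <- : (\int[mscale (NngNum sn0) P]_x f x =
   \int[lebesgue_measure]_x f x)%E.
  apply: eq_measure_integral => //= A mA _.
  apply/esym/lebesgue_measure_unique => //= _ [[p q]] _ <- /=.
  transitivity (`|s|%:E * lebesgue_measure (phi @^-1` `]p, q]%classic : set R))%E; last by [].
  have [sp|sm] := ltP 0 s.
    rewrite (_ : phi @^-1` _ = `]((p - a) / s), ((q - a) / s)]%classic); last first.
      apply/seteqP; split => x; rewrite /phi /= !in_itv /= ltr_pdivrMr// ler_pdivlMr//;
        rewrite ltrBlDr lerBrDr (mulrC x)//.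
    rewrite !lebesgue_measure_itv; cbn [fst snd]; rewrite !lte_fin ltr_pM2r ?invr_gt0// ltrD2r.
    case: ifP; rewrite ?mule0// => _; rewrite -!EFinD -EFinM gtr0_norm//.
    by congr EFin; field.
  have {}sm : s < 0 by rewrite lt_neqAle s0.
  (* A negative slope reverses the interval, so its closed end is now on the left. *)
  rewrite (_ : phi @^-1` _ = `[((q - a) / s), ((p - a) / s)[%classic); last first.
    apply/seteqP; split => x; rewrite /phi /= !in_itv /= ltr_ndivlMr// ler_ndivrMr//;
      by rewrite ltrBlDr lerBrDr (mulrC x) andbC.
  rewrite !lebesgue_measure_itv; cbn [fst snd]; rewrite !lte_fin ltr_nM2r ?invr_lt0// ltrD2r.
  case: ifP; rewrite ?mule0// => _; rewrite -!EFinD -EFinM ltr0_norm//.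
  by congr EFin; field.
rewrite ge0_integral_mscale//= ge0_integral_pushforward//= preimage_setT.
rewrite muleA -EFinM mulVf ?normr_eq0// mul1e//.
Qed.

Lemma scale_rV_cons m (s t : R) (y : 'rV[R]_m) (a : 'rV[R]_m.+1) :
  s *: rV_cons (t, y) + a =
  rV_cons (s * t + a ord0 ord0, s *: y + \row_j a ord0 (lift ord0 j)).
Proof.
by apply/rowP => i; rewrite !mxE /=; case: unliftP => [j|] ->; rewrite ?mxE.
Qed.

(** Induction on the dimension: Tonelli splits off one coordinate, and each coordinate contributes a
    factor [|s|^-1]. *)
Lemma integral_rV_affine m (s : R) (a : 'rV[R]_m) (f : 'rV[R]_m -> \bar R) :
  s != 0 -> measurable_fun setT f -> (forall x, (0 <= f x)%E) ->
  (\int[mu m]_x f (s *: x + a)%R = (`|s| ^- m)%:E * \int[mu m]_x f x)%E.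
Proof.
move=> s0; elim: m a f => [|m IH] a f mf f0.
  rewrite (integral_rV0 mf) integral_rV0; last first.
    exact: (measurableT_comp mf (measurable_lin _ _)).
  by rewrite expr0 invr1 mul1e; congr f; apply/rowP => -[].
rewrite !integral_rVS//; last exact: (measurableT_comp mf (measurable_lin _ _)).
have mfc : measurable_fun setT (f \o rV_cons (m := m)).
  exact: (measurableT_comp mf (measurable_rV_cons (m := m))).
pose g t := (\int[mu m]_y f (rV_cons (t, y)))%E.
have mg : measurable_fun setT g.
  apply: (@measurable_fun_fubini_tonelli_F _ _ _ _ _ (mu m) (f \o rV_cons (m := m)) mfc) => p; exact: f0.
transitivity (\int[lebesgue_measure]_t
   ((`|s| ^- m)%:E * g (s * t + a ord0 ord0)%R))%E.
  apply: eq_integral => t _; under eq_integral do rewrite scale_rV_cons.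
  rewrite (IH _ (fun y => f (rV_cons (s * t + a ord0 ord0, y))))//.
  exact: (measurable_slice1 mfc).
have mga : measurable_fun setT (fun t => g (s * t + a ord0 ord0)).
  by apply: (measurableT_comp mg); exact: measurable_funD.
transitivity ((`|s| ^- m)%:E * \int[lebesgue_measure]_t g (s * t + a ord0 ord0)%R)%E.
  apply: ge0_integralZl; [by []|exact: mga|by move=> t _; exact: integral_ge0|].
  by rewrite lee_fin invr_ge0 exprn_ge0.
rewrite (@lebesgue_affine s (a ord0 ord0) g)//; last by move=> t; exact: integral_ge0.
by rewrite muleA -EFinM -invfM -exprSr.
Qed.

(** Tonelli, one coordinate at a time. It evaluates volumes of boxes and the masses of the Poisson
    weight and kernel. *)
Lemma tensor_integral m (g : 'I_m -> R -> R) (c : 'I_m -> R) :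
  (forall i, measurable_fun setT (g i)) -> (forall i x, 0 <= g i x) ->
  (forall i, \int[lebesgue_measure]_t (g i t)%:E = (c i)%:E)%E ->
  (\int[mu m]_x (\prod_i g i (x ord0 i))%:E = (\prod_i c i)%:E)%E.
Proof.
elim: m g c => [|m IH] g c mg g0 gc.
  rewrite integral_rV0; first by rewrite !big_ord0.
  by apply/measurable_EFinP; apply: measurable_prod => -[].
rewrite integral_rVS//; last 2 first.
- apply/measurable_EFinP; apply: measurable_prod => i _.
  by apply: (measurableT_comp (mg i)); exact: measurable_coor.
- by move=> x; rewrite lee_fin prodr_ge0.
transitivity (\int[lebesgue_measure]_t ((\prod_(i < m) c (lift ord0 i)) * g ord0 t)%:E)%E.
  apply: eq_integral => t _.
  rewrite (@eq_integral _ _ _ _ _ (fun y : 'rV[R]_m => (g ord0 t)%:E *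
     (\prod_i g (lift ord0 i) (y ord0 i))%:E)%E); last first.
    move=> y _; rewrite big_ord_recl -EFinM mxE unlift_none; congr (_ * _)%:E.
    by apply: eq_bigr => i _; rewrite mxE liftK.
  rewrite ge0_integralZl//; last 3 first.
  - apply/measurable_EFinP; apply: measurable_prod => i _.
    by apply: (measurableT_comp (mg _)); exact: measurable_coor.
  - by move=> x _; rewrite lee_fin prodr_ge0.
  - by rewrite lee_fin.
  by rewrite (IH (fun i => g (lift ord0 i)) (fun i => c (lift ord0 i)))// -EFinM mulrC.
have c0 i : 0 <= c i by rewrite -lee_fin -gc; apply: integral_ge0 => t _; rewrite lee_fin.
under eq_integral do rewrite EFinM.
rewrite ge0_integralZl//; last 3 first.
- by apply/measurable_EFinP; exact: mg.
- by move=> t _; rewrite lee_fin.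
- by rewrite lee_fin prodr_ge0.
by rewrite gc -EFinM big_ord_recl mulrC.
Qed.
End lebesgue_rV_integral.

Section lebesgue_rV_corollaries.
Context (R : realType) (m : nat).
Local Notation mu := (lebesgue_rV R m).

Lemma affine_integrable (s : R) (a : 'rV[R]_m) (f : 'rV[R]_m -> R) : s != 0 ->
  mu.-integrable setT (EFin \o f) ->
  mu.-integrable setT (EFin \o (fun x => f (s *: x + a))).
Proof.
move=> s0 fi; have mf := Rintegrable_measurable fi.
have mfa : measurable_fun setT (fun x : 'rV[R]_m => f (s *: x + a)).
  exact: (measurableT_comp mf (measurable_lin _ _)).
apply/integrableP; split; first exact/measurable_EFinP.
rewrite /= (@integral_rV_affine _ _ s a (fun x => `|f x|%:E))//; last first.
  by apply/measurable_EFinP; exact: measurableT_comp.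
move: fi => /integrableP[_] /= I1.
by rewrite lte_mul_pinfty// ?lee_fin ?invr_ge0 ?exprn_ge0.
Qed.

Lemma Rintegral_affine (s : R) (a : 'rV[R]_m) (f : 'rV[R]_m -> R) : s != 0 ->
  mu.-integrable setT (EFin \o f) ->
  \int[mu]_x f (s *: x + a) = `|s| ^- m * \int[mu]_x f x.
Proof.
move=> s0 fi; have mf := Rintegrable_measurable fi.
pose fp x := Num.max (f x) 0; pose fn x := Num.max (- f x) 0.
have fE : f = (fun x => fp x - fn x).
  apply/funext => x; rewrite /fp /fn.
  by case: (leP (f x) 0) => h; case: (leP (- f x) 0) => h'; lra.
have mp : measurable_fun setT fp by exact: measurable_maxr.
have mn : measurable_fun setT fn by apply: measurable_maxr => //; exact: measurableT_comp.
have ip : mu.-integrable setT (EFin \o fp).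
  apply: Rintegrable_le (integrable_norm fi) => // x.
  rewrite /fp /= ger0_norm ?le_max ?lexx ?orbT// ge_max normr_ge0 ler_norm//.
have in_ : mu.-integrable setT (EFin \o fn).
  apply: Rintegrable_le (integrable_norm fi) => // x.
  rewrite /fn /= ger0_norm ?le_max ?lexx ?orbT// ge_max normr_ge0 -normrN ler_norm//.
have ge0 (g : 'rV[R]_m -> R) : measurable_fun setT g -> (forall x, 0 <= g x) ->
    mu.-integrable setT (EFin \o g) ->
    \int[mu]_x g (s *: x + a) = `|s| ^- m * \int[mu]_x g x.
  move=> mg g0 gi; rewrite /Rintegral.
  rewrite (@integral_rV_affine _ _ s a (fun x => (g x)%:E))//; last exact/measurable_EFinP.
  by rewrite -EFin_Rintegral.
rewrite fE RintegralB//; [|exact: affine_integrable|exact: affine_integrable].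
rewrite RintegralB// mulrBr !ge0//;
  by move=> x; rewrite /fp /fn le_max lexx orbT.
Qed.

Lemma Rintegral_shift (a : 'rV[R]_m) (f : 'rV[R]_m -> R) :
  mu.-integrable setT (EFin \o f) ->
  \int[mu]_x f (x + a) = \int[mu]_x f x.
Proof.
move=> fi; have := Rintegral_affine a (oner_neq0 R) fi.
rewrite normr1 expr1n invr1 mul1r => <-.
by apply: eq_Rintegral => x _; rewrite scale1r.
Qed.

Lemma Rintegral_opp (f : 'rV[R]_m -> R) :
  mu.-integrable setT (EFin \o f) ->
  \int[mu]_x f (- x) = \int[mu]_x f x.
Proof.
move=> fi; have N1 : (-1 : R) != 0 by rewrite oppr_eq0 oner_neq0.
have := Rintegral_affine 0 N1 fi.
rewrite normrN normr1 expr1n invr1 mul1r => <-.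
by apply: eq_Rintegral => x _; rewrite scaleN1r addr0.
Qed.

Lemma Rintegral_opp0 (f : 'rV[R]_m -> R) :
  mu.-integrable setT (EFin \o f) -> (forall x, f (- x) = - f x) ->
  \int[mu]_x f x = 0.
Proof.
move=> fi fN; have := Rintegral_opp fi.
under eq_Rintegral do rewrite fN -mulN1r.
by rewrite RintegralZl//; lra.
Qed.

Definition box (a b : 'I_m -> R) : set 'rV[R]_m :=
  [set x | forall i, a i < x ord0 i < b i].

Lemma boxE a b : box a b = \bigcap_(i in [set: 'I_m])
  [set x : 'rV[R]_m | `]a i, b i[%classic (x ord0 i)].
Proof.
apply/seteqP; split => x /=; first by move=> h i _; rewrite /= in_itv /=.
by move=> h i; have := h i Logic.I; rewrite /= in_itv.
Qed.

Lemma measurable_box a b : measurable (box a b).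
Proof.
rewrite boxE; apply: fin_bigcap_measurable => // i _.
rewrite -[X in measurable X]setTI.
exact: (@measurable_coor R m i measurableT `]a i, b i[%classic).
Qed.

Lemma lebesgue_itvoo (a b : R) : a < b -> lebesgue_measure `]a, b[%classic = (b - a)%:E.
Proof. by move=> ab; rewrite lebesgue_measure_itv /= lte_fin ab -EFinB. Qed.

Lemma indic_box (a b : 'I_m -> R) x :
  \1_(box a b) x = \prod_i \1_(`]a i, b i[%classic) (x ord0 i) :> R.
Proof.
rewrite indicE; case: (pselect (box a b x)) => h.
  by rewrite mem_set// big1// => i _; rewrite indicE mem_set//= in_itv /=; exact: h.
rewrite memNset//; move/existsNP : h => [i hi].
by rewrite (bigD1 i)//= indicE memNset ?mul0r//= in_itv.
Qed.

Lemma lebesgue_rV_box (a b : 'I_m -> R) : (forall i, a i < b i) ->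
  mu (box a b) = (\prod_i (b i - a i))%:E.
Proof.
move=> ab; have mB := measurable_box a b.
rewrite -[X in mu X]setIT -integral_indic//.
under eq_integral do rewrite indic_box.
rewrite (@tensor_integral R m (fun i t => \1_(`]a i, b i[%classic) t) (fun i => b i - a i))//.
  by move=> i; exact: measurable_indic.
by move=> i; rewrite integral_indic// setIT; exact: lebesgue_itvoo.
Qed.

Lemma ball_box (x : 'rV[R]_m) (e : R) : 0 < e ->
  ball x e = box (fun i => x ord0 i - e) (fun i => x ord0 i + e).
Proof.
move=> e0; rewrite coord_ball//; apply/seteqP; split => y /=.
  by move=> h i; have := h i Logic.I; rewrite /ball /= distrC ltr_distl.
by move=> h i _; rewrite /ball /= distrC ltr_distl h.
Qed.

Lemma bounded_setP (A : set 'rV[R]_m) : bounded_set A ->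
  exists2 r : R, 0 < r & forall x, A x -> `|x| < r.
Proof. by move=> /ex_strict_bound_gt0[r r0 h]; exists r. Qed.

Lemma coord_le_norm (x : 'rV[R]_m) i : `|x ord0 i| <= `|x|.
Proof.
rewrite [X in _ <= X]mx_normrE.
exact: (@le_bigmax _ _ _ _ (fun i : 'I_1 * 'I_m => `|x i.1 i.2|) (ord0, i)).
Qed.

Lemma norm_le_coord (x : 'rV[R]_m) (r : R) : 0 <= r ->
  (forall i, `|x ord0 i| <= r) -> `|x| <= r.
Proof.
move=> r0 h; rewrite [X in X <= _]mx_normrE; apply/bigmax_leP; split => // -[i j] _ /=.
by rewrite ord1.
Qed.

Lemma bounded_set_le (A : set 'rV[R]_m) (r : R) : (forall x, A x -> `|x| <= r) ->
  bounded_set A.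
Proof.
move=> Ar; exists r; split; first exact: num_real.
by move=> M rM x Ax /=; rewrite (le_trans (Ar _ Ax))// ltW.
Qed.

Lemma bounded_finite_measure (A : set 'rV[R]_m) : measurable A -> bounded_set A ->
  (mu A < +oo)%E.
Proof.
move=> mA /bounded_setP[r r0 Ar].
apply: (@le_lt_trans _ _ (mu (ball 0 r))).
  apply: le_measure; rewrite ?inE//; first exact: measurable_rV_ball.
  by move=> x Ax; rewrite -ball_normE /= sub0r normrN; exact: Ar.
by rewrite ball_box// lebesgue_rV_box ?ltry// => i; rewrite mxE; lra.
Qed.

Lemma open_measure_gt0 (A : set 'rV[R]_m) : open A -> A !=set0 -> (0 < mu A)%E.
Proof.
move=> oA [x Ax]; have /nbhs_ballP[e /= e0 eA] := open_nbhs_nbhs (conj oA Ax).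
apply: (@lt_le_trans _ _ (mu (ball x e))).
  rewrite ball_box// lebesgue_rV_box ?lte_fin; first by apply: prodr_gt0 => i _; lra.
  by move=> i; lra.
by apply: le_measure; rewrite ?inE//; [exact: measurable_rV_ball|exact: open_rV_measurable].
Qed.

Lemma integrable_indic_fin (A : set 'rV[R]_m) : measurable A -> (mu A < +oo)%E ->
  mu.-integrable setT (EFin \o (\1_A : _ -> R)).
Proof.
move=> mA fA; apply: ge0_Rintegrable => //.
by rewrite integral_indic// setIT.
Qed.

Lemma integrable_indic_ball (r : R) :
  mu.-integrable setT (EFin \o (\1_(ball (0 : 'rV[R]_m) r) : _ -> R)).
Proof.
have mA : measurable (ball (0 : 'rV[R]_m) r) by exact: measurable_rV_ball.
apply: integrable_indic_fin => //; apply: bounded_finite_measure => //.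
by apply: (@bounded_set_le _ r) => x; rewrite -ball_normE /= sub0r normrN => /ltW.
Qed.
End lebesgue_rV_corollaries.

(** * Poisson kernels, Bessel's inequality and Fourier inversion *)

Section one_dimensional_integrals.
Context (R : realType).
Local Notation leb := (@lebesgue_measure R).

(** The fundamental theorem of calculus on the half-line, doubled by symmetry. [F] is an
    antiderivative only for positive arguments because integrands may contain [|x|]. *)
Lemma ge0_even_integral (f F : R -> R) (l : R) :
  (forall x, 0 <= f x) -> continuous f -> (forall x, f (- x) = f x) ->
  (forall x, 0 < x -> derivable F x 1 /\ 'D_1 F x = f x) -> F x @[x --> 0^'+] --> F 0 ->
  F x @[x --> +oo] --> l ->
  (\int[leb]_x (f x)%:E = (2 * (l - F 0))%:E)%E.
Proof.
move=> f0 cf fN dF F0 Fl.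
rewrite ge0_symfun_integralT//; last by move=> x /=; rewrite fN.
rewrite (_ : [set x | _] = `[0, +oo[%classic); last first.
  by apply/seteqP; split => x/=; rewrite in_itv/= andbT.
rewrite (@ge0_continuous_FTC2y _ f F 0 l)//.
- exact: continuous_subspaceT.
- by move=> x x0; case: (dF x x0).
- by move=> x; rewrite in_itv /= andbT => x0; rewrite derive1E; case: (dF x x0).
Qed.

Lemma integral_oneDsqr_inv :
  (\int[leb]_x ((1 + x ^+ 2)^-1)%:E = pi%:E)%E.
Proof.
rewrite (@ge0_even_integral _ atan (pi / 2)).
- by rewrite atan0 subr0; congr EFin; field.
- by move=> x; rewrite invr_ge0 addr_ge0// sqr_ge0.
- move=> x; apply: cvgV; first by rewrite gt_eqF// ltr_pwDl// sqr_ge0.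
  by apply: cvgD; [exact: cvg_cst|exact: exprn_continuous].
- by move=> x; rewrite sqrrN.
- by move=> x _; case: (is_derive1_atan x).
- by apply: cvg_at_right_filter; exact: continuous_atan.
- exact: cvgy_atan.
Qed.

Lemma is_derive_linM (x z : R) : is_derive x 1 (fun y => y * z) z.
Proof.
have -> : (fun y : R => y * z) = z \*: id by apply/funext => y /=; rewrite /= mulrC.
by apply: is_derive_eq; rewrite /GRing.scale /= mulr1.
Qed.

Lemma is_derive_sinM (x z : R) : is_derive x 1 (fun y => sin (y * z)) (cos (x * z) * z).
Proof.
by apply: (@is_derive1_comp _ sin (fun y => y * z)); exact: is_derive_linM.
Qed.

Lemma is_derive_cosM (x z : R) : is_derive x 1 (fun y => cos (y * z)) (- sin (x * z) * z).
Proof.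
by apply: (@is_derive1_comp _ cos (fun y => y * z)); exact: is_derive_linM.
Qed.

Lemma is_derive_expRN (x : R) : is_derive x 1 (fun y => expR (- y)) (- expR (- x)).
Proof.
rewrite -mulrN1; apply: (@is_derive1_comp _ expR -%R).
Qed.

Lemma cvg_expRN : expR (- x : R) @[x --> +oo] --> 0.
Proof. exact: cvgr_expR. Qed.

(** With [1 + cos] in place of [cos] the integrand is nonnegative, as the improper fundamental
    theorem demands; [poisson_cos1] subtracts the extra mass again. *)
Lemma integral_exp_cos1 (z : R) :
  (\int[leb]_x (expR (- `|x|) * (1 + cos (x * z)))%:E = (2 + 2 / (1 + z ^+ 2))%:E)%E.
Proof.
have z1 : 0 < 1 + z ^+ 2 by rewrite ltr_pwDl// sqr_ge0.
have z0 : 1 + z ^+ 2 != 0 by rewrite gt_eqF.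
(* The fraction is the antiderivative of the cosine term, found by integrating by parts twice; the
   [- 1] accounts for the plain exponential. *)
pose F x := expR (- x) * ((z * sin (x * z) - cos (x * z)) / (1 + z ^+ 2) - 1).
have dF (x : R) : is_derive x 1 F (expR (- x) * (1 + cos (x * z))).
  pose G : R -> R := (1 + z ^+ 2)^-1 \*: (z \*: (fun y : R => sin (y * z)) - (fun y => cos (y * z))) - cst 1.
  have -> : F = (fun x => expR (- x)) * G.
    by apply/funext => y; rewrite /F /G /GRing.scale /= [X in _ * (X - 1)]mulrC.
  have dG : is_derive x 1 G ((1 + z ^+ 2)^-1 *: (z *: (cos (x * z) * z) + sin (x * z) * z)).
    have ds := is_derive_sinM x z; have dc := is_derive_cosM x z.
    by apply: is_derive_eq; rewrite subr0 mulNr opprK.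
  have de := is_derive_expRN x.
  apply: is_derive_eq.
  have -> : G x = (1 + z ^+ 2)^-1 * (z * sin (x * z) - cos (x * z)) - 1 by [].
  by rewrite /GRing.scale /=; field.
rewrite (@ge0_even_integral _ F 0).
- by rewrite /F oppr0 expR0 mul0r sin0 cos0; congr EFin; field.
- by move=> x; rewrite mulr_ge0 ?expR_ge0// -lerBlDl sub0r cos_geN1.
- move=> x; apply: cvgM.
    apply: continuous_comp; last exact: continuous_expR.
    by apply: continuousN; exact: norm_continuous.
  apply: cvgD; first exact: cvg_cst.
  apply: continuous_comp; last exact: continuous_cos.
  exact: mulrr_continuous.
- by move=> x; rewrite normrN mulNr cosN.
- by move=> x x0; rewrite gtr0_norm//; case: (dF x).
- apply: cvg_at_right_filter; apply: differentiable_continuous.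
  by apply/derivable1_diffP; case: (dF 0).
pose C := (`|z| + 1) / (1 + z ^+ 2) + 1.
have FC x : `|F x| <= C * expR (- x).
  rewrite /F normrM ger0_norm ?expR_ge0// mulrC ler_wpM2r ?expR_ge0//.
  rewrite /C (le_trans (ler_normB _ _))// normr1 lerD2r normrM [`|_^-1|]gtr0_norm ?invr_gt0//.
  rewrite ler_wpM2r ?invr_ge0 ?(ltW z1)// (le_trans (ler_normB _ _))// normrM lerD//.
    by rewrite -[leRHS]mulr1 ler_wpM2l// ler_norml sin_geN1 sin_le1.
  by rewrite ler_norml cos_geN1 cos_le1.
have e0 : C * expR (- x) @[x --> +oo] --> 0.
  by rewrite -(mulr0 C); apply: cvgM; [exact: cvg_cst|exact: cvg_expRN].
apply: (@squeeze_cvgr _ _ _ _ (fun x => - (C * expR (- x))) (fun x => C * expR (- x))).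
- by near=> x; rewrite -ler_norml.
- by rewrite -oppr0; exact: cvgN.
- exact: e0.
Unshelve. all: by end_near. Qed.
End one_dimensional_integrals.

(** * Poisson weights and kernels in several variables *)

Section poisson.
Context (R : realType).
Local Notation mu := (lebesgue_rV R).

Lemma integrable_rV_cons m (f : 'rV[R]_m.+1 -> R) :
  (mu m.+1).-integrable setT (EFin \o f) ->
  (lebesgue_measure \x mu m)%E.-integrable setT (EFin \o (f \o rV_cons (m := m))).
Proof.
move=> /integrableP[mf fi]; apply/integrableP; split.
  exact: (measurableT_comp mf (measurable_rV_cons (m := m))).
move: fi; rewrite (ge0_integral_pushforward (measurable_rV_cons (m := m)))//=.
by apply/measurable_EFinP; apply: measurableT_comp => //; exact/measurable_EFinP.
Qed.

Lemma Rintegral_rVS m (f : 'rV[R]_m.+1 -> R) : (mu m.+1).-integrable setT (EFin \o f) ->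
  (forall t, (mu m).-integrable setT (EFin \o (fun y => f (rV_cons (t, y))))) ->
  \int[mu m.+1]_x f x = \int[lebesgue_measure]_t \int[mu m]_y f (rV_cons (t, y)).
Proof.
move=> fi ft; rewrite /Rintegral; congr fine.
transitivity (\int[lebesgue_measure \x mu m]_p (f (rV_cons p))%:E)%E.
  rewrite (integral_pushforward (measurable_rV_cons (m := m)))//.
  - by have /integrableP[] := fi.
  - exact: integrable_rV_cons.
rewrite -(integral12_prod_meas1 (integrable_rV_cons fi)).
by apply: eq_integral => t _; rewrite /fubini_F -EFin_Rintegral//; exact: ft.
Qed.

(** The weight damps frequency integrals and the kernel is its cosine transform, see [poisson_cos].
    Positivity of the weight serves Fatou's lemma, positivity of the kernel the Schur test in
    [bessel_weight]. *)
Definition poisson_weight m (x : 'rV[R]_m) : R := \prod_i expR (- `|x ord0 i|).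
Definition poisson_kernel m (z : 'rV[R]_m) : R := \prod_i (2 / (1 + z ord0 i ^+ 2)).

Lemma poisson_weight_cons m t (y : 'rV[R]_m) :
  poisson_weight (rV_cons (t, y)) = expR (- `|t|) * poisson_weight y.
Proof.
rewrite /poisson_weight big_ord_recl mxE unlift_none; congr (_ * _).
by apply: eq_bigr => i _; rewrite mxE liftK.
Qed.

Lemma poisson_weight_ge0 m (x : 'rV[R]_m) : 0 <= poisson_weight x.
Proof. by apply: prodr_ge0 => i _; rewrite expR_ge0. Qed.

Lemma measurable_expNnorm : measurable_fun setT (fun x : R => expR (- `|x|)).
Proof.
apply: continuous_measurable_fun => x.
apply: continuous_comp; last exact: continuous_expR.
by apply: continuousN; exact: norm_continuous.
Qed.

Lemma measurable_poisson_weight m : measurable_fun setT (@poisson_weight m).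
Proof.
apply: measurable_prod => i _; apply: (measurableT_comp measurable_expNnorm).
exact: measurable_coor.
Qed.

(** The case [z = 0] of [integral_exp_cos1], where the integrand is doubled and the value is 4. *)
Lemma integral_expNnorm : (\int[lebesgue_measure]_x (expR (- `|x : R|))%:E = 2%:R%:E)%E.
Proof.
have := integral_exp_cos1 (0 : R).
under eq_integral => x _ do rewrite mulr0 cos0 EFinM.
rewrite ge0_integralZr//; last first.
- by apply/measurable_EFinP; exact: measurable_expNnorm.
set I := (X in (X * _)%E); rewrite expr0n /= addr0 divr1.
move=> IE; suff : I = 2%:R%:E by []; move: IE.
have : (0 <= I)%E by apply: integral_ge0 => x _; rewrite lee_fin expR_ge0.
case: I => [r||]//= r0.
  by rewrite -EFinM => -[rE]; congr EFin; lra.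
by rewrite gt0_mulye// lte_fin; lra.
Qed.

Lemma integrable_poisson_weight m : (mu m).-integrable setT (EFin \o @poisson_weight m).
Proof.
apply: ge0_Rintegrable; [exact: measurable_poisson_weight|exact: poisson_weight_ge0|].
rewrite (@tensor_integral R m (fun=> fun x => expR (- `|x|)) (fun=> 2)) ?ltry//.
- by move=> _; exact: measurable_expNnorm.
- by move=> _; exact: integral_expNnorm.
Qed.

Lemma poisson_kernel_ge0 m (x : 'rV[R]_m) : 0 <= poisson_kernel x.
Proof. by apply: prodr_ge0 => i _; rewrite divr_ge0// addr_ge0// sqr_ge0. Qed.

Lemma measurable_oneDsqr_inv : measurable_fun setT (fun x : R => 2 / (1 + x ^+ 2)).
Proof.
apply: continuous_measurable_fun => x; apply: cvgM; first exact: cvg_cst.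
apply: cvgV; first by rewrite gt_eqF// ltr_pwDl// sqr_ge0.
by apply: cvgD; [exact: cvg_cst|exact: exprn_continuous].
Qed.

Lemma measurable_poisson_kernel m : measurable_fun setT (@poisson_kernel m).
Proof.
apply: measurable_prod => i _; apply: (measurableT_comp measurable_oneDsqr_inv).
exact: measurable_coor.
Qed.

Lemma ge0_integral_poisson_kernel m :
  (\int[mu m]_z (poisson_kernel z)%:E = ((2 * pi) ^+ m)%:E)%E.
Proof.
rewrite (@tensor_integral R m (fun=> fun x => 2 / (1 + x ^+ 2)) (fun=> 2 * pi)).
- by rewrite prodr_const card_ord.
- by move=> _; exact: measurable_oneDsqr_inv.
- by move=> _ x; rewrite divr_ge0// addr_ge0// sqr_ge0.
move=> _; under eq_integral => x _ do rewrite EFinM.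
rewrite ge0_integralZl//; first by rewrite integral_oneDsqr_inv -EFinM.
- apply/measurable_EFinP; apply: continuous_measurable_fun => x.
  apply: cvgV; first by rewrite gt_eqF// ltr_pwDl// sqr_ge0.
  by apply: cvgD; [exact: cvg_cst|exact: exprn_continuous].
- by move=> x _; rewrite lee_fin invr_ge0 addr_ge0// sqr_ge0.
Qed.

Lemma integrable_poisson_kernel m : (mu m).-integrable setT (EFin \o @poisson_kernel m).
Proof.
apply: ge0_Rintegrable; [exact: measurable_poisson_kernel|exact: poisson_kernel_ge0|].
by rewrite ge0_integral_poisson_kernel ltry.
Qed.

Lemma integral_poisson_kernel m : \int[mu m]_z poisson_kernel z = (2 * pi) ^+ m.
Proof. by rewrite /Rintegral ge0_integral_poisson_kernel. Qed.

Lemma dotp_cons m t (y : 'rV[R]_m) (z : 'rV[R]_m.+1) :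
  dotp (rV_cons (t, y)) z = t * z ord0 ord0 + dotp y (\row_j z ord0 (lift ord0 j)).
Proof.
rewrite /dotp big_ord_recl mxE unlift_none; congr (_ + _).
by apply: eq_bigr => i _; rewrite !mxE liftK.
Qed.

Lemma dotpNl m (x y : 'rV[R]_m) : dotp (- x) y = - dotp x y.
Proof. by rewrite /dotp -sumrN; apply: eq_bigr => i _; rewrite mxE mulNr. Qed.

Lemma measurable_cos_dotp m (z : 'rV[R]_m) : measurable_fun setT (fun x => cos (dotp x z)).
Proof.
apply: (measurableT_comp (f := @cos R)).
  by apply: continuous_measurable_fun; exact: continuous_cos.
exact: measurable_dotp.
Qed.

Lemma measurable_sin_dotp m (z : 'rV[R]_m) : measurable_fun setT (fun x => sin (dotp x z)).
Proof.
apply: (measurableT_comp (f := @sin R)).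
  by apply: continuous_measurable_fun; exact: continuous_sin.
exact: measurable_dotp.
Qed.

Lemma normr_cos_le1 (x : R) : `|cos x| <= 1.
Proof. by rewrite ler_norml cos_geN1 cos_le1. Qed.

Lemma normr_sin_le1 (x : R) : `|sin x| <= 1.
Proof. by rewrite ler_norml sin_geN1 sin_le1. Qed.

Lemma integrableM_cos m (f : 'rV[R]_m -> R) z : (mu m).-integrable setT (EFin \o f) ->
  (mu m).-integrable setT (EFin \o (fun x => f x * cos (dotp x z))).
Proof.
move=> fi; apply: RintegrableM_bounded fi _ (fun x => normr_cos_le1 _).
exact: measurable_cos_dotp.
Qed.

Lemma integrableM_sin m (f : 'rV[R]_m -> R) z : (mu m).-integrable setT (EFin \o f) ->
  (mu m).-integrable setT (EFin \o (fun x => f x * sin (dotp x z))).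
Proof.
move=> fi; apply: RintegrableM_bounded fi _ (fun x => normr_sin_le1 _).
exact: measurable_sin_dotp.
Qed.

Lemma poisson_sin m (z : 'rV[R]_m) : \int[mu m]_x (poisson_weight x * sin (dotp x z)) = 0.
Proof.
apply: Rintegral_opp0; first exact/integrableM_sin/integrable_poisson_weight.
move=> x; rewrite dotpNl sinN mulrN; congr (- (_ * _)).
by apply: eq_bigr => i _; rewrite mxE normrN.
Qed.

Lemma integrable_expNnorm :
  lebesgue_measure.-integrable setT (EFin \o (fun x : R => expR (- `|x|))).
Proof.
apply: ge0_Rintegrable; [exact: measurable_expNnorm|by move=> x; exact: expR_ge0|].
by rewrite integral_expNnorm ltry.
Qed.

Lemma measurable_cosM (z : R) : measurable_fun setT (fun x : R => cos (x * z)).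
Proof.
apply: continuous_measurable_fun => x.
by apply: continuous_comp; [exact: mulrr_continuous|exact: continuous_cos].
Qed.

Lemma poisson_cos1 (z : R) :
  \int[lebesgue_measure]_x (expR (- `|x|) * cos (x * z)) = 2 / (1 + z ^+ 2).
Proof.
have e1 := integrable_expNnorm.
have ec : lebesgue_measure.-integrable setT (EFin \o (fun x : R => expR (- `|x|) * cos (x * z))).
  apply: RintegrableM_bounded e1 _ (fun x => normr_cos_le1 _).
  exact: measurable_cosM.
have := integral_exp_cos1 z.
under eq_integral => x _ do rewrite mulrDr mulr1.
rewrite -(EFin_Rintegral (RintegrableD e1 ec)).
rewrite RintegralD// => -[]; rewrite [X in X + _ = _]/Rintegral integral_expNnorm /=.
by move/addrI.
Qed.

(** Induction by the addition formula for the cosine. The product of sines contributes nothing, as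
    the weight is even in the remaining coordinates. *)
Lemma poisson_cos m (z : 'rV[R]_m) :
  \int[mu m]_x (poisson_weight x * cos (dotp x z)) = poisson_kernel z.
Proof.
elim: m z => [|m IH] z.
  rewrite /Rintegral integral_rV0.
    by rewrite /poisson_weight /dotp /poisson_kernel !big_ord0 cos0 mulr1.
  apply/measurable_EFinP; have := integrableM_cos z (integrable_poisson_weight 0).
  exact: Rintegrable_measurable.
pose z' := \row_j z ord0 (lift ord0 j).
have iw := integrable_poisson_weight m.
have tE (t : R) y : poisson_weight (rV_cons (t, y)) * cos (dotp (rV_cons (t, y)) z) =
    expR (- `|t|) * cos (t * z ord0 ord0) * (poisson_weight y * cos (dotp y z')) -
    expR (- `|t|) * sin (t * z ord0 ord0) * (poisson_weight y * sin (dotp y z')).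
  by rewrite poisson_weight_cons dotp_cons cosD; ring.
have ti t : (mu m).-integrable setT (EFin \o (fun y =>
    poisson_weight (rV_cons (t, y)) * cos (dotp (rV_cons (t, y)) z))).
  rewrite (_ : (fun y => _) = (fun y =>
    expR (- `|t|) * cos (t * z ord0 ord0) * (poisson_weight y * cos (dotp y z')) -
    expR (- `|t|) * sin (t * z ord0 ord0) * (poisson_weight y * sin (dotp y z')))); last first.
    by apply/funext => y; exact: tE.
  by apply: RintegrableB; apply: RintegrableZ; [exact: integrableM_cos|exact: integrableM_sin].
rewrite Rintegral_rVS//; last exact/integrableM_cos/integrable_poisson_weight.
transitivity (\int[lebesgue_measure]_t (expR (- `|t|) * cos (t * z ord0 ord0) * poisson_kernel z')).
  apply: eq_Rintegral => t _; under eq_Rintegral => y _ do rewrite tE.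
  rewrite RintegralB//; last 2 first.
  - by apply: RintegrableZ; exact: integrableM_cos.
  - by apply: RintegrableZ; exact: integrableM_sin.
  rewrite RintegralZl//; last exact: integrableM_cos.
  rewrite RintegralZl//; last exact: integrableM_sin.
  by rewrite IH poisson_sin mulr0 subr0.
rewrite RintegralZr//; last first.
  apply: RintegrableM_bounded (integrable_expNnorm) _ (fun x => normr_cos_le1 _).
  exact: measurable_cosM.
rewrite poisson_cos1 /poisson_kernel big_ord_recl; congr (_ * _).
by apply: eq_bigr => i _; rewrite mxE.
Qed.
End poisson.

(** * Cosine and sine transforms *)

Section trigonometric_transforms.
Context (R : realType) (m : nat).
Local Notation X := 'rV[R]_m.
Local Notation mu := (lebesgue_rV R m).
Local Notation L1 f := (mu.-integrable setT (EFin \o f)).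
Implicit Types f g : X -> R.

(** For real [f] the unnormalised Fourier transform is [Fcos f - i Fsin f]. *)
Definition Fcos f (xi : X) : R := \int[mu]_x (f x * cos (dotp x xi)).
Definition Fsin f (xi : X) : R := \int[mu]_x (f x * sin (dotp x xi)).

Lemma dotpC (x y : X) : dotp x y = dotp y x.
Proof. by apply: eq_bigr => i _; rewrite mulrC. Qed.

Lemma dotpDl (x y z : X) : dotp (x + y) z = dotp x z + dotp y z.
Proof. by rewrite /dotp -big_split; apply: eq_bigr => i _; rewrite !mxE mulrDl. Qed.

Lemma dotpZl c (x z : X) : dotp (c *: x) z = c * dotp x z.
Proof. by rewrite /dotp mulr_sumr; apply: eq_bigr => i _; rewrite !mxE mulrA. Qed.

Lemma dotpBl (x y z : X) : dotp (x - y) z = dotp x z - dotp y z.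
Proof. by rewrite dotpDl dotpNl. Qed.

Lemma dotpDr (x y z : X) : dotp z (x + y) = dotp z x + dotp z y.
Proof. by rewrite dotpC dotpDl !(dotpC _ z). Qed.

Lemma dotpZr c (x z : X) : dotp z (c *: x) = c * dotp z x.
Proof. by rewrite dotpC dotpZl dotpC. Qed.

Lemma dotpNr (x z : X) : dotp z (- x) = - dotp z x.
Proof. by rewrite dotpC dotpNl dotpC. Qed.

Lemma measurable_cos_dotp2 : measurable_fun setT (fun p : X * X => cos (dotp p.1 p.2)).
Proof.
apply: (measurableT_comp (f := @cos R)).
  by apply: continuous_measurable_fun; exact: continuous_cos.
exact: measurable_dotp.
Qed.

Lemma measurable_sin_dotp2 : measurable_fun setT (fun p : X * X => sin (dotp p.1 p.2)).
Proof.
apply: (measurableT_comp (f := @sin R)).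
  by apply: continuous_measurable_fun; exact: continuous_sin.
exact: measurable_dotp.
Qed.

Lemma Fcos_swap f g : L1 f -> L1 g ->
  \int[mu]_x (f x * Fcos g x) = \int[mu]_x (g x * Fcos f x).
Proof.
move=> fi gi.
have := fubini_kernel fi gi measurable_cos_dotp2 (fun p => normr_cos_le1 _).
by rewrite /Fcos => <-; under eq_Rintegral => x _ do under eq_Rintegral => y _ do rewrite dotpC.
Qed.

Lemma Fsin_swap f g : L1 f -> L1 g ->
  \int[mu]_x (f x * Fsin g x) = \int[mu]_x (g x * Fsin f x).
Proof.
move=> fi gi.
have := fubini_kernel fi gi measurable_sin_dotp2 (fun p => normr_sin_le1 _).
by rewrite /Fsin => <-; under eq_Rintegral => x _ do under eq_Rintegral => y _ do rewrite dotpC.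
Qed.

Lemma Fcos_bound f xi : L1 f -> `|Fcos f xi| <= \int[mu]_x `|f x|.
Proof.
move=> fi; rewrite (le_trans (le_normr_Rintegral _ _))//; first exact: integrableM_cos.
apply: le_Rintegral => //.
- exact/integrable_norm/integrableM_cos.
- exact/integrable_norm.
- by move=> x _; rewrite normrM -[leRHS]mulr1 ler_wpM2l// normr_cos_le1.
Qed.

Lemma Fsin_bound f xi : L1 f -> `|Fsin f xi| <= \int[mu]_x `|f x|.
Proof.
move=> fi; rewrite (le_trans (le_normr_Rintegral _ _))//; first exact: integrableM_sin.
apply: le_Rintegral => //.
- exact/integrable_norm/integrableM_sin.
- exact/integrable_norm.
- by move=> x _; rewrite normrM -[leRHS]mulr1 ler_wpM2l// normr_sin_le1.
Qed.

(** Positive and negative parts reduce the claim to the measurability statement of Tonelli's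
    theorem. *)
Lemma measurable_Rintegral_param (F : X * X -> R) : measurable_fun setT F ->
  (forall x, L1 (fun y => F (x, y))) ->
  measurable_fun setT (fun x => \int[mu]_y F (x, y)).
Proof.
move=> mF iF.
have E x : \int[mu]_y F (x, y) =
    fine (\int[mu]_y (Num.max (F (x, y)) 0)%:E) - fine (\int[mu]_y (Num.max (- F (x, y)) 0)%:E).
  rewrite -(@RintegralB _ _ _ mu setT (fun y => Num.max (F (x, y)) 0) (fun y => Num.max (- F (x, y)) 0))//.
  - apply: eq_Rintegral => y _.
    by case: (leP (F (x, y)) 0) => h; case: (leP (- F (x, y)) 0) => h'; lra.
  - have := iF x; move=> iFx; apply: Rintegrable_le (integrable_norm iFx).
      apply: measurable_maxr => //; exact: Rintegrable_measurable iFx.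
    move=> y; rewrite /= ger0_norm ?le_max ?lexx ?orbT// ge_max normr_ge0 ler_norm//.
  - have := iF x; move=> iFx; apply: Rintegrable_le (integrable_norm iFx).
      apply: measurable_maxr => //; apply: measurableT_comp => //.
      exact: Rintegrable_measurable iFx.
    move=> y; rewrite /= ger0_norm ?le_max ?lexx ?orbT// ge_max normr_ge0 -normrN ler_norm//.
rewrite (funext E); apply: measurable_funB; apply: (measurableT_comp (f := fine)) => //;
  [apply: (@measurable_fun_fubini_tonelli_F _ _ _ _ _ mu (fun p => (Num.max (F p) 0)%:E))|
   apply: (@measurable_fun_fubini_tonelli_F _ _ _ _ _ mu (fun p => (Num.max (- F p) 0)%:E))].
- by apply/measurable_EFinP; exact: measurable_maxr.
- by move=> p; rewrite lee_fin le_max lexx orbT.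
- by apply/measurable_EFinP; apply: measurable_maxr => //; exact: measurableT_comp.
- by move=> p; rewrite lee_fin le_max lexx orbT.
Qed.

Lemma measurable_Fcos f : L1 f -> measurable_fun setT (Fcos f).
Proof.
move=> fi; apply: (@measurable_Rintegral_param (fun p => f p.2 * cos (dotp p.2 p.1))).
  apply: measurable_funM.
    by apply: measurableT_comp => //; exact: Rintegrable_measurable fi.
  apply: (measurableT_comp (f := @cos R)).
    by apply: continuous_measurable_fun; exact: continuous_cos.
  exact: measurable_dotp.
by move=> xi; exact: integrableM_cos.
Qed.

Lemma measurable_Fsin f : L1 f -> measurable_fun setT (Fsin f).
Proof.
move=> fi; apply: (@measurable_Rintegral_param (fun p => f p.2 * sin (dotp p.2 p.1))).
  apply: measurable_funM.
    by apply: measurableT_comp => //; exact: Rintegrable_measurable fi.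
  apply: (measurableT_comp (f := @sin R)).
    by apply: continuous_measurable_fun; exact: continuous_sin.
  exact: measurable_dotp.
by move=> xi; exact: integrableM_sin.
Qed.

(** As [d] decreases to 0, [weight d] increases to 1, while its cosine transform [kern d] is an
    approximate identity of mass [(2 * pi) ^+ m]. *)
Definition weight (d : R) (x : X) := poisson_weight (d *: x).
Definition kern (d : R) (z : X) := d ^- m * poisson_kernel (d^-1 *: z).

Lemma weight_ge0 d x : 0 <= weight d x. Proof. exact: poisson_weight_ge0. Qed.

Lemma weight_le1 d x : weight d x <= 1.
Proof.
apply: prodr_ile1 => i _; rewrite expR_ge0 /= -expR0 ler_expR oppr_le0//.
Qed.

Lemma kern_ge0 d z : 0 < d -> 0 <= kern d z.
Proof.
by move=> d0; rewrite mulr_ge0 ?poisson_kernel_ge0// invr_ge0 exprn_ge0// ltW.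
Qed.

Lemma integrable_weight d : 0 < d -> L1 (weight d).
Proof.
move=> d0; have := affine_integrable (0 : X) (lt0r_neq0 d0) (integrable_poisson_weight R m).
by apply: eq_integrable => // x _; rewrite /= addr0.
Qed.

Lemma weight_cos d (z : X) : 0 < d ->
  \int[mu]_x (weight d x * cos (dotp x z)) = kern d z.
Proof.
move=> d0; rewrite /kern -poisson_cos.
have d0' : d != 0 by rewrite gt_eqF.
have := Rintegral_affine (0 : X) d0' (integrableM_cos (d^-1 *: z) (integrable_poisson_weight R m)).
rewrite gtr0_norm// => <-; apply: eq_Rintegral => x _.
by rewrite addr0 dotpZl dotpZr mulrA divff// mul1r.
Qed.

Lemma integrable_kern d : 0 < d -> L1 (kern d).
Proof.
move=> d0; apply: RintegrableZ.
have d0' : d^-1 != 0 by rewrite gt_eqF// invr_gt0.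
have := affine_integrable (0 : X) d0' (integrable_poisson_kernel R m).
by apply: eq_integrable => // x _; rewrite /= addr0.
Qed.

Lemma integral_kern d : 0 < d -> \int[mu]_z kern d z = (2 * pi) ^+ m.
Proof.
move=> d0; have d0' : d^-1 != 0 by rewrite gt_eqF// invr_gt0.
have := Rintegral_affine (0 : X) d0' (integrable_poisson_kernel R m).
under eq_Rintegral do rewrite addr0.
rewrite normfV gtr0_norm// -exprVn invrK integral_poisson_kernel => E.
rewrite RintegralZl//; last first.
  have := affine_integrable (0 : X) d0' (integrable_poisson_kernel R m).
  by apply: eq_integrable => // x _; rewrite /= addr0.
by rewrite E mulrA mulVf ?mul1r// expf_neq0// gt_eqF.
Qed.

Lemma measurable_kern d : 0 < d -> measurable_fun setT (kern d).
Proof. by move=> d0; exact: Rintegrable_measurable (integrable_kern d0). Qed.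


(** Each transform of [f] is exchanged against the damped one, and [cos (a - b)] recombines the
    cosine and sine terms into the transform of the weight at [x - y]. *)
Lemma bessel_bilinear f d : 0 < d -> L1 f ->
  \int[mu]_xi (weight d xi * (Fcos f xi ^+ 2 + Fsin f xi ^+ 2)) =
  \int[mu]_x (f x * \int[mu]_y (f y * kern d (x - y))).
Proof.
move=> d0 fi; pose w := weight d.
have iw : L1 w by exact: integrable_weight.
have iwc : L1 (fun xi => w xi * Fcos f xi).
  by apply: RintegrableM_bounded iw (measurable_Fcos fi) (fun xi => Fcos_bound xi fi).
have iws : L1 (fun xi => w xi * Fsin f xi).
  by apply: RintegrableM_bounded iw (measurable_Fsin fi) (fun xi => Fsin_bound xi fi).
have iwcc : L1 (fun xi => w xi * Fcos f xi * Fcos f xi).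
  by apply: RintegrableM_bounded iwc (measurable_Fcos fi) (fun xi => Fcos_bound xi fi).
have iwss : L1 (fun xi => w xi * Fsin f xi * Fsin f xi).
  by apply: RintegrableM_bounded iws (measurable_Fsin fi) (fun xi => Fsin_bound xi fi).
transitivity (\int[mu]_xi (w xi * Fcos f xi * Fcos f xi) +
    \int[mu]_xi (w xi * Fsin f xi * Fsin f xi)).
  by rewrite -RintegralD//; apply: eq_Rintegral => xi _; rewrite /w; ring.
rewrite Fcos_swap// Fsin_swap// -RintegralD//; last 2 first.
- exact: RintegrableM_bounded fi (measurable_Fcos iwc) (fun xi => Fcos_bound xi iwc).
- exact: RintegrableM_bounded fi (measurable_Fsin iws) (fun xi => Fsin_bound xi iws).
apply: eq_Rintegral => x _; rewrite -mulrDr; congr (_ * _).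
have iC : L1 (fun xi => w xi * cos (dotp xi x)) by exact: integrableM_cos.
have iS : L1 (fun xi => w xi * sin (dotp xi x)) by exact: integrableM_sin.
transitivity (\int[mu]_xi (w xi * cos (dotp xi x) * Fcos f xi) +
    \int[mu]_xi (w xi * sin (dotp xi x) * Fsin f xi)).
  by congr (_ + _); apply: eq_Rintegral => xi _; rewrite mulrAC.
rewrite Fcos_swap// Fsin_swap// -RintegralD//; last 2 first.
- exact: RintegrableM_bounded fi (measurable_Fcos iC) (fun xi => Fcos_bound xi iC).
- exact: RintegrableM_bounded fi (measurable_Fsin iS) (fun xi => Fsin_bound xi iS).
apply: eq_Rintegral => y _; rewrite -mulrDr; congr (_ * _).
rewrite -weight_cos// /Fcos /Fsin -RintegralD//; last 2 first.
- exact: integrableM_cos.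
- exact: integrableM_sin.
by apply: eq_Rintegral => xi _; rewrite [dotp xi (x - y)]dotpC dotpBl cosB !(dotpC xi) /w; ring.
Qed.

Lemma kern_bound d z : 0 < d -> `|kern d z| <= d ^- m * 2 ^+ m.
Proof.
move=> d0; rewrite ger0_norm ?kern_ge0// ler_wpM2l ?invr_ge0 ?exprn_ge0 ?(ltW d0)//.
rewrite -[leRHS](_ : \prod_(i < m) 2 = _); last by rewrite prodr_const card_ord.
apply: ler_prod => i _; rewrite divr_ge0 ?addr_ge0 ?sqr_ge0//=.
by rewrite ler_pdivrMr ?ltr_pwDl ?sqr_ge0// ler_peMr// lerDl sqr_ge0.
Qed.

Lemma measurable_sub2 : measurable_fun setT (fun p : X * X => p.1 - p.2).
Proof.
apply: measurable_fun_rVP => i; under eq_fun do rewrite !mxE.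
by apply: measurable_funB; apply: measurable_coor_fun.
Qed.

Lemma measurable_kern2 d : 0 < d -> measurable_fun setT (fun p : X * X => kern d (p.1 - p.2)).
Proof. by move=> d0; exact: (measurableT_comp (measurable_kern d0) measurable_sub2). Qed.

Lemma integrable_kern_shift d x : 0 < d -> L1 (fun y => kern d (x - y)).
Proof.
move=> d0; have N1 : (-1 : R) != 0 by rewrite oppr_eq0 oner_neq0.
have := affine_integrable x N1 (integrable_kern d0).
by apply: eq_integrable => // y _; rewrite /= scaleN1r addrC.
Qed.

Lemma kernN d z : kern d (- z) = kern d z.
Proof.
rewrite /kern; congr (_ * _); apply: eq_bigr => i _.
by rewrite scalerN mxE sqrrN.
Qed.

Lemma integral_kern_shift d x : 0 < d -> \int[mu]_y kern d (x - y) = (2 * pi) ^+ m.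
Proof.
move=> d0; rewrite -(integral_kern d0) -(Rintegral_shift (- x) (integrable_kern d0)).
by apply: eq_Rintegral => y _; rewrite -kernN opprB.
Qed.

Lemma integrable_kern_conv g d x : 0 < d -> L1 g -> L1 (fun y => g y * kern d (x - y)).
Proof.
move=> d0 gi; apply: RintegrableM_bounded gi _ (fun y => kern_bound _ d0).
exact: (measurable_slice1 (measurable_kern2 d0)).
Qed.

Lemma ge0_integral_kern_conv g d : 0 < d -> L1 g -> (forall x, 0 <= g x) ->
  (\int[mu]_x (\int[mu]_y (g y * kern d (x - y)))%:E =
   ((2 * pi) ^+ m * \int[mu]_y g y)%:E)%E.
Proof.
move=> d0 gi g0.
pose F (p : X * X) := (g p.2 * kern d (p.1 - p.2))%:E.
have mF : measurable_fun setT F.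
  apply/measurable_EFinP; apply: measurable_funM; last exact: measurable_kern2.
  by apply: measurableT_comp => //; exact: Rintegrable_measurable gi.
have F0 p : (0 <= F p)%E by rewrite lee_fin mulr_ge0// kern_ge0.
transitivity (\int[mu]_x \int[mu]_y F (x, y))%E.
  by apply: eq_integral => x _; rewrite EFin_Rintegral//; exact: integrable_kern_conv.
transitivity (\int[mu]_y \int[mu]_x F (x, y))%E; first exact: (fubini_tonelli _ mF F0).
transitivity (\int[mu]_y ((2 * pi) ^+ m * g y)%:E)%E.
  apply: eq_integral => y _; rewrite -EFin_Rintegral; last first.
    rewrite /=; apply: RintegrableZ; have := integrable_kern_shift y d0.
    by apply: eq_integrable => // x _ /=; rewrite -kernN opprB.
  rewrite /= RintegralZl//; last first.
    have := integrable_kern_shift y d0.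
    by apply: eq_integrable => // x _ /=; rewrite -kernN opprB.
  rewrite mulrC; congr (_ * _)%:E.
  transitivity (\int[mu]_x kern d (y - x)); last exact: integral_kern_shift.
  by apply: eq_Rintegral => x _; rewrite -kernN opprB.
by rewrite -RintegralZl// EFin_Rintegral//; exact: RintegrableZ.
Qed.

(** Schur test: [f x * f y] is at most half the sum of the squares, and the nonnegative symmetric
    kernel has mass [(2 * pi) ^+ m] in either variable. *)
Lemma bessel_weight f d : 0 < d -> L1 f -> L1 (fun x => f x ^+ 2) ->
  \int[mu]_xi (weight d xi * (Fcos f xi ^+ 2 + Fsin f xi ^+ 2)) <=
  (2 * pi) ^+ m * \int[mu]_x f x ^+ 2.
Proof.
move=> d0 fi f2i; rewrite bessel_bilinear//.
pose K := (2 * pi) ^+ m : R.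
pose h x := \int[mu]_y (f y ^+ 2 * kern d (x - y)).
have f20 x : 0 <= f x ^+ 2 by rewrite sqr_ge0.
have h0 x : 0 <= h x by apply: Rintegral_ge0 => y _; rewrite mulr_ge0// kern_ge0.
have mh : measurable_fun setT h.
  apply: (@measurable_Rintegral_param (fun p => f p.2 ^+ 2 * kern d (p.1 - p.2))).
    apply: measurable_funM; last exact: measurable_kern2.
    apply: measurable_funX; apply: measurableT_comp => //.
    exact: Rintegrable_measurable fi.
  by move=> x; exact: integrable_kern_conv.
have hE := ge0_integral_kern_conv d0 f2i f20.
have ih : L1 h by apply: ge0_Rintegrable => //; rewrite hE ltry.
apply: (@le_trans _ _ (\int[mu]_x (2^-1 * (K * f x ^+ 2) + 2^-1 * h x))).
  apply: le_Rintegral => //.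
  - exact: (integrable_kernel1 fi fi (measurable_kern2 d0) (fun z => kern_bound _ d0)).
  - by apply: RintegrableD; apply: RintegrableZ => //; exact: RintegrableZ.
  move=> x _; rewrite -RintegralZl//; last exact: integrable_kern_conv.
  have -> : K * f x ^+ 2 = \int[mu]_y (f x ^+ 2 * kern d (x - y)).
    by rewrite RintegralZl// ?integral_kern_shift 1?mulrC//; exact: integrable_kern_shift.
  rewrite -mulrDr -RintegralD//; last 2 first.
  - by apply: RintegrableZ; exact: integrable_kern_shift.
  - exact: integrable_kern_conv.
  rewrite -RintegralZl//; last first.
    by apply: RintegrableD; [apply: RintegrableZ; exact: integrable_kern_shift|exact: integrable_kern_conv].
  apply: le_Rintegral => //.
  - by apply: RintegrableZ; exact: integrable_kern_conv.
  - by apply: RintegrableZ; apply: RintegrableD;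
      [apply: RintegrableZ; exact: integrable_kern_shift|exact: integrable_kern_conv].
  move=> y _; have k0 := kern_ge0 (x - y) d0.
  have := mulr_ge0 k0 (sqr_ge0 (f x - f y)); nra.
rewrite RintegralD//; last 2 first.
- by apply: RintegrableZ; exact: RintegrableZ.
- exact: RintegrableZ.
rewrite RintegralZl//; last exact: RintegrableZ.
rewrite RintegralZl// RintegralZl// [X in _ + _ * X]/Rintegral hE /=.
rewrite -/K; lra.
Qed.

Lemma weight_cvg1 x : weight n.+1%:R^-1 x @[n --> \oo] --> (1 : R).
Proof.
have E n : weight n.+1%:R^-1 x = expR (- (n.+1%:R^-1 * \sum_i `|x ord0 i|)).
  rewrite mulr_sumr -sumrN expR_sum; apply: eq_bigr => i _.
  by rewrite mxE normrM ger0_norm.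
under eq_fun do rewrite E.
suff : expR (- (n.+1%:R^-1 * \sum_i `|x ord0 i|)) @[n --> \oo] -->
    expR (- (0 * \sum_i `|x ord0 i|)) by rewrite mul0r oppr0 expR0.
apply: cvg_comp; last exact: continuous_expR.
apply: cvgN; apply: cvgM; last exact: cvg_cst.
exact: cvg_harmonic.
Qed.

(** Fatou's lemma turns the damped bounds, which are uniform in the damping, into the inequality
    half of Plancherel's theorem. *)
Lemma bessel f : L1 f -> L1 (fun x => f x ^+ 2) ->
  (\int[mu]_xi (Fcos f xi ^+ 2 + Fsin f xi ^+ 2)%:E <=
  ((2 * pi) ^+ m * \int[mu]_x f x ^+ 2)%:E)%E.
Proof.
move=> fi f2i; pose q xi := Fcos f xi ^+ 2 + Fsin f xi ^+ 2.
have mq : measurable_fun setT q.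
  by apply: measurable_funD; apply: measurable_funX; [exact: measurable_Fcos|exact: measurable_Fsin].
have q0 xi : 0 <= q xi by rewrite addr_ge0// sqr_ge0.
(* This crude bound serves the integrability of the damped integrand; the estimate itself comes from
   [bessel_weight]. *)
have qB xi : `|q xi| <= (\int[mu]_x `|f x|) ^+ 2 + (\int[mu]_x `|f x|) ^+ 2.
  rewrite ger0_norm// lerD// -[leLHS]real_normK ?num_real//;
  by rewrite lerXn2r ?nnegrE ?Rintegral_ge0// ?Fcos_bound ?Fsin_bound.
apply: (@fatou_bound _ _ _ mu (fun n xi => weight n.+1%:R^-1 xi * q xi)).
- move=> n; apply: measurable_funM => //.
  by apply: Rintegrable_measurable (integrable_weight _); rewrite invr_gt0.
- by move=> n xi; rewrite mulr_ge0// weight_ge0.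
- by move=> xi; rewrite -[X in _ --> X]mul1r; apply: cvgM; [exact: weight_cvg1|exact: cvg_cst].
- move=> n; have n0 : 0 < n.+1%:R^-1 :> R by rewrite invr_gt0.
  rewrite -EFin_Rintegral ?lee_fin; first exact: bessel_weight.
  exact: RintegrableM_bounded (integrable_weight n0) mq qB.
Qed.

Lemma integrable_Fsqr f : L1 f -> L1 (fun x => f x ^+ 2) ->
  L1 (fun xi => Fcos f xi ^+ 2 + Fsin f xi ^+ 2).
Proof.
move=> fi f2i; apply: ge0_Rintegrable.
- by apply: measurable_funD; apply: measurable_funX; [exact: measurable_Fcos|exact: measurable_Fsin].
- by move=> xi; rewrite addr_ge0// sqr_ge0.
- by apply: (le_lt_trans (bessel fi f2i)); rewrite ltry.
Qed.

Lemma bessel_R f : L1 f -> L1 (fun x => f x ^+ 2) ->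
  \int[mu]_xi (Fcos f xi ^+ 2 + Fsin f xi ^+ 2) <= (2 * pi) ^+ m * \int[mu]_x f x ^+ 2.
Proof.
move=> fi f2i; rewrite -lee_fin EFin_Rintegral; first exact: bessel.
exact: integrable_Fsqr.
Qed.

(** The substitution [y = x + d z] moves the scale from the kernel into the argument of [a]; then
    the fixed Poisson kernel times [B] dominates and continuity at the single point [x] gives the
    limit. *)
Lemma kern_conv_cvg (a : X -> R) (B : R) x : measurable_fun setT a ->
  (forall y, `|a y| <= B) -> {for x, continuous a} -> L1 a ->
  \int[mu]_y (a y * kern n.+1%:R^-1 (x - y)) @[n --> \oo] --> (2 * pi) ^+ m * a x.
Proof.
move=> ma aB ca ai.
have E n : \int[mu]_y (a y * kern n.+1%:R^-1 (x - y)) =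
   \int[mu]_z (poisson_kernel z * a (x + n.+1%:R^-1 *: z)).
  pose d : R := n.+1%:R^-1; have d0 : 0 < d by rewrite invr_gt0.
  have d0' : d != 0 by rewrite gt_eqF.
  have := Rintegral_affine x d0' (integrable_kern_conv x d0 ai).
  rewrite gtr0_norm// => H.
  have -> : \int[mu]_y (a y * kern d (x - y)) = d ^+ m * (d ^- m * \int[mu]_y (a y * kern d (x - y))).
    by rewrite mulrA divff ?mul1r// expf_neq0.
  rewrite -H -RintegralZl//; last first.
    exact: affine_integrable (integrable_kern_conv x d0 ai).
  apply: eq_Rintegral => z _; rewrite -/d opprD addrCA addrN addr0 kernN /kern.
  rewrite scalerA mulVf// scale1r [d *: z + x]addrC.
  by rewrite mulrCA mulVKf ?expf_neq0// mulrC.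
under eq_fun do rewrite E.
have -> : (2 * pi) ^+ m * a x = \int[mu]_z (poisson_kernel z * a x).
  by rewrite RintegralZr ?integral_poisson_kernel//; exact: integrable_poisson_kernel.
apply: (@Rdominated_cvg _ _ _ mu _ _ (fun z => B * poisson_kernel z)).
- move=> n; apply: measurable_funM; first exact: measurable_poisson_kernel.
  under eq_fun do rewrite addrC.
  exact: (measurableT_comp ma (measurable_lin _ _)).
- by apply: measurable_funM => //; exact: measurable_poisson_kernel.
- move=> z; apply: cvgM; first exact: cvg_cst.
  apply: cvg_comp; last exact: ca.
  suff : x + n.+1%:R^-1 *: z @[n --> \oo] --> x + 0 *: z by rewrite scale0r addr0.
  apply: cvgD; first exact: cvg_cst.
  by apply: cvgZ; [exact: cvg_harmonic|exact: cvg_cst].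
- by apply: RintegrableZ; exact: integrable_poisson_kernel.
- by move=> n z; rewrite normrM mulrC [X in _ * X]ger0_norm ?poisson_kernel_ge0// ler_wpM2r// poisson_kernel_ge0.
Qed.

(** The damped inversion integral equals the Poisson mean of [a]. One limit is [kern_conv_cvg]; in
    the other, integrability of the transforms lets the damping be removed by dominated
    convergence. *)
Lemma inversion (a : X -> R) (B : R) x : (forall y, `|a y| <= B) ->
  {for x, continuous a} -> L1 a -> L1 (Fcos a) -> L1 (Fsin a) ->
  \int[mu]_xi (cos (dotp xi x) * Fcos a xi + sin (dotp xi x) * Fsin a xi) = (2 * pi) ^+ m * a x.
Proof.
move=> aB ca ai ci si; have ma := Rintegrable_measurable ai.
have H1 := kern_conv_cvg ma aB ca ai.
have iC : L1 (fun xi => Fcos a xi * cos (dotp xi x)) by exact: integrableM_cos.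
have iS : L1 (fun xi => Fsin a xi * sin (dotp xi x)) by exact: integrableM_sin.
pose q xi := cos (dotp xi x) * Fcos a xi + sin (dotp xi x) * Fsin a xi.
have iq : L1 q.
  have := RintegrableD iC iS; apply: eq_integrable => // xi _ /=.
  by rewrite /q mulrC [X in _ + X]mulrC.
suff H2 : \int[mu]_y (a y * kern n.+1%:R^-1 (x - y)) @[n --> \oo] --> \int[mu]_xi q xi.
  exact: cvg_unique H2 H1.
have E n : \int[mu]_y (a y * kern n.+1%:R^-1 (x - y)) = \int[mu]_xi (weight n.+1%:R^-1 xi * q xi).
  pose d : R := n.+1%:R^-1; have d0 : 0 < d by rewrite invr_gt0.
  have iw := integrable_weight d0.
  have iwC := integrableM_cos x iw; have iwS := integrableM_sin x iw.
  have iaC := RintegrableM_bounded ai (measurable_Fcos iwC) (fun y => Fcos_bound y iwC).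
  have iaS := RintegrableM_bounded ai (measurable_Fsin iwS) (fun y => Fsin_bound y iwS).
  transitivity (\int[mu]_y (a y * Fcos (fun xi => weight d xi * cos (dotp xi x)) y) +
      \int[mu]_y (a y * Fsin (fun xi => weight d xi * sin (dotp xi x)) y)).
    rewrite -RintegralD//; apply: eq_Rintegral => y _; rewrite -mulrDr; congr (_ * _).
    rewrite -weight_cos// /Fcos /Fsin -RintegralD//; [|exact: integrableM_cos|exact: integrableM_sin].
    by apply: eq_Rintegral => xi _; rewrite -/d [dotp xi (x - y)]dotpC dotpBl cosB !(dotpC xi); ring.
  rewrite Fcos_swap// Fsin_swap// -RintegralD//; last 2 first.
  - exact: RintegrableM_bounded iwC (measurable_Fcos ai) (fun y => Fcos_bound y ai).
  - exact: RintegrableM_bounded iwS (measurable_Fsin ai) (fun y => Fsin_bound y ai).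
  by apply: eq_Rintegral => xi _; rewrite /q -/d; ring.
under eq_fun do rewrite E.
apply: (@Rdominated_cvg _ _ _ mu _ _ (fun xi => `|q xi|)).
- move=> n; apply: measurable_funM; last exact: Rintegrable_measurable iq.
  by apply: Rintegrable_measurable (integrable_weight _); rewrite invr_gt0.
- exact: Rintegrable_measurable iq.
- by move=> xi; rewrite -[X in _ --> X]mul1r; apply: cvgM; [exact: weight_cvg1|exact: cvg_cst].
- exact: integrable_norm.
- by move=> n xi; rewrite normrM ger0_norm ?weight_ge0// ler_piMl// weight_le1.
Qed.
End trigonometric_transforms.

(** * Test functions and their transforms *)

Section quadratic_remainder.
Context (R : realType) (V : normedModType R).

(** Serves linear forms, transforms and the bump profile at 0, whose remainders are all bounded by
    an explicit multiple of the square. *)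
Lemma quadratic_diff (f : V -> R) (L : {linear V -> R}) (C : R) (x : V) :
  continuous L -> (forall h, `|f (h + x) - f x - L h| <= C * `|h| ^+ 2) ->
  is_diff x f L.
Proof.
move=> cL fL.
have H : f \o shift x = cst (f x) + L +o_ 0 id.
  apply/eqaddoP => _/posnumP[e].
  (* [C] may be zero or negative, so the division below is by [|C| + 1]. *)
  have C1 : 0 < `|C| + 1 by rewrite ltr_pwDr.
  near=> h.
  rewrite -[X in `|X|]/(f (h + x) - (f x + L h)) opprD addrA (le_trans (fL h))//.
  rewrite expr2 mulrA ler_wpM2r//.
  have h1 : `|h| <= e%:num / (`|C| + 1).
    near: h; apply: nbhs0_le; by rewrite divr_gt0.
  apply: (@le_trans _ _ ((`|C| + 1) * `|h|)).
    by rewrite ler_wpM2r// (le_trans (ler_norm C))// lerDl.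
  by rewrite -ler_pdivlMl// mulrC.
have dE := diff_unique cL H.
split; last exact: dE.
by apply/diff_locallyP; rewrite dE.
Unshelve. all: by end_near. Qed.

Lemma is_derive_line (g : V -> R) (x v : V) (t : R) : differentiable g (x + t *: v) ->
  is_derive t 1 (fun s => g (x + s *: v)) ('D_v g (x + t *: v)).
Proof.
move=> dg.
have dl : is_diff t (fun s : R => x + s *: v) ( *:%R^~ v).
  by apply: is_diff_eq; rewrite add0r.
have dc : differentiable (fun s : R => g (x + s *: v)) t.
  by apply: (@differentiable_comp _ _ _ _ (fun s : R => x + s *: v) g).
split; first exact/derivable1_diffP.
rewrite deriveE// (@diff_comp _ _ _ _ (fun s : R => x + s *: v) g)//=.
by rewrite diff_val /= scale1r deriveE.
Qed.

Lemma lipschitz_line (g : V -> R) (B : R) (v : V) : (forall x, differentiable g x) ->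
  (forall x, `|'D_v g x| <= B) ->
  forall (x : V) (t : R), 0 <= t -> `|g (x + t *: v) - g x| <= B * t.
Proof.
move=> dg gB x t t0.
have [||c _] := @MVT_segment R (fun s => g (x + s *: v)) (fun s => 'D_v g (x + s *: v)) 0 t t0.
- by move=> s _; exact: is_derive_line.
- apply: derivable_within_continuous => s _.
  by case: (is_derive_line (dg (x + s *: v))).
rewrite scale0r addr0 subr0 => ->.
by rewrite normrM (ger0_norm t0) ler_wpM2r.
Qed.
End quadratic_remainder.

(** * Smoothness by induction on partial derivatives *)

Section smooth_functions.
Context (R : realType) (m : nat).
Local Notation X := 'rV[R]_m.
Local Notation mu := (lebesgue_rV R m).
Local Notation L1 f := (mu.-integrable setT (EFin \o f)).
Implicit Types (f g a b : X -> R) (i : 'I_m).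

Definition pd i g : X -> R := fun x => 'D_(delta_mx ord0 i) g x.

(** A word in [smooth] adds derivatives on the outside; here the derivative is taken first, on the
    inside. A class of differentiable functions closed under [pd] is then smooth by induction on
    [n]. *)
Fixpoint smoothn n g : Prop := (forall x, differentiable g x) /\
  if n is n'.+1 then forall i, smoothn n' (pd i g) else True.

Lemma smoothn_diff n g : smoothn n g -> forall x, differentiable g x.
Proof. by case: n => [|n] []. Qed.

Lemma smoothnW n g : smoothn n.+1 g -> smoothn n g.
Proof. by elim: n g => [|n IH] g [dg sg]; split => // i; exact/IH/sg. Qed.

Lemma pderiv_rcons al i g : pderiv (rcons al i) g = pderiv al (pd i g).
Proof. by rewrite /pderiv foldr_rcons. Qed.

Lemma smoothP g : smooth g <-> forall n, smoothn n g.
Proof.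
split=> [sg n|].
  elim: n g sg => [|n IH] g sg; split => //; try exact: (sg [::]).
  move=> i; apply: IH => al x; have := sg (rcons al i) x.
  by rewrite pderiv_rcons.
move=> H al; elim/last_ind: al g H => [|al i IH] g H x; first exact: (smoothn_diff (H 0)).
by rewrite pderiv_rcons; apply: IH => n; case: (H n.+1) => _; apply.
Qed.

Lemma pdD i f g : (forall x, differentiable f x) -> (forall x, differentiable g x) ->
  pd i (fun x => f x + g x) = (fun x => pd i f x + pd i g x).
Proof. by move=> df dg; apply/funext => x; apply: deriveD; exact: diff_derivable. Qed.

Lemma pdM i f g : (forall x, differentiable f x) -> (forall x, differentiable g x) ->
  pd i (fun x => f x * g x) = (fun x => f x * pd i g x + g x * pd i f x).
Proof. by move=> df dg; apply/funext => x; apply: deriveM; exact: diff_derivable. Qed.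

Lemma pd_cst i c : pd i (fun=> c) = fun=> 0.
Proof. by apply/funext => x; exact: derive_cst. Qed.

Lemma smoothnD n f g : smoothn n f -> smoothn n g -> smoothn n (fun x => f x + g x).
Proof.
elim: n f g => [|n IH] f g [df sf] [dg sg]; split => //; try by move=> x; exact: differentiableD.
by move=> i; rewrite pdD//; apply: IH; [exact: sf|exact: sg].
Qed.

Lemma smoothn_cst n c : smoothn n (fun=> c).
Proof.
elim: n c => [|n IH] c; split => //; try by move=> x; exact: differentiable_cst.
by move=> i; rewrite pd_cst.
Qed.

Lemma smoothnM n f g : smoothn n f -> smoothn n g -> smoothn n (fun x => f x * g x).
Proof.
elim: n f g => [|n IH] f g sf sg.
  by split => // x; apply: differentiableM; [exact: (smoothn_diff sf)|exact: (smoothn_diff sg)].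
have [df pf] := sf; have [dg pg] := sg.
split; first by move=> x; exact: differentiableM.
by move=> i; rewrite pdM//; apply: smoothnD; apply: IH; (try exact: smoothnW); [exact: pg|exact: pf].
Qed.

Lemma smoothD f g : smooth f -> smooth g -> smooth (fun x => f x + g x).
Proof. by move=> /smoothP sf /smoothP sg; apply/smoothP => n; exact: smoothnD. Qed.

Lemma smoothM f g : smooth f -> smooth g -> smooth (fun x => f x * g x).
Proof. by move=> /smoothP sf /smoothP sg; apply/smoothP => n; exact: smoothnM. Qed.

Lemma smooth_cst c : smooth (fun _ : X => c).
Proof. by apply/smoothP => n; exact: smoothn_cst. Qed.

Lemma smooth_prod (I : Type) (r : seq I) (F : I -> X -> R) :
  (forall k, smooth (F k)) -> smooth (fun x => \prod_(k <- r) F k x).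
Proof.
move=> sF; elim: r => [|k r IH].
  by under eq_fun do rewrite big_nil; exact: smooth_cst.
by under eq_fun do rewrite big_cons; exact: smoothM.
Qed.

Lemma smooth_pd i g : smooth g -> smooth (pd i g).
Proof. by move=> /smoothP sg; apply/smoothP => n; case: (sg n.+1) => _; apply. Qed.

Lemma smooth_differentiable g : smooth g -> forall x, differentiable g x.
Proof. by move=> sg; exact: (sg [::]). Qed.

Lemma smooth_continuous g : smooth g -> continuous g.
Proof. by move=> sg x; exact/differentiable_continuous/smooth_differentiable. Qed.

(** Registered as a linear map below, because it is the candidate differential in
    [quadratic_diff]. *)
Definition dotp_with (v : X) : X -> R := fun x => dotp x v.

Fact dotp_with_linear (v : X) : linear (dotp_with v).
Proof. by move=> c x y; rewrite /dotp_with dotpDl dotpZl. Qed.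
HB.instance Definition _ (v : X) := GRing.isLinear.Build R X R *%R
  (dotp_with v) (dotp_with_linear v).

Lemma norm_dotp (x y : X) : `|dotp x y| <= m%:R * `|x| * `|y|.
Proof.
rewrite /dotp (le_trans (ler_norm_sum _ _ _))//.
rewrite (le_trans (ler_sum _ (G := fun=> `|x| * `|y|) _))//.
  by move=> i _; rewrite normrM ler_pM// coord_le_norm.
by rewrite sumr_const card_ord -mulrA mulr_natl.
Qed.

Lemma continuous_dotp_with (v : X) : continuous (dotp_with v).
Proof.
apply: bounded_linear_continuous; exists (m%:R * `|v|); split; first exact: num_real.
move=> B vB; near=> y; rewrite /= (le_trans (norm_dotp _ _))// (le_trans _ (ltW vB))//.
rewrite mulrAC ler_piMr ?mulr_ge0//; near: y.
Unshelve. all: by end_near. Qed.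

Lemma is_diff_dotp (v x : X) : is_diff x (dotp_with v) (dotp_with v).
Proof.
apply: (@quadratic_diff _ _ _ _ 0); first exact: continuous_dotp_with.
by move=> h; rewrite raddfD/= addrK subrr normr0 mul0r.
Qed.

Lemma dotp_delta i (v : X) : dotp (delta_mx ord0 i) v = v ord0 i.
Proof.
rewrite /dotp (bigD1 i)//= mxE !eqxx mul1r big1 ?addr0// => j ji.
by rewrite mxE eqxx (negbTE ji) mul0r.
Qed.

Lemma is_diff_dotpD (v x : X) (d : R) :
  is_diff x (fun x : X => dotp x v + d) (dotp_with v).
Proof. by have h := is_diff_dotp v x; apply: is_diff_eq; rewrite addr0. Qed.

Lemma differentiable_comp_dotp (phi : R -> R) (v : X) (d : R) :
  (forall x, derivable phi x 1) ->
  forall x, differentiable (fun x => phi (dotp x v + d)) x.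
Proof.
move=> dphi x; have dl := is_diff_dotpD v x d.
apply: (@differentiable_comp _ _ _ _ (fun x : X => dotp x v + d) phi) => //.
exact/derivable1_diffP.
Qed.

Lemma pd_comp_dotp (phi : R -> R) (v : X) (d : R) i :
  (forall x, derivable phi x 1) ->
  pd i (fun x => phi (dotp x v + d)) = (fun x => v ord0 i * 'D_1 phi (dotp x v + d)).
Proof.
move=> dphi; apply/funext => x; have dl := is_diff_dotpD v x d.
have dp y : differentiable phi y by exact/derivable1_diffP.
rewrite /pd deriveE; last exact: differentiable_comp_dotp.
rewrite (@diff_comp _ _ _ _ (fun x : X => dotp x v + d) phi)//=.
rewrite diff_val /= /dotp_with dotp_delta -[v ord0 i]mulr1 -[v ord0 i * 1]/(v ord0 i *: 1) linearZ /=.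
by rewrite deriveE// /GRing.scale /= mulr1.
Qed.

(** If differentiation permutes a family of profiles of one real variable, every derivative of a
    member along an affine form is a multiple of another member. Used for coordinates and for the
    flat functions [theta p]. *)
Lemma smooth_family (I : Type) (Phi : I -> R -> R) (s : I -> I) (v : X) (d : R) :
  (forall k x, derivable (Phi k) x 1 /\ 'D_1 (Phi k) x = Phi (s k) x) ->
  forall k, smooth (fun x => Phi k (dotp x v + d)).
Proof.
move=> H k; apply/smoothP => n; elim: n k => [|n IH] k.
  by split => //; apply: differentiable_comp_dotp => x; case: (H k x).
split; first by apply: differentiable_comp_dotp => x; case: (H k x).
move=> i; rewrite pd_comp_dotp; last by move=> x; case: (H k x).
apply: smoothnM; first exact: smoothn_cst.
rewrite (_ : (fun x => _) = (fun x : X => Phi (s k) (dotp x v + d))); first exact: IH.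
by apply/funext => x; case: (H k (dotp x v + d)).
Qed.

Lemma derive_sin (x : R) : derivable sin x 1 /\ 'D_1 sin x = cos x.
Proof. by case: (is_derive_sin x). Qed.

Lemma derive_cos (x : R) : derivable cos x 1 /\ 'D_1 cos x = - sin x.
Proof. by case: (is_derive_cos x). Qed.

Lemma pd_sin_dotp i (v : X) : pd i (fun x => sin (dotp x v)) = (fun x => v ord0 i * cos (dotp x v)).
Proof.
have := @pd_comp_dotp sin v 0 i (fun x => (derive_sin x).1).
under eq_fun do rewrite addr0; move=> ->; apply/funext => x.
by rewrite addr0 (derive_sin _).2.
Qed.

Lemma pd_cos_dotp i (v : X) : pd i (fun x => cos (dotp x v)) = (fun x => - (v ord0 i * sin (dotp x v))).
Proof.
have := @pd_comp_dotp cos v 0 i (fun x => (derive_cos x).1).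
under eq_fun do rewrite addr0; move=> ->; apply/funext => x.
by rewrite addr0 (derive_cos _).2 mulrN.
Qed.

Lemma smooth_trig_dotp (v : X) : forall n,
  smoothn n (fun x => sin (dotp x v)) /\ smoothn n (fun x => cos (dotp x v)).
Proof.
have ds : forall x : X, differentiable (fun x => sin (dotp x v)) x.
  move=> x; have := @differentiable_comp_dotp sin v 0 (fun x => (derive_sin x).1) x.
  by under eq_fun do rewrite addr0.
have dc : forall x : X, differentiable (fun x => cos (dotp x v)) x.
  move=> x; have := @differentiable_comp_dotp cos v 0 (fun x => (derive_cos x).1) x.
  by under eq_fun do rewrite addr0.
elim=> [//|n [IHs IHc]]; split; split => // i.
  by rewrite pd_sin_dotp; apply: smoothnM IHc; exact: smoothn_cst.
rewrite pd_cos_dotp.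
rewrite (_ : (fun x => _) = (fun x : X => - v ord0 i * sin (dotp x v))).
  by apply: smoothnM IHs; exact: smoothn_cst.
by apply/funext => x; rewrite mulNr.
Qed.

Lemma smooth_sin_dotp (v : X) : smooth (fun x => sin (dotp x v)).
Proof. by apply/smoothP => n; case: (smooth_trig_dotp v n). Qed.

Lemma smooth_cos_dotp (v : X) : smooth (fun x => cos (dotp x v)).
Proof. by apply/smoothP => n; case: (smooth_trig_dotp v n). Qed.

Lemma smooth_coord i : smooth (fun x : X => x ord0 i).
Proof.
have E : (fun x : X => x ord0 i) = (fun x => dotp x (delta_mx ord0 i) + 0).
  by apply/funext => x; rewrite dotpC dotp_delta addr0.
pose Phi (k : nat) : R -> R := if k is 0%N then id else if k is 1%N then cst 1 else cst 0.
rewrite E; apply: (@smooth_family nat Phi S _ 0 _ 0%N) => -[|[|k]] x /=.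
- by split; [exact: derivable_id|exact: derive_id].
- by split; [exact: derivable_cst|exact: derive_cst].
- by split; [exact: derivable_cst|exact: derive_cst].
Qed.
End smooth_functions.

(** * Bounded supports and vanishing integrals of derivatives *)

Section test_functions.
Context (R : realType) (m : nat).
Local Notation X := 'rV[R]_m.
Local Notation mu := (lebesgue_rV R m).
Local Notation L1 f := (mu.-integrable setT (EFin \o f)).
Implicit Types (f g a b : X -> R) (i : 'I_m).

Definition bounded_support a := exists2 r : R, 0 < r & forall x, r < `|x| -> a x = 0.

Lemma bounded_support_mul f a : bounded_support a -> bounded_support (fun x => f x * a x).
Proof. by move=> [r r0 h]; exists r => // x /h ->; rewrite mulr0. Qed.

Lemma bounded_support_pd i a : bounded_support a -> bounded_support (pd i a).
Proof.
move=> [r r0 h]; exists r => // x rx.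
rewrite /pd (@near_eq_derive _ _ _ a (cst 0)) ?derive_cst//.
near=> y; rewrite h//.
have : ball x (`|x| - r) y by near: y; apply: nbhsx_ballx; rewrite subr_gt0.
rewrite -ball_normE /= => xy; have := ler_normD (x - y) y; rewrite subrK; lra.
Unshelve. all: by end_near. Qed.

Lemma bounded_support_integrable (B : R) f : measurable_fun setT f ->
  (forall x, `|f x| <= B) -> bounded_support f -> L1 f.
Proof.
move=> mf fB [r r0 h].
(* The function may be nonzero on the sphere of radius [r], and the ball is open; hence a larger
   radius. *)
pose A : set X := ball 0 (r + 1).
have mA : measurable A by exact: measurable_rV_ball.
have i1 : L1 (fun x => B * \1_A x) by apply: RintegrableZ; exact: integrable_indic_ball.
apply: Rintegrable_le i1 => // x.
have [xr|rx] := leP `|x| r.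
  rewrite indicE mem_set ?mulr1//= /A -ball_normE /= sub0r normrN; lra.
rewrite h// normr0 mulr_ge0//; first exact: le_trans (fB x).
Qed.

Definition testf a := smooth a /\ bounded_support a.

Lemma testf_bounded a : testf a -> exists B, forall x, `|a x| <= B.
Proof.
move=> [sa [r r0 h]].
have ca := smooth_continuous sa.
have cK : compact (closed_ball (0 : X) r).
  apply: bounded_closed_compact; last exact: closed_ball_closed.
  apply: (@bounded_set_le _ _ _ r) => x; rewrite closed_ballE// /closed_ball_ /= sub0r normrN => xr.
  exact: xr.
have /compact_bounded [M [Mr HM]] : compact (a @` closed_ball (0 : X) r).
  by apply: continuous_compact cK; exact: continuous_subspaceT.
exists (`|M| + 1) => x.
have M1 : M < `|M| + 1 by rewrite (le_lt_trans (ler_norm _))// ltrDl.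
have [xr|rx] := leP `|x| r; last by rewrite h// normr0.
apply: (HM _ M1); exists x => //; by rewrite closed_ballE// /closed_ball_ /= sub0r normrN.
Qed.

Lemma testf_integrable a : testf a -> L1 a.
Proof.
move=> ta; have [B aB] := testf_bounded ta; have [sa ba] := ta.
apply: bounded_support_integrable aB ba.
by apply: continuous_rV_measurable; exact: smooth_continuous.
Qed.

Lemma testf_pd i a : testf a -> testf (pd i a).
Proof. by move=> [sa ba]; split; [exact: smooth_pd|exact: bounded_support_pd]. Qed.

Lemma testf_mul f a : smooth f -> testf a -> testf (fun x => f x * a x).
Proof. by move=> sf [sa ba]; split; [exact: smoothM|exact: bounded_support_mul]. Qed.

(** Difference quotients have integral 0 by translation invariance. The mean value theorem bounds
    them by the supremum of the derivative, on one ball for all step sizes. *)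
Lemma integral_pd i a : testf a -> \int[mu]_x pd i a x = 0.
Proof.
move=> ta; have [sa [r r0 ar]] := ta; have ia := testf_integrable ta.
have [B aB] := testf_bounded (testf_pd i ta).
have B0 : 0 <= B by exact: le_trans (aB 0).
have da := smooth_differentiable sa.
pose e : X := delta_mx ord0 i.
have e1 : `|e| <= 1.
  by apply: norm_le_coord => // j; rewrite mxE eqxx; case: (j == i); rewrite ?normr1 ?normr0.
pose q n x := n.+1%:R * (a (x + n.+1%:R^-1 *: e) - a x).
have ish n : L1 (fun x => a (x + n.+1%:R^-1 *: e)).
  have := affine_integrable (n.+1%:R^-1 *: e) (oner_neq0 R) ia.
  by apply: eq_integrable => // x _; rewrite /= scale1r.
have iq n : L1 (q n) by apply: RintegrableZ; exact: RintegrableB.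
have q0 n : \int[mu]_x q n x = 0.
  rewrite RintegralZl//; last exact: RintegrableB.
  by rewrite RintegralB// (Rintegral_shift _ ia) subrr mulr0.
(* Steps have norm at most 1, so a quotient can be nonzero only for [|x| <= r + 1]. *)
pose A : set X := ball 0 (r + 2).
have mA : measurable A by exact: measurable_rV_ball.
have i1 : L1 (fun x => B * \1_A x).
  by apply: RintegrableZ; exact: integrable_indic_ball.
have : \int[mu]_x q n x @[n --> \oo] --> \int[mu]_x pd i a x.
  apply: Rdominated_cvg i1 _.
  - by move=> n; exact: Rintegrable_measurable (iq n).
  - exact: Rintegrable_measurable (testf_integrable (testf_pd i ta)).
  - move=> x; have /cvgr_dnbhsP dx := @diff_derivable _ _ _ a x e (da x).
    have := dx (fun n : nat => n.+1%:R^-1 : R).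
    have -> : (fun n : nat => (n.+1%:R^-1)^-1 *: ((a \o shift x) (n.+1%:R^-1 *: e) - a x)) =
        q ^~ x.
      by apply/funext => n; rewrite /q /= invrK [_ + x]addrC.
    apply; split; last exact: cvg_harmonic.
    by move=> n; rewrite invr_eq0 pnatr_eq0.
  - move=> n x; have n0 : 0 < n.+1%:R^-1 :> R by rewrite invr_gt0.
    have n1 : n.+1%:R^-1 <= 1 :> R by rewrite invf_le1// ler1n.
    have lip := lipschitz_line da aB x (ltW n0).
    have [xr|rx] := ltP `|x| (r + 2).
      rewrite indicE mem_set; last by rewrite /A /= -ball_normE /= sub0r normrN.
      by rewrite mulr1 /q normrM ger0_norm// mulrC -ler_pdivlMr// (le_trans lip).
    rewrite /q !ar ?subrr ?mulr0 ?normr0 ?mulr_ge0//; first by rewrite (lt_le_trans _ rx)// ltrDl.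
    rewrite (lt_le_trans (_ : _ < `|x| - 1))//; first lra.
    rewrite lerBlDr (le_trans _ (lerD (lexx _) (_ : `|n.+1%:R^-1 *: e| <= 1)))//.
      by rewrite -{1}[x](addrK (n.+1%:R^-1 *: e)) (le_trans (ler_normB _ _)).
    by rewrite normrZ ger0_norm ?(ltW n0)// mulr_ile1// ltW.
under eq_fun do rewrite q0; move=> /cvg_lim <-//; by rewrite lim_cst.
Qed.
End test_functions.

(** * Derivatives and decay of transforms *)

Section transforms_of_test_functions.
Context (R : realType) (m : nat).
Local Notation X := 'rV[R]_m.
Local Notation mu := (lebesgue_rV R m).
Local Notation L1 f := (mu.-integrable setT (EFin \o f)).
Implicit Types (f g a b : X -> R) (i : 'I_m).

(** Integration by parts: the derivative of the product of [a] with a sine integrates to 0. *)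
Lemma Fcos_pd i a xi : testf a -> Fsin (pd i a) xi = - (xi ord0 i * Fcos a xi).
Proof.
move=> ta; have ts := testf_mul (smooth_sin_dotp xi) ta.
have := integral_pd i ts; rewrite pdM; last 2 first.
- exact/smooth_differentiable/smooth_sin_dotp.
- exact/smooth_differentiable/(ta.1).
rewrite pd_sin_dotp => E; apply/eqP; rewrite -addr_eq0; apply/eqP; rewrite -[RHS]E.
have i1 : L1 (fun x => pd i a x * sin (dotp x xi)) by exact/integrableM_sin/testf_integrable/testf_pd.
have i2 : L1 (fun x => a x * cos (dotp x xi)) by exact/integrableM_cos/testf_integrable.
rewrite /Fcos -RintegralZl// /Fsin -RintegralD//; last exact: RintegrableZ.
by apply: eq_Rintegral => x _; ring.
Qed.

Lemma Fsin_pd i a xi : testf a -> Fcos (pd i a) xi = xi ord0 i * Fsin a xi.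
Proof.
move=> ta; have ts := testf_mul (smooth_cos_dotp xi) ta.
have := integral_pd i ts; rewrite pdM; last 2 first.
- exact/smooth_differentiable/smooth_cos_dotp.
- exact/smooth_differentiable/(ta.1).
rewrite pd_cos_dotp => E; apply/eqP; rewrite -subr_eq0; apply/eqP; rewrite -[RHS]E.
have i1 : L1 (fun x => pd i a x * cos (dotp x xi)) by exact/integrableM_cos/testf_integrable/testf_pd.
have i2 : L1 (fun x => a x * sin (dotp x xi)) by exact/integrableM_sin/testf_integrable.
rewrite /Fsin -RintegralZl// /Fcos -RintegralB//; last exact: RintegrableZ.
by apply: eq_Rintegral => x _; ring.
Qed.

(** Weak enough to contain the truncated transforms of the duality argument, strong enough for their
    cosine and sine transforms to be smooth. *)
Definition compactly_integrable a := L1 a /\ bounded_support a.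

Lemma testf_ci a : testf a -> compactly_integrable a.
Proof. by move=> ta; split; [exact: testf_integrable|exact: ta.2]. Qed.

Lemma ci_coord i a : compactly_integrable a -> compactly_integrable (fun x => x ord0 i * a x).
Proof.
move=> [ia [r r0 h]]; split; last by exists r => // x /h ->; rewrite mulr0.
apply: (@Rintegrable_le _ _ _ _ _ (fun x => r * `|a x|)).
- by apply: measurable_funM; [exact: measurable_coor|exact: Rintegrable_measurable ia].
- move=> x; rewrite normrM; have [xr|/h ->] := leP `|x| r; last by rewrite normr0 !mulr0.
  by rewrite ler_wpM2r// (le_trans (coord_le_norm _ _)).
- by apply: RintegrableZ; exact: integrable_norm.
Qed.

Lemma mvt_bound (f df : R -> R) (B t : R) :
  (forall s, derivable f s 1 /\ 'D_1 f s = df s) -> 0 <= t ->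
  (forall s, 0 <= s <= t -> `|df s| <= B) -> `|f t - f 0| <= B * t.
Proof.
move=> fdf t0 dfB.
have [||c cI ->] := @MVT_segment R f df 0 t t0.
- by move=> s _; case: (fdf s).
- by apply: derivable_within_continuous => s _; case: (fdf s).
by rewrite subr0 normrM (ger0_norm t0) ler_wpM2r// dfB.
Qed.

Lemma is_derive_addl (u s : R) : is_derive s 1 (fun s : R => u + s) 1.
Proof.
have -> : (fun s : R => u + s) = cst u + id by [].
by apply: is_derive_eq; rewrite add0r.
Qed.

Lemma sin_lipschitz (u t : R) : 0 <= t -> `|sin (u + t) - sin u| <= t.
Proof.
move=> t0; have := @mvt_bound (fun s => sin (u + s)) (fun s => cos (u + s)) 1 t.
rewrite mul1r addr0; apply => // s; last by rewrite normr_cos_le1.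
have du := is_derive_addl u s.
have := @is_derive1_comp _ sin (fun s : R => u + s) s _ _ (is_derive_sin (u + s)) du.
by rewrite mulr1 => -[].
Qed.

Lemma cos_quadratic_pos (u t : R) : 0 <= t ->
  `|cos (u + t) - cos u + t * sin u| <= t ^+ 2.
Proof.
move=> t0; have := @mvt_bound (fun s => cos (u + s) + s * sin u)
  (fun s => - sin (u + s) + sin u) t t.
rewrite addr0 mul0r addr0 -expr2 addrAC; apply => // s.
  have du := is_derive_addl u s.
  have d1 := @is_derive1_comp _ cos (fun s : R => u + s) s _ _ (is_derive_cos (u + s)) du.
  have d2 := is_derive_linM s (sin u).
  by have := is_deriveD d1 d2; rewrite mulr1 => -[].
move=> /andP[s0 st]; rewrite addrC -opprB normrN.
by rewrite (le_trans (sin_lipschitz _ _)).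
Qed.

Lemma cos_quadratic (u t : R) : `|cos (u + t) - cos u + t * sin u| <= t ^+ 2.
Proof.
have [t0|t0] := leP 0 t; first exact: cos_quadratic_pos.
have t0' : 0 <= - t by lra.
have := cos_quadratic_pos (- u) t0'.
by rewrite -opprD !cosN sinN mulrNN sqrrN.
Qed.

(** A shift by a quarter period reduces this to the cosine. *)
Lemma sin_quadratic (u t : R) : `|sin (u + t) - sin u - t * cos u| <= t ^+ 2.
Proof.
have := cos_quadratic (u - pi / 2) t.
have c x : cos (x - pi / 2) = sin x by rewrite cosB cos_pihalf sin_pihalf; ring.
have -> : u - pi / 2 + t = u + t - pi / 2 by ring.
rewrite !c (_ : sin (u - pi / 2) = - cos u) ?mulrN//.
by rewrite sinB cos_pihalf sin_pihalf; ring.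
Qed.

Lemma Rintegral_sum n (F : 'I_n -> X -> R) : (forall k, L1 (F k)) ->
  L1 (fun x => \sum_i F i x) /\ \int[mu]_x (\sum_i F i x) = \sum_i \int[mu]_x F i x.
Proof.
elim: n F => [|n IH] F iF.
  under eq_fun do rewrite big_ord0; rewrite big_ord0; split; first exact: integrable0.
  by rewrite /Rintegral integral0.
have [i1 e1] := IH _ (fun k => iF (lift ord0 k)).
split; first by under eq_fun do rewrite big_ord_recl; exact: RintegrableD.
under eq_Rintegral do rewrite big_ord_recl.
by rewrite RintegralD// e1 big_ord_recl.
Qed.

Lemma compact_dotp_bound a r (x k : X) : 0 <= r -> (r < `|x| -> a x = 0 :> R) ->
  `|a x| * dotp x k ^+ 2 <= (m%:R * r) ^+ 2 * `|k| ^+ 2 * `|a x|.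
Proof.
move=> r0 h; have [xr|/h ->] := leP `|x| r; last by rewrite normr0 !mul0r mulr0.
rewrite mulrC ler_wpM2r// -exprMn -[leLHS]real_normK ?num_real//.
rewrite lerXn2r ?nnegrE ?mulr_ge0// (le_trans (norm_dotp _ _))//.
by rewrite ler_wpM2r// ler_wpM2l.
Qed.

(** Differentiation under the integral: the second-order error of the cosine is at most the square
    of [dotp x k], which the bounded support controls by [(m r |k|)^2]. *)
Lemma Fcos_diff a xi : compactly_integrable a ->
  is_diff xi (Fcos a) (dotp_with (\row_i - Fsin (fun x => x ord0 i * a x) xi)).
Proof.
move=> ca; have [ia [r r0 h]] := ca.
pose K := \int[mu]_x `|a x|.
apply: (@quadratic_diff _ _ _ _ ((m%:R * r) ^+ 2 * K)); first exact: continuous_dotp_with.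
move=> k /=.
have iC (z : X) : L1 (fun x => a x * cos (dotp x z)) by exact: integrableM_cos.
have iS i : L1 (fun x : X => x ord0 i * a x * sin (dotp x xi)).
  exact: (integrableM_sin xi (ci_coord i ca).1).
have [i1 e1] := Rintegral_sum (fun i => RintegrableZ (k ord0 i) (iS i)).
have -> : dotp_with (\row_i - Fsin (fun x => x ord0 i * a x) xi) k =
    - \int[mu]_x (\sum_i k ord0 i * (x ord0 i * a x * sin (dotp x xi))).
  rewrite /dotp_with /dotp e1 -sumrN; apply: eq_bigr => i _.
  by rewrite mxE mulrN RintegralZl.
have E (x : X) : a x * cos (dotp x (k + xi)) - a x * cos (dotp x xi) +
    \sum_i k ord0 i * (x ord0 i * a x * sin (dotp x xi)) =
    a x * (cos (dotp x xi + dotp x k) - cos (dotp x xi) + dotp x k * sin (dotp x xi)).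
  rewrite dotpDr [dotp x k + _]addrC [in RHS]mulrDr mulrBr; congr (_ + _).
  rewrite [in RHS]/dotp mulr_suml mulr_sumr; apply: eq_bigr => i _; ring.
rewrite opprK /Fcos -RintegralB// -RintegralD//; last exact: RintegrableB.
have iD := RintegrableD (RintegrableB (iC (k + xi)) (iC xi)) i1.
rewrite (le_trans (le_normr_Rintegral _ iD))// mulrAC -RintegralZl//; last exact: integrable_norm.
apply: le_Rintegral => //; first exact: integrable_norm.
  by apply: RintegrableZ; exact: integrable_norm.
move=> x _; rewrite E normrM (le_trans _ (compact_dotp_bound k (ltW r0) (h x)))//.
by rewrite ler_wpM2l// cos_quadratic.
Qed.

Lemma Fsin_diff a xi : compactly_integrable a ->
  is_diff xi (Fsin a) (dotp_with (\row_i Fcos (fun x => x ord0 i * a x) xi)).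
Proof.
move=> ca; have [ia [r r0 h]] := ca.
pose K := \int[mu]_x `|a x|.
apply: (@quadratic_diff _ _ _ _ ((m%:R * r) ^+ 2 * K)); first exact: continuous_dotp_with.
move=> k /=.
have iC (z : X) : L1 (fun x => a x * sin (dotp x z)) by exact: integrableM_sin.
have iS i : L1 (fun x : X => x ord0 i * a x * cos (dotp x xi)).
  exact: (integrableM_cos xi (ci_coord i ca).1).
have [i1 e1] := Rintegral_sum (fun i => RintegrableZ (k ord0 i) (iS i)).
have -> : dotp_with (\row_i Fcos (fun x => x ord0 i * a x) xi) k =
    \int[mu]_x (\sum_i k ord0 i * (x ord0 i * a x * cos (dotp x xi))).
  rewrite /dotp_with /dotp e1; apply: eq_bigr => i _.
  by rewrite mxE RintegralZl.
have E (x : X) : a x * sin (dotp x (k + xi)) - a x * sin (dotp x xi) -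
    \sum_i k ord0 i * (x ord0 i * a x * cos (dotp x xi)) =
    a x * (sin (dotp x xi + dotp x k) - sin (dotp x xi) - dotp x k * cos (dotp x xi)).
  rewrite dotpDr [dotp x k + _]addrC [in RHS]mulrBr mulrBr; congr (_ - _).
  rewrite [in RHS]/dotp mulr_suml mulr_sumr; apply: eq_bigr => i _; ring.
rewrite /Fsin -RintegralB// -RintegralB//; last exact: RintegrableB.
have iD := RintegrableB (RintegrableB (iC (k + xi)) (iC xi)) i1.
rewrite (le_trans (le_normr_Rintegral _ iD))// mulrAC -RintegralZl//; last exact: integrable_norm.
apply: le_Rintegral => //; first exact: integrable_norm.
  by apply: RintegrableZ; exact: integrable_norm.
move=> x _; rewrite E normrM (le_trans _ (compact_dotp_bound k (ltW r0) (h x)))//.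
by rewrite ler_wpM2l// sin_quadratic.
Qed.

Lemma dotp_with_delta i (v : X) : dotp_with v (delta_mx ord0 i) = v ord0 i.
Proof. exact: dotp_delta. Qed.

Lemma pd_Fcos a i : compactly_integrable a ->
  pd i (Fcos a) = fun xi => - Fsin (fun x => x ord0 i * a x) xi.
Proof.
move=> ca; apply/funext => xi; have [d1 d2] := Fcos_diff xi ca.
by rewrite /pd deriveE// d2 dotp_with_delta mxE.
Qed.

Lemma pd_Fsin a i : compactly_integrable a ->
  pd i (Fsin a) = Fcos (fun x => x ord0 i * a x).
Proof.
move=> ca; apply/funext => xi; have [d1 d2] := Fsin_diff xi ca.
by rewrite /pd deriveE// d2 dotp_with_delta mxE.
Qed.

Lemma smoothn_F n a : compactly_integrable a -> smoothn n (Fcos a) /\ smoothn n (Fsin a).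
Proof.
elim: n a => [|n IH] a ca.
  by split; split => // xi; [case: (Fcos_diff xi ca)|case: (Fsin_diff xi ca)].
split; split; try by move=> xi; [case: (Fcos_diff xi ca)|case: (Fsin_diff xi ca)].
- by move=> xi; case: (Fcos_diff xi ca).
- move=> i; rewrite pd_Fcos//.
  rewrite (_ : (fun xi => _) = fun xi => -1 * Fsin (fun x => x ord0 i * a x) xi).
    by apply: smoothnM; [exact: smoothn_cst|case: (IH _ (ci_coord i ca))].
  by apply/funext => xi; rewrite mulN1r.
- by move=> xi; case: (Fsin_diff xi ca).
- by move=> i; rewrite pd_Fsin//; case: (IH _ (ci_coord i ca)).
Qed.

Lemma smooth_Fcos a : compactly_integrable a -> smooth (Fcos a).
Proof. by move=> ca; apply/smoothP => n; case: (smoothn_F n ca). Qed.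

Lemma smooth_Fsin a : compactly_integrable a -> smooth (Fsin a).
Proof. by move=> ca; apply/smoothP => n; case: (smoothn_F n ca). Qed.

(** The transforms of test functions form a class closed under partial derivatives and under
    multiplication by coordinates, which yields the rapid decay of all derivatives. *)
Definition trig_poly_decay (h : X -> R) := exists a b, [/\ testf a, testf b &
  h = fun xi => Fcos a xi + Fsin b xi].

Lemma trig_decay_pd i h : trig_poly_decay h -> trig_poly_decay (pd i h).
Proof.
move=> [a [b [ta tb ->]]].
exists (fun x : X => x ord0 i * b x), (fun x : X => - x ord0 i * a x); split.
- by apply: testf_mul => //; exact: smooth_coord.
- apply: testf_mul => //; rewrite (_ : (fun x => _) = fun x : X => -1 * x ord0 i).
    by apply: smoothM; [exact: smooth_cst|exact: smooth_coord].
  by apply/funext => x; rewrite mulN1r.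
rewrite pdD; last 2 first.
- by apply: smooth_differentiable; exact/smooth_Fcos/testf_ci.
- by apply: smooth_differentiable; exact/smooth_Fsin/testf_ci.
rewrite pd_Fcos ?pd_Fsin; try exact: testf_ci.
apply/funext => xi; rewrite addrC; congr (_ + _).
rewrite /Fsin -mulN1r -RintegralZl//; last exact: (integrableM_sin xi (ci_coord i (testf_ci ta)).1).
by apply: eq_Rintegral => x _; ring.
Qed.

Lemma trig_decay_mul i h : trig_poly_decay h -> trig_poly_decay (fun xi => xi ord0 i * h xi).
Proof.
move=> [a [b [ta tb ->]]].
exists (pd i b), (fun x => -1 * pd i a x); split.
- exact: testf_pd.
- by apply: testf_mul; [exact: smooth_cst|exact: testf_pd].
apply/funext => xi; rewrite mulrDr Fsin_pd// addrC; congr (_ + _).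
have E : Fsin (fun x => -1 * pd i a x) xi = - Fsin (pd i a) xi.
  rewrite /Fsin -[RHS]mulN1r -RintegralZl//; last exact/integrableM_sin/testf_integrable/testf_pd.
  by apply: eq_Rintegral => x _; ring.
by rewrite E Fcos_pd// opprK.
Qed.

(** Induction on [k]: one factor [1 + sum |xi_i|] is distributed over [h], and each [xi_i h] belongs
    to the same class. *)
Lemma trig_decay_bound h k : trig_poly_decay h ->
  exists B, forall xi : X, (1 + \sum_i `|xi ord0 i|) ^+ k * `|h xi| <= B.
Proof.
elim: k h => [|k IH] h dh.
  have [a [b [ta tb ->]]] := dh.
  exists (\int[mu]_x `|a x| + \int[mu]_x `|b x|) => xi; rewrite expr0 mul1r.
  by rewrite (le_trans (ler_normD _ _))// lerD ?Fcos_bound ?Fsin_bound//; exact: testf_integrable.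
have [B0 hB0] := IH _ dh.
pose B i := projT1 (cid (IH _ (trig_decay_mul i dh))).
have hB i (xi : X) : (1 + \sum_i `|xi ord0 i|) ^+ k * `|xi ord0 i * h xi| <= B i.
  by rewrite /B; case: cid => /= ?; apply.
exists (B0 + \sum_i B i) => xi.
rewrite exprSr -mulrA mulrDl mul1r mulrDr lerD// mulr_suml mulr_sumr.
by apply: ler_sum => i _; rewrite -normrM.
Qed.

Lemma trig_decay_pderiv al h : trig_poly_decay h -> trig_poly_decay (pderiv al h).
Proof. by elim: al h => [//|i al IH] h dh /=; apply: trig_decay_pd; exact: IH. Qed.

Lemma trig_decay_smooth h : trig_poly_decay h -> smooth h.
Proof.
move=> [a [b [ta tb ->]]]; apply: smoothD.
- exact/smooth_Fcos/testf_ci.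
- exact/smooth_Fsin/testf_ci.
Qed.

Lemma enorm_le_sum (x : X) : enorm x <= \sum_i `|x ord0 i|.
Proof.
have S0 : 0 <= \sum_i `|x ord0 i| by apply: sumr_ge0.
rewrite /enorm -[leRHS]ger0_norm// -sqrtr_sqr ler_sqrt ?sqr_ge0//.
rewrite expr2 mulr_suml /dotp; apply: ler_sum => i _.
rewrite -expr2 -[leLHS]real_normK ?num_real// expr2 ler_wpM2l//.
by rewrite (bigD1 i)//= lerDl sumr_ge0.
Qed.

Lemma trig_decay_schwartz h1 h2 : trig_poly_decay h1 -> trig_poly_decay h2 ->
  is_schwartz (fun xi => Complex (h1 xi) (h2 xi)).
Proof.
move=> d1 d2; split; [exact: trig_decay_smooth|exact: trig_decay_smooth|].
move=> k al.
have [B1 H1] := trig_decay_bound k (trig_decay_pderiv al d1).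
have [B2 H2] := trig_decay_bound k (trig_decay_pderiv al d2).
exists (B1 + B2) => xi.
have e0 : 0 <= 1 + enorm xi by rewrite addr_ge0// sqrtr_ge0.
apply: (@le_trans _ _ ((1 + \sum_i `|xi ord0 i|) ^+ k *
   (`|pderiv al h1 xi| + `|pderiv al h2 xi|))); last by rewrite mulrDr lerD.
rewrite ler_pM ?exprn_ge0//; first by case: (cpderiv _ _ _) => u v; exact: sqrtr_ge0.
  apply: lerXn2r; rewrite ?nnegrE//; first by rewrite addr_ge0// sumr_ge0.
  by rewrite lerD2l enorm_le_sum.
rewrite /cpderiv /= -[leRHS]ger0_norm ?addr_ge0// -sqrtr_sqr ler_sqrt ?sqr_ge0//.
rewrite sqrrD !real_normK ?num_real//.
have := mulr_ge0 (normr_ge0 (pderiv al h1 xi)) (normr_ge0 (pderiv al h2 xi)).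
rewrite /comp /=; lra.
Qed.
End transforms_of_test_functions.

(** * Bump functions and the fundamental lemma of the calculus of variations *)

Section bump.
Context (R : realType).
Implicit Types (p : {poly R}) (x y : R).

(** The flat function [exp (-1/x)], with a polynomial in [1/x] in front so that the family is closed
    under differentiation: [theta_deriv] is the induced map on polynomials. *)
Definition theta p x : R := if 0 < x then p.[x^-1] * expR (- x^-1) else 0.
Definition theta_deriv p : {poly R} := 'X^2 * (p - p^`()).

Lemma pow_expN_le (n : nat) y : 0 < y -> y ^+ n * expR (- y) <= n`!%:R.
Proof.
move=> y0; rewrite expRN ler_pdivrMr ?expR_gt0//.
case: n => [|n]; first by rewrite expr0 fact0 mul1r; have := @expR_ge1Dx R y; lra.
have := @expR_ge1Dxn R y n (ltW y0).
have f0 : 0 < (n.+1)`!%:R :> R by rewrite ltr0n fact_gt0.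
by move=> h; rewrite mulrC -ler_pdivrMr// (le_trans _ h)// lerDr.
Qed.

(** With [y = 1/x] it reads [|theta p x| <= C x^2] for positive [x], hence a vanishing derivative at
    0 by [quadratic_diff]. *)
Lemma poly_expN_bound p : exists C, forall y, 0 < y -> y ^+ 2 * `|p.[y] * expR (- y)| <= C.
Proof.
exists (\sum_(i < size p) `|p`_i| * (i.+2)`!%:R) => y y0.
rewrite horner_coef mulr_suml (le_trans (ler_wpM2l _ (ler_norm_sum _ _ _)))//.
  by rewrite exprn_ge0// ltW.
rewrite mulr_sumr; apply: ler_sum => i _.
rewrite !normrM [`|expR _|]ger0_norm ?expR_ge0// normrX [`|y|]gtr0_norm//.
have -> : y ^+ 2 * (`|p`_i| * y ^+ i * expR (- y)) = `|p`_i| * (y ^+ i.+2 * expR (- y)).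
  by rewrite (exprSr y i.+1) (exprSr y i); ring.
by rewrite ler_wpM2l// pow_expN_le.
Qed.

Lemma derive_theta p x : derivable (theta p) x 1 /\ 'D_1 (theta p) x = theta (theta_deriv p) x.
Proof.
have [x0|x0|<-] := ltgtP 0 x.
- have dV : is_derive x 1 (fun y : R => y^-1) (- x ^- 2).
    have x0' : x != 0 by rewrite gt_eqF.
    split; first by apply/derivable1_diffP; exact: differentiable_Rinv.
    rewrite deriveE; last exact: differentiable_Rinv.
    by rewrite diff_Rinv//= /GRing.scale /= mulr1.
  have dp := @is_derive1_comp _ (horner p) (fun y : R => y^-1) x _ _ (is_derive_poly p _) dV.
  have dNV : is_derive x 1 (fun y : R => - y^-1) (x ^- 2).
    by apply: is_derive_eq; rewrite opprK.
  have de := @is_derive1_comp _ expR (fun y : R => - y^-1) x _ _ (is_derive_expR _) dNV.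
  have dm := is_deriveM dp de.
  suff : is_derive x 1 (theta p) (theta (theta_deriv p) x) by case.
  apply: (@near_eq_is_derive _ _ _ ((horner p \o (fun y => y^-1)) * (expR \o (fun y : R => - y^-1)))).
    near=> y; rewrite /theta ifT//; near: y; exact: lt_nbhsr.
  apply: is_derive_eq; rewrite /theta x0 /theta_deriv /GRing.scale /= hornerM hornerXn hornerD hornerN.
  rewrite exprVn; ring.
- have E : \near x, cst 0 x = theta p x.
    by near=> y; rewrite /theta ifF//; apply/negbTE; rewrite -leNgt ltW//; near: y; exact: lt_nbhsl.
  have := near_eq_is_derive E (is_derive_cst (0 : R) x 1).
  have -> : theta (theta_deriv p) x = 0 by rewrite /theta ltNge (ltW x0).
  by case.
- have [C HC] := poly_expN_bound p.
  have h0 : theta p 0 = 0 by rewrite /theta ltxx.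
  have := @quadratic_diff R R^o (theta p) (\0 : {linear R^o -> R}) C 0.
  case.
  + exact: cst_continuous.
  + move=> h; rewrite addr0 h0 !subr0 /theta.
    have [hp|hn] := ltP 0 h; last first.
      rewrite normr0 mulr_ge0 ?sqr_ge0//.
      by have := HC 1 ltr01; apply: le_trans; rewrite mulr_ge0.
    have := HC h^-1; rewrite invr_gt0 => /(_ hp) H.
    have hx : 0 < h ^+ 2 by rewrite exprn_gt0.
    by rewrite [`|h|]gtr0_norm// -ler_pdivrMr ?exprn_gt0// mulrC -exprVn.
  move=> d1 d2; split; first exact/derivable1_diffP.
  by rewrite deriveE// d2 /theta ltxx.
Unshelve. all: by end_near. Qed.

Lemma theta1E x : 0 < x -> theta 1 x = expR (- x^-1).
Proof. by move=> x0; rewrite /theta x0 hornerC mul1r. Qed.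

Lemma theta1_ge0 x : 0 <= theta 1 x.
Proof. by rewrite /theta hornerC mul1r; case: ifP => // _; exact: expR_ge0. Qed.

Lemma theta1_le1 x : theta 1 x <= 1.
Proof.
rewrite /theta hornerC mul1r; case: ifP => // x0.
by rewrite -expR0 ler_expR oppr_le0 invr_ge0 ltW.
Qed.

Lemma theta1_cvg x : theta 1 (n.+1%:R * x) @[n --> \oo] --> (if 0 < x then 1 else 0 : R).
Proof.
case: ifPn => x0; last first.
  rewrite (_ : (fun n => _) = cst 0); first exact: cvg_cst.
  by apply/funext => n; rewrite /theta pmulr_rgt0// (negbTE x0).
have E n : theta 1 (n.+1%:R * x) = expR (- (n.+1%:R^-1 * x^-1)).
  by rewrite theta1E ?mulr_gt0// invfM.
under eq_fun do rewrite E.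
suff : expR (- (n.+1%:R^-1 * x^-1)) @[n --> \oo] --> expR (- (0 * x^-1)) by rewrite mul0r oppr0 expR0.
apply: cvg_comp; last exact: continuous_expR.
by apply: cvgN; apply: cvgM; [exact: cvg_harmonic|exact: cvg_cst].
Qed.
End bump.

Section box_bump.
Context (R : realType) (m : nat).
Local Notation X := 'rV[R]_m.
Local Notation mu := (lebesgue_rV R m).
Local Notation L1 f := (mu.-integrable setT (EFin \o f)).
Implicit Types (f : X -> R) (a b : 'I_m -> R).

(** The parameter [c] is a steepness: along the integers the bumps tend to the indicator of the box,
    and with [c = e^-1] they scale exactly with a box of size [e]. *)
Definition box_bump a b (c : R) (x : X) : R :=
  \prod_i (theta 1 (c * (x ord0 i - a i)) * theta 1 (c * (b i - x ord0 i))).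

Lemma smooth_theta p (v : X) d : smooth (fun x : X => theta p (dotp x v + d)).
Proof.
exact: (@smooth_family R m {poly R} (@theta R) (@theta_deriv R) v d (@derive_theta R)).
Qed.

Lemma smooth_box_bump a b c : smooth (box_bump a b c).
Proof.
apply: smooth_prod => i; apply: smoothM.
- rewrite (_ : (fun x => _) = fun x : X => theta 1 (dotp x (c *: delta_mx ord0 i) + - (c * a i))).
    exact: smooth_theta.
  by apply/funext => x; rewrite dotpZr [dotp x _]dotpC dotp_delta mulrBr.
- rewrite (_ : (fun x => _) = fun x : X => theta 1 (dotp x (- c *: delta_mx ord0 i) + c * b i)).
    exact: smooth_theta.
  by apply/funext => x; rewrite dotpZr [dotp x _]dotpC dotp_delta mulrBr mulNr addrC.
Qed.

Lemma box_bump_eq0 a b c x : 0 < c -> ~ box a b x -> box_bump a b c x = 0.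
Proof.
move=> c0 /existsNP[i hi]; rewrite /box_bump (bigD1 i)//=.
rewrite /theta !pmulr_rgt0// !subr_gt0.
have [h1|h1] := boolP (a i < x ord0 i); last by rewrite !mul0r.
have [h2|h2] := boolP (x ord0 i < b i); last by rewrite mulr0 mul0r.
by case: hi; rewrite h1 h2.
Qed.

Lemma box_bump_gt0 a b c x : 0 < c -> box a b x -> 0 < box_bump a b c x.
Proof.
move=> c0 h; apply: prodr_gt0 => i _; have /andP[h1 h2] := h i.
by rewrite !theta1E ?mulr_gt0 ?expR_gt0 ?subr_gt0.
Qed.

Lemma box_bump_ge0 a b c x : 0 <= box_bump a b c x.
Proof. by apply: prodr_ge0 => i _; rewrite mulr_ge0 ?theta1_ge0. Qed.

Lemma box_bump_le1 a b c x : box_bump a b c x <= 1.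
Proof.
apply: prodr_ile1 => i; rewrite mulr_ge0 ?theta1_ge0//=.
by rewrite mulr_ile1 ?theta1_ge0 ?theta1_le1.
Qed.

Lemma box_bounded a b : exists2 r : R, 0 < r & forall x, box a b x -> `|x| <= r.
Proof.
exists (1 + \sum_i (`|a i| + `|b i|)).
  by rewrite ltr_pwDl// sumr_ge0// => i _; rewrite addr_ge0.
move=> x h; apply: norm_le_coord => [|i]; first by rewrite addr_ge0// sumr_ge0// => i _; rewrite addr_ge0.
have /andP[h1 h2] := h i.
have : `|a i| + `|b i| <= \sum_i (`|a i| + `|b i|).
  by rewrite (bigD1 i)//= lerDl sumr_ge0// => j _; rewrite addr_ge0.
have := ler_norm (b i); have := ler_norm (- a i); rewrite normrN.
have := normr_ge0 (a i); have := normr_ge0 (b i).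
move=> *; rewrite ler_norml; apply/andP; split; lra.
Qed.

Lemma testf_box_bump a b c : 0 < c -> testf (box_bump a b c).
Proof.
move=> c0; split; first exact: smooth_box_bump.
have [r r0 h] := box_bounded a b; exists r => // x rx.
by apply: box_bump_eq0 => // /h; rewrite leNgt rx.
Qed.

Lemma cvg_prodr (I : Type) (r : seq I) (F : I -> nat -> R) (l : I -> R) :
  (forall k, F k n @[n --> \oo] --> l k) ->
  \prod_(k <- r) F k n @[n --> \oo] --> \prod_(k <- r) l k.
Proof.
move=> H; elim: r => [|k r IH].
  by rewrite big_nil; under eq_cvg do rewrite big_nil; exact: cvg_cst.
by rewrite big_cons; under eq_cvg do rewrite big_cons; exact: cvgM.
Qed.

Lemma box_bump_cvg a b x : box_bump a b n.+1%:R x @[n --> \oo] --> (\1_(box a b) x : R).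
Proof.
rewrite indic_box.
have H i : theta 1 (n.+1%:R * (x ord0 i - a i)) * theta 1 (n.+1%:R * (b i - x ord0 i)) @[n --> \oo]
    --> (\1_(`]a i, b i[%classic) (x ord0 i) : R).
  have -> : \1_(`]a i, b i[%classic) (x ord0 i) = (if 0 < x ord0 i - a i then 1 else 0) *
     (if 0 < b i - x ord0 i then 1 else 0) :> R.
    rewrite indicE !subr_gt0 mem_setE in_itv /=.
    by do 2 case: (_ < _); rewrite ?mulr1 ?mulr0.
  by apply: cvgM; exact: theta1_cvg.
exact: (@cvg_prodr _ _ (fun i n => theta 1 (n.+1%:R * (x ord0 i - a i)) *
  theta 1 (n.+1%:R * (b i - x ord0 i)))).
Qed.

Definition boxes : set (set X) := [set A | exists a b, A = box a b].

Lemma setI_closed_boxes : setI_closed boxes.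
Proof.
move=> _ _ [a [b ->]] [c [d ->]].
exists (fun i => Num.max (a i) (c i)), (fun i => Num.min (b i) (d i)).
apply/seteqP; split => x /=.
  by move=> [h1 h2] i; have /andP[p1 p2] := h1 i; have /andP[p3 p4] := h2 i;
    rewrite gt_max lt_min p1 p2 p3 p4.
by move=> h; split=> i; have := h i; rewrite gt_max lt_min => /andP[/andP[p1 p2] /andP[p3 p4]]; apply/andP; split.
Qed.

Lemma measurable_boxes (A : set X) : measurable A -> <<s boxes >> A.
Proof.
pose T := g_sigma_algebraType boxes.
have mc (i : 'I_m) : measurable_fun [set: T] (fun x : T => (x : X) ord0 i : measurableTypeR R).
  apply: (measurability _ (RGenOInfty.measurableE R)) => _ [_ [t ->] <-].
  (* A coordinate half-space is the union of boxes whose other bounds are the integers [- n] and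
     [n]. *)
  rewrite setTI (_ : _ @^-1` _ = \bigcup_n (box (fun j => if j == i then t else - n%:R)
     (fun=> n%:R) : set T)).
    apply: bigcup_measurable => n _; apply: sub_sigma_algebra.
    by exists (fun j => if j == i then t else - n%:R), (fun=> n%:R).
  apply/seteqP; split => x /=; rewrite in_itv /= andbT.
    move=> tx; exists (Num.bound (`|x : X|)) => // j.
    have xb : `|x : X| < (Num.bound (`|x : X|))%:R by exact: archi_boundP.
    have := le_lt_trans (coord_le_norm (x : X) j) xb; rewrite ltr_norml => /andP[h1 h2].
    by rewrite h2 andbT; case: eqP => [->|].
  by move=> [n _ /(_ i)]; rewrite eqxx => /andP[].
apply: smallest_sub; first exact: smallest_sigma_algebra.
rewrite -bigcup_seq; apply: bigcup_sub => i _ B [Y mY <-].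
exact: mc.
Qed.

(** Bumps carry orthogonality over to indicators of boxes, Dynkin's lemma to all measurable sets.
    Balls enter because [f] is only locally integrable. *)
Lemma ae_eq0_of_testf f : (forall r : R, L1 (fun x => f x * \1_(ball (0 : X) r) x)) ->
  measurable_fun setT f ->
  (forall g : X -> R, testf g -> \int[mu]_x (f x * g x) = 0) ->
  forall r : R, ae_eq mu setT (EFin \o (fun x => f x * \1_(ball (0 : X) r) x)) (cst 0%E).
Proof.
move=> fl mf fg r.
(* The bumps live in the box and are at most 1, so [|f|] on one fixed ball dominates. *)
have boxI a b : \int[mu]_x (f x * \1_(box a b) x) = 0.
  have [s s0 bs] := box_bounded a b.
  have H : \int[mu]_x (f x * box_bump a b n.+1%:R x) @[n --> \oo] -->
      \int[mu]_x (f x * \1_(box a b) x).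
    apply: (@Rdominated_cvg _ _ _ _ _ _ (fun x => `|f x * \1_(ball (0 : X) (s + 1)) x|)).
    - move=> n; apply: measurable_funM => //.
      by apply: continuous_rV_measurable; apply: smooth_continuous; exact: smooth_box_bump.
    - by apply: measurable_funM => //; apply: measurable_indic; exact: measurable_box.
    - by move=> x; apply: cvgM; [exact: cvg_cst|exact: box_bump_cvg].
    - exact: integrable_norm.
    - move=> n x; rewrite !normrM ler_wpM2l//.
      have [h|h] := pselect (box a b x); last by rewrite box_bump_eq0// normr0.
      rewrite indicE mem_set ?normr1; last first.
        rewrite -ball_normE /= sub0r normrN; have := bs _ h; lra.
      by rewrite ger0_norm ?box_bump_ge0// box_bump_le1.
  have E : (fun n => \int[mu]_x (f x * box_bump a b n.+1%:R x)) = cst 0.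
    by apply/funext => n; rewrite fg//; exact: testf_box_bump.
  by move: H; rewrite E => /cvg_lim <-//; rewrite lim_cst.
have [r0|r0] := leP r 0.
  apply: aeW => x _ /=; rewrite (_ : ball 0 r = set0) ?indic0 ?mulr0//.
  by apply/seteqP; split => y //=; rewrite -ball_normE /= ltNge (le_trans r0).
pose F x := f x * \1_(ball (0 : X) r) x.
have iF : L1 F by exact: fl.
have iFA A : measurable A -> L1 (fun x => F x * \1_A x).
  move=> mA; apply: (@RintegrableM_bounded _ _ _ _ _ _ 1) => // x.
  by rewrite indicE; case: (_ \in _); rewrite ?normr1 ?normr0.
pose H := [set A : set X | measurable A /\ \int[mu]_x (F x * \1_A x) = 0].
(* Boxes are stable under intersection, and the sets over which the truncated [F] integrates to 0
   form a lambda-system. *)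
have sub : <<s boxes >> `<=` H.
  apply: (lambda_system_subset setI_closed_boxes); last by move=> ? _ ?.
    split => //.
    - split => //; rewrite -[RHS](boxI (fun=> - r) (fun=> r)).
      apply: eq_Rintegral => x _; rewrite indicT mulr1 /F ball_box//; congr (_ * \1_ _ x).
      by congr box; apply/funext => i; rewrite mxE ?sub0r ?add0r.
    - move=> A B BA [mA iA] [mB iB]; split; first exact: measurableD.
      under eq_Rintegral => x _.
        rewrite (_ : F x * \1_(A `\` B) x = F x * \1_A x - F x * \1_B x).
          over.
        rewrite -mulrBr !indicE in_setD; congr (_ * _).
        case: (boolP (x \in B)) => [xB|]; last by rewrite andbT subr0.
        have -> : x \in A by rewrite inE; apply: BA; rewrite inE in xB.
        by rewrite subrr.
      by rewrite RintegralB ?iA ?iB ?subrr//; exact: iFA.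
    - move=> A ndA HA; have mU : measurable (\bigcup_n A n).
        by apply: bigcup_measurable => n _; case: (HA n).
      split => //.
      have C : \int[mu]_x (F x * \1_(A n) x) @[n --> \oo] --> \int[mu]_x (F x * \1_(\bigcup_n A n) x).
        apply: (@Rdominated_cvg _ _ _ _ _ _ (fun x => `|F x|)).
        - by move=> n; apply: Rintegrable_measurable (iFA _ _); case: (HA n).
        - by apply: Rintegrable_measurable (iFA _ _).
        - move=> x; apply: cvgM; first exact: cvg_cst.
          have [[N _ xN]|xN] := pselect ((\bigcup_n A n) x).
            apply: cvg_near_cst; near=> n; rewrite !indicE !mem_set//; first by exists N.
            by move: xN; apply/subsetPset/ndA; near: n; exact: nbhs_infty_ge.
          apply: cvg_near_cst; near=> n; rewrite !indicE !memNset// => xn.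
          by apply: xN; exists n.
        - exact: integrable_norm.
        - move=> n x; rewrite normrM ler_piMr// indicE.
          by case: (_ \in _); rewrite ?normr1 ?normr0.
      move: C; rewrite (_ : (fun n => _) = cst 0); last by apply/funext => n; case: (HA n).
      by move=> /cvg_lim <-//; rewrite lim_cst.
  move=> _ [a [b ->]]; split; first exact: measurable_box.
  (* In the sup norm the ball is itself a box, so the intersection is one and [boxI] applies. *)
  have [c [d E]] : boxes (box a b `&` ball 0 r).
    by apply: setI_closed_boxes; [exists a, b|rewrite ball_box//; eexists; eexists; reflexivity].
  rewrite -[RHS](boxI c d) -E; apply: eq_Rintegral => x _.
  by rewrite /F indicI /= -mulrA [X in _ * X]mulrC.
apply: (@integral_ae_eq _ _ _ mu setT measurableT) => //.
move=> E _ mE; rewrite integral_cst// mul0e.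
have [_ HE] := sub _ (measurable_boxes mE).
rewrite integral_mkcond -[RHS]/(0%:E) -HE EFin_Rintegral; last exact: iFA.
apply: eq_integral => x _; rewrite patchE [\1_E x]indicE.
by case: ifP => _; rewrite ?mulr1 ?mulr0.
Unshelve. all: by end_near. Qed.
End box_bump.

(** * Transforms of distributions and Sobolev norms *)

Section complex_transform.
Context (R : realType) (m : nat).
Local Notation X := 'rV[R]_m.
Local Notation C := R[i].
Local Notation Re := (@complex.Re R).
Local Notation Im := (@complex.Im R).
Local Notation mu := (lebesgue_rV R m).
Local Notation L1 f := (mu.-integrable setT (EFin \o f)).
Implicit Types (f g h phi psi : X -> C).

Definition cint f := L1 (fun x => Re (f x)) /\ L1 (fun x => Im (f x)).

Lemma cintegralE f : cintegral f = Complex (\int[mu]_x Re (f x)) (\int[mu]_x Im (f x)).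
Proof. by []. Qed.

Lemma normc_sqr (z : C) : normc z ^+ 2 = Re z ^+ 2 + Im z ^+ 2.
Proof. by case: z => a b; rewrite /= sqr_sqrtr// addr_ge0// sqr_ge0. Qed.

Lemma Re_le_normc (z : C) : `|Re z| <= normc z.
Proof. by case: z => a b /=; rewrite -sqrtr_sqr ler_sqrt ?lerDl ?sqr_ge0// addr_ge0// sqr_ge0. Qed.

Lemma Im_le_normc (z : C) : `|Im z| <= normc z.
Proof. by case: z => a b /=; rewrite -sqrtr_sqr ler_sqrt ?lerDr ?sqr_ge0// addr_ge0// sqr_ge0. Qed.

Lemma normc_ge0 (z : C) : 0 <= normc z.
Proof. by case: z => a b; exact: sqrtr_ge0. Qed.

Lemma normc_le_abs (z : C) : normc z <= `|Re z| + `|Im z|.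
Proof.
rewrite -[leRHS]ger0_norm ?addr_ge0// -(ger0_norm (normc_ge0 z)) -ler_sqr ?nnegrE//.
rewrite !real_normK ?num_real// normc_sqr sqrrD !real_normK ?num_real//.
by have := mulr_ge0 (normr_ge0 (Re z)) (normr_ge0 (Im z)); lra.
Qed.

Lemma cReM (z w : C) : Re (z * w) = Re z * Re w - Im z * Im w.
Proof. by case: z => a b; case: w => c d. Qed.
Lemma cImM (z w : C) : Im (z * w) = Re z * Im w + Im z * Re w.
Proof. by case: z => a b; case: w => c d. Qed.
Lemma cReD (z w : C) : Re (z + w) = Re z + Re w. Proof. by case: z => a b; case: w. Qed.
Lemma cImD (z w : C) : Im (z + w) = Im z + Im w. Proof. by case: z => a b; case: w. Qed.
Lemma cReN (z : C) : Re (- z) = - Re z. Proof. by case: z. Qed.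
Lemma cImN (z : C) : Im (- z) = - Im z. Proof. by case: z. Qed.
Lemma complex_ext (z w : C) : Re z = Re w -> Im z = Im w -> z = w.
Proof. by case: z => a b; case: w => c d /= -> ->. Qed.

Lemma measurable_normc f : cmeasurable f -> measurable_fun setT (fun x => normc (f x)).
Proof.
move=> [mr mi]; rewrite (_ : (fun x => _) = (fun x => Num.sqrt (Re (f x) ^+ 2 + Im (f x) ^+ 2))).
  apply: (measurableT_comp (f := @Num.sqrt R)).
    by apply: continuous_measurable_fun; exact: sqrt_continuous.
  by apply: measurable_funD; apply: measurable_funX.
by apply/funext => x; case: (f x).
Qed.

Lemma cint_le f (G : X -> R) : cmeasurable f -> (forall x, normc (f x) <= G x) -> L1 G -> cint f.
Proof.
move=> [mr mi] fG iG; split; apply: Rintegrable_le iG => // x.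
- exact: le_trans (Re_le_normc _) (fG x).
- exact: le_trans (Im_le_normc _) (fG x).
Qed.

Lemma cint_cmeasurable f : cint f -> cmeasurable f.
Proof. by move=> [i1 i2]; split; [exact: Rintegrable_measurable i1|exact: Rintegrable_measurable i2]. Qed.

Lemma cint_integrable_normc f : cint f -> L1 (fun x => normc (f x)).
Proof.
move=> fi; have [mr mi] := cint_cmeasurable fi; have [i1 i2] := fi.
apply: (@Rintegrable_le _ _ _ _ _ (fun x => `|Re (f x)| + `|Im (f x)|)).
- exact: measurable_normc.
- by move=> x; rewrite ger0_norm ?normc_ge0// normc_le_abs.
- by apply: RintegrableD; exact: integrable_norm.
Qed.

Lemma cmeasurableM f g : cmeasurable f -> cmeasurable g -> cmeasurable (fun x => f x * g x).
Proof.
move=> [mr mi] [nr ni]; split.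
- rewrite (_ : _ \o _ = fun x => Re (f x) * Re (g x) - Im (f x) * Im (g x)).
    by apply: measurable_funB; apply: measurable_funM.
  by apply/funext => x /=; rewrite cReM.
- rewrite (_ : _ \o _ = fun x => Re (f x) * Im (g x) + Im (f x) * Re (g x)).
    by apply: measurable_funD; apply: measurable_funM.
  by apply/funext => x /=; rewrite cImM.
Qed.

Lemma cmeasurableB f g : cmeasurable f -> cmeasurable g -> cmeasurable (fun x => f x - g x).
Proof.
move=> [mr mi] [nr ni]; split.
- rewrite (_ : _ \o _ = fun x => Re (f x) - Re (g x)); first exact: measurable_funB.
  by apply/funext => x /=; rewrite cReD cReN.
- rewrite (_ : _ \o _ = fun x => Im (f x) - Im (g x)); first exact: measurable_funB.
  by apply/funext => x /=; rewrite cImD cImN.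
Qed.

Lemma cintegralD f g : cint f -> cint g ->
  cintegral (fun x => f x + g x) = cintegral f + cintegral g.
Proof.
move=> [f1 f2] [g1 g2]; apply: complex_ext; rewrite ?cReD ?cImD /=.
- by rewrite -RintegralD//; apply: eq_Rintegral => x _; rewrite cReD.
- by rewrite -RintegralD//; apply: eq_Rintegral => x _; rewrite cImD.
Qed.

Lemma cintegralB f g : cint f -> cint g ->
  cintegral (fun x => f x - g x) = cintegral f - cintegral g.
Proof.
move=> [f1 f2] [g1 g2]; apply: complex_ext; rewrite ?cReD ?cImD ?cReN ?cImN /=.
- by rewrite -RintegralB//; apply: eq_Rintegral => x _; rewrite cReD cReN.
- by rewrite -RintegralB//; apply: eq_Rintegral => x _; rewrite cImD cImN.
Qed.

Lemma cintegralZ (z : C) f : cint f ->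
  cintegral (fun x => z * f x) = z * cintegral f.
Proof.
move=> [f1 f2]; apply: complex_ext; rewrite ?cReM ?cImM /=.
- rewrite -RintegralZl// -RintegralZl// -RintegralB//; [|exact: RintegrableZ|exact: RintegrableZ].
  by apply: eq_Rintegral => x _; rewrite cReM.
- rewrite -RintegralZl// -RintegralZl// -RintegralD//; [|exact: RintegrableZ|exact: RintegrableZ].
  by apply: eq_Rintegral => x _; rewrite cImM.
Qed.

Lemma normc_cintegral_le f : cint f -> normc (cintegral f) <= 2 * \int[mu]_x normc (f x).
Proof.
move=> fi; have [f1 f2] := fi; have fn := cint_integrable_normc fi.
rewrite (le_trans (normc_le_abs _))//= mulrDl !mul1r lerD//.
- rewrite (le_trans (le_normr_Rintegral _ f1))//; apply: le_Rintegral => //.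
    exact: integrable_norm.
  by move=> x _; exact: Re_le_normc.
- rewrite (le_trans (le_normr_Rintegral _ f2))//; apply: le_Rintegral => //.
    exact: integrable_norm.
  by move=> x _; exact: Im_le_normc.
Qed.

Definition fc : R := (2 * pi) `^ (- (m%:R / 2)).

Lemma fc_gt0 : 0 < fc. Proof. by rewrite powR_gt0// mulr_gt0// pi_gt0. Qed.

Lemma fc_sqr : fc ^+ 2 = (2 * pi) ^- m.
Proof.
rewrite -powR_mulrn; last exact: ltW fc_gt0.
rewrite /fc -powRrM mulNr divfK// powRN powR_mulrn//.
by rewrite mulr_ge0// pi_ge0.
Qed.

Lemma fourierE f xi : cint f -> fourier f xi =
  Complex (fc * (Fcos (Re \o f) xi + Fsin (Im \o f) xi))
          (fc * (Fcos (Im \o f) xi - Fsin (Re \o f) xi)).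
Proof.
move=> [i1 i2]; rewrite /fourier -/fc cintegralE; apply: complex_ext; rewrite ?cReM ?cImM /=.
- rewrite mul0r subr0; congr (_ * _).
  rewrite /Fcos /Fsin -RintegralD//; [|exact: integrableM_cos|exact: integrableM_sin].
  by apply: eq_Rintegral => x _; rewrite cReM /= cosN sinN dotpC; ring.
- rewrite mul0r addr0; congr (_ * _).
  rewrite /Fcos /Fsin -RintegralB//; [|exact: integrableM_cos|exact: integrableM_sin].
  by apply: eq_Rintegral => x _; rewrite cImM /= cosN sinN dotpC; ring.
Qed.

Lemma Re_fourier f : cint f -> Re \o fourier f = fun xi => fc * (Fcos (Re \o f) xi + Fsin (Im \o f) xi).
Proof. by move=> fi; apply/funext => xi; rewrite -[LHS]/(Re (fourier f xi)) fourierE. Qed.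

Lemma Im_fourier f : cint f -> Im \o fourier f = fun xi => fc * (Fcos (Im \o f) xi - Fsin (Re \o f) xi).
Proof. by move=> fi; apply/funext => xi; rewrite -[LHS]/(Im (fourier f xi)) fourierE. Qed.

Lemma cmeasurable_fourier f : cint f -> cmeasurable (fourier f).
Proof.
move=> fi; have [i1 i2] := fi; split.
- rewrite Re_fourier//; apply: measurable_funM => //.
  by apply: measurable_funD; [exact: measurable_Fcos|exact: measurable_Fsin].
- rewrite Im_fourier//; apply: measurable_funM => //.
  by apply: measurable_funB; [exact: measurable_Fcos|exact: measurable_Fsin].
Qed.

Lemma normc_fourier_le f xi : cint f ->
  normc (fourier f xi) <= 2 * fc * (\int[mu]_x `|Re (f x)| + \int[mu]_x `|Im (f x)|).
Proof.
move=> fi; have [i1 i2] := fi; rewrite (le_trans (normc_le_abs _))// fourierE//=.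
have c0 := ltW fc_gt0.
rewrite !normrM [`|fc|]ger0_norm// -mulrDr [leRHS]mulrAC [leRHS]mulrC ler_wpM2l//.
have := ler_normD (Fcos (Re \o f) xi) (Fsin (Im \o f) xi).
have := ler_normB (Fcos (Im \o f) xi) (Fsin (Re \o f) xi).
have := Fcos_bound xi i1; have := Fsin_bound xi i1; have := Fcos_bound xi i2; have := Fsin_bound xi i2.
rewrite /comp; lra.
Qed.

(** Each of the real and imaginary parts splits into four integrals, to which [Fcos_swap] and
    [Fsin_swap] apply; the terms then regroup with [f] and [phi] exchanged. *)
Lemma cmul_fourier_swap f phi : cint f -> cint phi ->
  cintegral (fun x => f x * fourier phi x) = cintegral (fun x => fourier f x * phi x).
Proof.
move=> fi pi_; have [f1 f2] := fi; have [p1 p2] := pi_.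
have MB (g h : X -> R) : L1 g -> L1 h -> L1 (fun x => g x * Fcos h x).
  by move=> ig ih; exact: RintegrableM_bounded ig (measurable_Fcos ih) (fun x => Fcos_bound x ih).
have MS (g h : X -> R) : L1 g -> L1 h -> L1 (fun x => g x * Fsin h x).
  by move=> ig ih; exact: RintegrableM_bounded ig (measurable_Fsin ih) (fun x => Fsin_bound x ih).
have ED (g h : X -> R) : L1 g -> L1 h ->
    \int[mu]_x (fc * (g x + h x)) = fc * (\int[mu]_x g x + \int[mu]_x h x).
  by move=> ig ih; rewrite RintegralZl ?RintegralD//; exact: RintegrableD.
have EB (g h : X -> R) : L1 g -> L1 h ->
    \int[mu]_x (fc * (g x - h x)) = fc * (\int[mu]_x g x - \int[mu]_x h x).
  by move=> ig ih; rewrite RintegralZl ?RintegralB//; exact: RintegrableB.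
have SC (g h : X -> R) : L1 g -> L1 h -> \int[mu]_x (g x * Fcos h x) = \int[mu]_x (h x * Fcos g x).
  by move=> ig ih; rewrite Fcos_swap//.
have SS (g h : X -> R) : L1 g -> L1 h -> \int[mu]_x (g x * Fsin h x) = \int[mu]_x (h x * Fsin g x).
  by move=> ig ih; rewrite Fsin_swap//.
have ID (g h : X -> R) : L1 g -> L1 h ->
    \int[mu]_x (g x + h x) = \int[mu]_x g x + \int[mu]_x h x.
  by move=> ig ih; exact: RintegralD.
have IB (g h : X -> R) : L1 g -> L1 h ->
    \int[mu]_x (g x - h x) = \int[mu]_x g x - \int[mu]_x h x.
  by move=> ig ih; exact: RintegralB.
set a := (fun x => Re (f x)) in f1 *; set b := (fun x => Im (f x)) in f2 *.
set c := (fun x => Re (phi x)) in p1 *; set d := (fun x => Im (phi x)) in p2 *.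
apply: complex_ext => /=.
- transitivity (fc * (\int[mu]_x (a x * Fcos c x + a x * Fsin d x) -
                      \int[mu]_x (b x * Fcos d x - b x * Fsin c x))).
    rewrite -EB; [|by apply: RintegrableD; [exact: MB|exact: MS]|by apply: RintegrableB; [exact: MB|exact: MS]].
    by apply: eq_Rintegral => x _; rewrite fourierE// cReM /= /a /b; ring.
  transitivity (fc * (\int[mu]_x (c x * Fcos a x + c x * Fsin b x) -
                      \int[mu]_x (d x * Fcos b x - d x * Fsin a x))).
    rewrite (ID _ _ (MB _ _ f1 p1) (MS _ _ f1 p2)) (IB _ _ (MB _ _ f2 p2) (MS _ _ f2 p1)).
    rewrite (ID _ _ (MB _ _ p1 f1) (MS _ _ p1 f2)) (IB _ _ (MB _ _ p2 f2) (MS _ _ p2 f1)).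
    rewrite (SC _ _ f1 p1) (SS _ _ f1 p2) (SC _ _ f2 p2) (SS _ _ f2 p1).
    have key (A B E D : R) : fc * (A + B - (E - D)) = fc * (A + D - (E - B)) by ring.
    exact: key.
  rewrite -EB; [|by apply: RintegrableD; [exact: MB|exact: MS]|by apply: RintegrableB; [exact: MB|exact: MS]].
  by apply: eq_Rintegral => x _; rewrite fourierE// cReM /= /c /d; ring.
- transitivity (fc * (\int[mu]_x (a x * Fcos d x - a x * Fsin c x) +
                      \int[mu]_x (b x * Fcos c x + b x * Fsin d x))).
    rewrite -ED; [|by apply: RintegrableB; [exact: MB|exact: MS]|by apply: RintegrableD; [exact: MB|exact: MS]].
    by apply: eq_Rintegral => x _; rewrite fourierE// cImM /= /a /b; ring.
  transitivity (fc * (\int[mu]_x (d x * Fcos a x + d x * Fsin b x) +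
                      \int[mu]_x (c x * Fcos b x - c x * Fsin a x))).
    rewrite (IB _ _ (MB _ _ f1 p2) (MS _ _ f1 p1)) (ID _ _ (MB _ _ f2 p1) (MS _ _ f2 p2)).
    rewrite (ID _ _ (MB _ _ p2 f1) (MS _ _ p2 f2)) (IB _ _ (MB _ _ p1 f2) (MS _ _ p1 f1)).
    rewrite (SC _ _ f1 p2) (SS _ _ f1 p1) (SC _ _ f2 p1) (SS _ _ f2 p2).
    have key (A B E D : R) : fc * (A - B + (E + D)) = fc * (A + D + (E - B)) by ring.
    exact: key.
  rewrite -ED; [|by apply: RintegrableD; [exact: MB|exact: MS]|by apply: RintegrableB; [exact: MB|exact: MS]].
  by apply: eq_Rintegral => x _; rewrite fourierE// cImM /= /c /d; ring.
Qed.

End complex_transform.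

Section schwartz_decay.
Context (R : realType) (m : nat).
Local Notation X := 'rV[R]_m.
Local Notation C := R[i].
Local Notation Re := (@complex.Re R).
Local Notation Im := (@complex.Im R).
Local Notation mu := (lebesgue_rV R m).
Local Notation L1 f := (mu.-integrable setT (EFin \o f)).
Implicit Types (f g h phi psi : X -> C) (x xi : X).

Lemma enorm_ge0 x : 0 <= enorm x. Proof. exact: sqrtr_ge0. Qed.

Lemma dotp_ge0 x : 0 <= dotp x x.
Proof. by apply: sumr_ge0 => i _; rewrite -expr2 sqr_ge0. Qed.

Lemma enorm_sqr x : enorm x ^+ 2 = dotp x x.
Proof. by rewrite sqr_sqrtr// dotp_ge0. Qed.

Lemma coord_le_enorm x i : `|x ord0 i| <= enorm x.
Proof.
rewrite -sqrtr_sqr ler_sqrt ?dotp_ge0// /dotp (bigD1 i)//= -expr2 lerDl.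
by apply: sumr_ge0 => j _; rewrite -expr2 sqr_ge0.
Qed.

Lemma norm_le_enorm x : `|x| <= enorm x.
Proof. by apply: norm_le_coord => [|i]; [exact: enorm_ge0|exact: coord_le_enorm]. Qed.

Lemma enorm_le_norm x : enorm x <= m%:R * `|x|.
Proof.
apply: (le_trans (enorm_le_sum x)); apply: (@le_trans _ _ (\sum_(i < m) `|x|)).
  by apply: ler_sum => i _; exact: coord_le_norm.
by rewrite sumr_const card_ord -[_ *+ _]mulr_natl.
Qed.

(** The Poisson kernel decays only polynomially, at most at order [2 m], so that it is a common
    integrable majorant for Schwartz functions. *)
Lemma poisson_kernel_decay x : 2 ^+ m <= (1 + enorm x) ^+ m.*2 * poisson_kernel x.
Proof.
have pc (z : R) : z ^+ m = \prod_(i < m) z by rewrite prodr_const card_ord.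
rewrite /poisson_kernel -mul2n exprM !pc -big_split/=.
apply: ler_prod => i _; rewrite ler0n/=.
have h : 0 < 1 + x ord0 i ^+ 2 by rewrite ltr_pwDl// sqr_ge0.
rewrite mulrA ler_pdivlMr// [leRHS]mulrC ler_wpM2l//.
have := coord_le_enorm x i; have e0 := enorm_ge0 x.
move=> h1; have : `|x ord0 i| ^+ 2 <= enorm x ^+ 2 by rewrite lerXn2r ?nnegrE.
by rewrite real_normK ?num_real// sqrrD; lra.
Qed.

Lemma poisson_kernel_gt0 x : 0 < poisson_kernel x.
Proof. by apply: prodr_gt0 => i _; rewrite divr_gt0// ltr_pwDl// sqr_ge0. Qed.

Lemma schwartz_decay phi k : is_schwartz phi ->
  exists2 B, 0 < B & forall x, (1 + enorm x) ^+ k * normc (phi x) <= B * poisson_kernel x.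
Proof.
move=> [_ _ /(_ (k + m.*2)%N [::])[B HB]].
(* The summand 1 makes the constant positive even when [B] is 0. *)
exists (2 ^- m * `|B| + 1) => [|x].
  by rewrite ltr_wpDl// mulr_ge0// invr_ge0 exprn_ge0.
have e0 : 0 < 1 + enorm x by rewrite ltr_pwDl// enorm_ge0.
have E : cpderiv [::] phi x = phi x by rewrite /cpderiv /=; case: (phi x).
have := HB x; rewrite E exprD => H.
have p0 := poisson_kernel_gt0 x.
apply: (@le_trans _ _ (2 ^- m * `|B| * poisson_kernel x)); last first.
  by rewrite ler_pM2r// lerDl.
rewrite -mulrA [leRHS]mulrC ler_pdivlMr ?exprn_gt0//.
have d := poisson_kernel_decay x.
have n0 : 0 <= (1 + enorm x) ^+ k * normc (phi x) by rewrite mulr_ge0 ?exprn_ge0 ?normc_ge0// ltW.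
apply: (le_trans (ler_wpM2l n0 d)); rewrite mulrA ler_pM2r//.
by rewrite mulrAC (le_trans H)// ler_norm.
Qed.

Lemma schwartz_cmeasurable phi : is_schwartz phi -> cmeasurable phi.
Proof.
by move=> [sr si _]; split; apply: continuous_rV_measurable; exact: smooth_continuous.
Qed.

Lemma schwartz_cint phi : is_schwartz phi -> cint phi.
Proof.
move=> sp; have [B B0 H] := schwartz_decay 0 sp.
apply: (@cint_le _ _ _ (fun x => B * poisson_kernel x)); first exact: schwartz_cmeasurable.
  by move=> x; have := H x; rewrite expr0 mul1r.
by apply: RintegrableZ; exact: integrable_poisson_kernel.
Qed.

Lemma testf_pderiv al (p : X -> R) : testf p -> testf (pderiv al p).
Proof. by elim: al => //= i al IH tp; apply: testf_pd; exact: IH. Qed.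

Lemma testf_decay k (p : X -> R) : testf p ->
  exists B, forall x, (1 + enorm x) ^+ k * `|p x| <= B.
Proof.
move=> tp; have [B HB] := testf_bounded tp; have [_ [r r0 h]] := tp.
exists ((1 + m%:R * r) ^+ k * B) => x.
have B0 : 0 <= B by exact: le_trans (HB x).
have [xr|xr] := leP `|x| r; last first.
  by rewrite h// normr0 mulr0 mulr_ge0// exprn_ge0// addr_ge0// mulr_ge0// ltW.
rewrite ler_pM ?exprn_ge0// ?addr_ge0 ?enorm_ge0//.
rewrite lerXn2r ?nnegrE ?addr_ge0 ?enorm_ge0 ?mulr_ge0 ?(ltW r0)// lerD2l.
by rewrite (le_trans (enorm_le_norm x))// ler_wpM2l.
Qed.

Lemma testf_schwartz (p q : X -> R) : testf p -> testf q ->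
  is_schwartz (fun x => Complex (p x) (q x)).
Proof.
move=> tp tq; split; [exact: tp.1|exact: tq.1|move=> k al].
have [B1 H1] := testf_decay k (testf_pderiv al tp).
have [B2 H2] := testf_decay k (testf_pderiv al tq).
exists (B1 + B2) => x; rewrite (le_trans _ (lerD (H1 x) (H2 x)))// -mulrDr ler_wpM2l//.
  by rewrite exprn_ge0// addr_ge0// enorm_ge0.
exact: normc_le_abs.
Qed.

Lemma testf0 : testf (fun _ : X => 0 : R).
Proof. by split; [exact: smooth_cst|exists 1]. Qed.

Lemma testfZ c (p : X -> R) : testf p -> testf (fun x => c * p x).
Proof. by move=> tp; apply: testf_mul => //; exact: smooth_cst. Qed.

Definition ctestf psi := testf (fun x => Re (psi x)) /\ testf (fun x => Im (psi x)).

Lemma ctestf_schwartz psi : ctestf psi -> is_schwartz psi.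
Proof.
move=> [tp tq]; have := testf_schwartz tp tq; congr (is_schwartz _).
by apply/funext => x; case: (psi x).
Qed.

Lemma ctestf_cint psi : ctestf psi -> cint psi.
Proof. by move=> /ctestf_schwartz/schwartz_cint. Qed.

Lemma FcosZ c (p : X -> R) xi : L1 p -> Fcos (fun x => c * p x) xi = c * Fcos p xi.
Proof.
move=> ip; rewrite /Fcos -RintegralZl//; last exact: integrableM_cos.
by apply: eq_Rintegral => x _; rewrite mulrA.
Qed.

Lemma FsinZ c (p : X -> R) xi : L1 p -> Fsin (fun x => c * p x) xi = c * Fsin p xi.
Proof.
move=> ip; rewrite /Fsin -RintegralZl//; last exact: integrableM_sin.
by apply: eq_Rintegral => x _; rewrite mulrA.
Qed.

Lemma FcosN (p : X -> R) xi : Fcos p (- xi) = Fcos p xi.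
Proof. by apply: eq_Rintegral => x _; rewrite dotpNr cosN. Qed.

Lemma FsinN (p : X -> R) xi : L1 p -> Fsin p (- xi) = - Fsin p xi.
Proof.
move=> ip; rewrite -[RHS]mulN1r /Fsin -RintegralZl//; last exact: integrableM_sin.
by apply: eq_Rintegral => x _; rewrite dotpNr sinN; ring.
Qed.

Lemma trig_decayD (p q : X -> R) (c d : R) : testf p -> testf q ->
  trig_poly_decay (fun xi => c * Fcos p xi + d * Fsin q xi).
Proof.
move=> tp tq; exists (fun x => c * p x), (fun x => d * q x); split; [exact: testfZ|exact: testfZ|].
apply/funext => xi; rewrite FcosZ ?FsinZ//; exact: testf_integrable.
Qed.

Lemma fourier_schwartz psi : ctestf psi -> is_schwartz (fourier psi).
Proof.
move=> tpsi; have ip := ctestf_cint tpsi; have [tp tq] := tpsi.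
have := trig_decay_schwartz (trig_decayD (fc R m) (fc R m) tp tq) (trig_decayD (fc R m) (- fc R m) tq tp).
congr (is_schwartz _); apply/funext => x; rewrite fourierE//.
by apply: complex_ext => /=; rewrite /comp; ring.
Qed.

Definition inv_fourier psi x := fourier psi (- x).

Lemma inv_fourierE psi x : ctestf psi -> inv_fourier psi x =
  Complex (fc R m * (Fcos (Re \o psi) x - Fsin (Im \o psi) x))
          (fc R m * (Fcos (Im \o psi) x + Fsin (Re \o psi) x)).
Proof.
move=> tpsi; have [/testf_integrable i1 /testf_integrable i2] := tpsi.
rewrite /inv_fourier fourierE; last exact: ctestf_cint.
by rewrite !FcosN !FsinN// opprK.
Qed.

Lemma inv_fourier_schwartz psi : ctestf psi -> is_schwartz (inv_fourier psi).
Proof.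
move=> tpsi; have [tp tq] := tpsi.
have := trig_decay_schwartz (trig_decayD (fc R m) (- fc R m) tp tq) (trig_decayD (fc R m) (fc R m) tq tp).
congr (is_schwartz _); apply/funext => x; rewrite inv_fourierE//.
by apply: complex_ext => /=; rewrite /comp; ring.
Qed.

Lemma testf_Fcos_integrable (p : X -> R) : testf p -> L1 (Fcos p).
Proof.
move=> tp; have := trig_decay_schwartz (trig_decayD 1 0 tp testf0) (trig_decayD 0 0 testf0 testf0).
by move=> /schwartz_cint[+ _]; congr (mu.-integrable _ _); apply/funext => x /=; rewrite mul1r mul0r addr0.
Qed.

Lemma testf_Fsin_integrable (p : X -> R) : testf p -> L1 (Fsin p).
Proof.
move=> tp; have := trig_decay_schwartz (trig_decayD 0 1 testf0 tp) (trig_decayD 0 0 testf0 testf0).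
by move=> /schwartz_cint[+ _]; congr (mu.-integrable _ _); apply/funext => x /=; rewrite mul1r mul0r add0r.
Qed.

Lemma FsinFcos0 (p : X -> R) x : testf p -> Fsin (Fcos p) x = 0.
Proof.
move=> tp; apply: Rintegral_opp0; first exact/integrableM_sin/testf_Fcos_integrable.
by move=> y; rewrite FcosN dotpNl sinN mulrN.
Qed.

Lemma FcosFsin0 (p : X -> R) x : testf p -> Fcos (Fsin p) x = 0.
Proof.
move=> tp; apply: Rintegral_opp0; first exact/integrableM_cos/testf_Fsin_integrable.
by move=> y; rewrite FsinN ?testf_integrable// dotpNl cosN mulNr.
Qed.

Lemma testf_inversion (p : X -> R) x : testf p ->
  Fcos (Fcos p) x + Fsin (Fsin p) x = (2 * pi) ^+ m * p x.
Proof.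
move=> tp; have [B HB] := testf_bounded tp.
have i1 := testf_Fcos_integrable tp; have i2 := testf_Fsin_integrable tp.
rewrite -(inversion HB (smooth_continuous tp.1 (x := x)) (testf_integrable tp) i1 i2).
rewrite -RintegralD//; [|exact: integrableM_cos|exact: integrableM_sin].
by apply: eq_Rintegral => y _; ring.
Qed.

(** The mixed transforms vanish by parity, [testf_inversion] evaluates the others, and the square of
    the normalisation cancels [(2 * pi) ^+ m]. *)
Lemma inv_fourierK psi : ctestf psi -> fourier (inv_fourier psi) = psi.
Proof.
move=> tpsi; have [tp tq] := tpsi; have ic := schwartz_cint (inv_fourier_schwartz tpsi).
apply/funext => y; rewrite fourierE//.
have F0 := fc_gt0 R m.
have E1 : Re \o inv_fourier psi = fun x => fc R m * (Fcos (Re \o psi) x - Fsin (Im \o psi) x).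
  by apply/funext => x; rewrite -[LHS]/(Re (inv_fourier psi x)) inv_fourierE.
have E2 : Im \o inv_fourier psi = fun x => fc R m * (Fcos (Im \o psi) x + Fsin (Re \o psi) x).
  by apply/funext => x; rewrite -[LHS]/(Im (inv_fourier psi x)) inv_fourierE.
have p1 := testf_Fcos_integrable tp; have p2 := testf_Fsin_integrable tp.
have q1 := testf_Fcos_integrable tq; have q2 := testf_Fsin_integrable tq.
rewrite E1 E2 !FcosZ ?FsinZ; [|exact: RintegrableB|exact: RintegrableD|exact: RintegrableD|exact: RintegrableB].
have CB (u v : X -> R) : L1 u -> L1 v -> Fcos (fun x => u x - v x) y = Fcos u y - Fcos v y.
  move=> iu iv; rewrite /Fcos -RintegralB; [|by []|exact: integrableM_cos|exact: integrableM_cos].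
  by apply: eq_Rintegral => x _; ring.
have SB (u v : X -> R) : L1 u -> L1 v -> Fsin (fun x => u x - v x) y = Fsin u y - Fsin v y.
  move=> iu iv; rewrite /Fsin -RintegralB; [|by []|exact: integrableM_sin|exact: integrableM_sin].
  by apply: eq_Rintegral => x _; ring.
have CD (u v : X -> R) : L1 u -> L1 v -> Fcos (fun x => u x + v x) y = Fcos u y + Fcos v y.
  move=> iu iv; rewrite /Fcos -RintegralD; [|by []|exact: integrableM_cos|exact: integrableM_cos].
  by apply: eq_Rintegral => x _; ring.
have SD (u v : X -> R) : L1 u -> L1 v -> Fsin (fun x => u x + v x) y = Fsin u y + Fsin v y.
  move=> iu iv; rewrite /Fsin -RintegralD; [|by []|exact: integrableM_sin|exact: integrableM_sin].
  by apply: eq_Rintegral => x _; ring.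
rewrite (CB _ _ p1 q2) (SD _ _ q1 p2) (CD _ _ q1 p2) (SB _ _ p1 q2).
rewrite (FcosFsin0 y tq) (FcosFsin0 y tp) (FsinFcos0 y tq) (FsinFcos0 y tp) !subr0 add0r addr0 sub0r !mulrN opprK -!mulrDr.
rewrite (testf_inversion y tp) (testf_inversion y tq) !mulrA -expr2 fc_sqr.
have P0 : (2 * pi) ^+ m != 0 :> R by rewrite expf_neq0// mulf_neq0// gt_eqF// pi_gt0.
by rewrite mulVf// !mul1r /=; case: (psi y).
Qed.

End schwartz_decay.

(** * Almost everywhere uniqueness of transforms and the weighted norm *)

Section transforms.
Context (R : realType) (m : nat).
Local Notation X := 'rV[R]_m.
Local Notation C := R[i].
Local Notation Re := (@complex.Re R).
Local Notation Im := (@complex.Im R).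
Local Notation mu := (lebesgue_rV R m).
Local Notation L1 f := (mu.-integrable setT (EFin \o f)).
Local Notation S := (schwartz R m).
Implicit Types (f g h phi psi : X -> C) (x xi : X) (u v : sdist R m).

Lemma rV_ball0 (r : R) x : ball (0 : X) r x = (`|x| < r) :> Prop.
Proof. by rewrite -ball_normE /ball_/= sub0r normrN. Qed.

Lemma compact_rV_bounded (K : set X) : compact K -> measurable K /\ (mu K < +oo)%E.
Proof.
move=> cK; have mK : measurable K.
  have := compact_closed (@norm_hausdorff _ _) cK => /closed_openC/open_rV_measurable/measurableC.
  by rewrite setCK.
split => //; apply: bounded_finite_measure => //; exact: compact_bounded.
Qed.

Lemma clocally_integrable_bounded f B : cmeasurable f -> (forall x, normc (f x) <= B) ->
  clocally_integrable f.
Proof.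
move=> mf fB; split => // K cK; have [mK fK] := compact_rV_bounded cK.
apply: (@le_lt_trans _ _ (\int[mu]_(x in K) B%:E)%E).
  apply: ge0_le_integral => //.
  - by move=> x _; rewrite lee_fin normc_ge0.
  - by apply/measurable_EFinP; apply: measurable_funTS; exact: measurable_normc.
  - by move=> x _; rewrite lee_fin (le_trans _ (fB x))// normc_ge0.
rewrite integral_cst//.
have B0 : 0 <= B by exact: le_trans (normc_ge0 (f 0)) (fB 0).
by rewrite lte_mul_pinfty// ?lee_fin// ge0_fin_numE.
Qed.

Lemma clocally_integrable_ball f (r : R) : clocally_integrable f ->
  L1 (fun x => normc (f x) * \1_(ball (0 : X) r) x).
Proof.
move=> [mf lf].
have mB : measurable (ball (0 : X) r) by exact: measurable_rV_ball.
have [r0|r0] := ltP 0 r; last first.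
  rewrite (_ : (fun x => _) = cst 0); first exact: integrable0.
  apply/funext => x; rewrite indicE memNset ?mulr0// rV_ball0 => xr.
  by have := le_lt_trans (normr_ge0 _) xr; rewrite ltNge r0.
apply: ge0_Rintegrable.
- by apply: measurable_funM => //; exact: measurable_normc.
- by move=> x; rewrite mulr_ge0 ?normc_ge0.
have cK : compact (closed_ball (0 : X) r).
  apply: bounded_closed_compact; last exact: closed_ball_closed.
  apply: (@bounded_set_le _ _ _ r) => x; rewrite closed_ballE// /closed_ball_/= sub0r normrN//.
have [mK _] := compact_rV_bounded cK.
apply: le_lt_trans (lf _ cK); rewrite [leRHS]integral_mkcond/=.
apply: ge0_le_integral => //.
- by move=> x _; rewrite lee_fin mulr_ge0 ?normc_ge0.
- by apply/measurable_EFinP; apply: measurable_funM => //; exact: measurable_normc.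
- apply/(measurable_restrictT _ mK); apply/measurable_EFinP.
  by apply: measurable_funTS; exact: measurable_normc.
move=> x _; rewrite patchE indicE; case: ifPn => xK.
  by rewrite lee_fin ler_piMr ?normc_ge0//; case: (x \in _).
rewrite memNset ?mulr0// => xb; move/negP: xK; apply; apply/mem_set.
by apply: subset_closure; exact: xb.
Qed.

Lemma fourier_is_transform f : cint f -> is_fourier_transform (regular_dist f) (fourier f).
Proof.
move=> fi; split.
  apply: clocally_integrable_bounded (fun x => normc_fourier_le x fi).
  exact: cmeasurable_fourier.
move=> phi psi e; rewrite /regular_dist -cmul_fourier_swap//.
  by congr cintegral; apply/funext => x; rewrite e.
exact/schwartz_cint/asboolP/schwartzP.
Qed.

Lemma schwartz_norm0_ge (phi : S) x : normc (phi x) <= schwartz_norm 0 phi.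
Proof.
have /asboolP[_ _ /(_ 0%N [::])[B HB]] := schwartzP phi.
apply: ub_le_sup.
  by exists B; move=> _ [al [y [+ ->]]]; case: al => // _; exact: HB.
exists [::], x; split => //; rewrite expr0 mul1r.
by rewrite /cpderiv /=; case: (phi x).
Qed.

Lemma regular_dist_tempered f : cint f -> tempered (regular_dist f).
Proof.
move=> fi; have fc := cint_cmeasurable fi; have fn := cint_integrable_normc fi.
have sc (phi : S) : is_schwartz phi by exact/asboolP/schwartzP.
have H0 (phi : S) x : normc (f x * phi x) <= normc (f x) * schwartz_norm 0 phi.
  by rewrite normcM ler_wpM2l ?normc_ge0// schwartz_norm0_ge.
have I (phi : S) : cint (fun x => f x * phi x).
  apply: (@cint_le _ _ _ (fun x => schwartz_norm 0 phi * normc (f x))).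
  - by apply: cmeasurableM => //; exact: schwartz_cmeasurable.
  - by move=> x; rewrite [leRHS]mulrC; exact: H0.
  - exact: RintegrableZ.
split.
  move=> a phi psi; rewrite -[RHS]/(a * regular_dist f phi + regular_dist f psi) /regular_dist -cintegralZ// -cintegralD//.
    by congr cintegral; apply/funext => x; rewrite -[(_ + _ : S) x]/(a * phi x + psi x); ring.
  apply: (@cint_le _ _ _ (fun x => normc a * normc (f x * phi x))).
  - by apply: cmeasurableM; [split; exact: measurable_cst|exact: cint_cmeasurable].
  - by move=> x; rewrite normcM.
  - by apply: RintegrableZ; exact: cint_integrable_normc.
exists 0%N, (2 * \int[mu]_x normc (f x)) => phi.
rewrite (le_trans (normc_cintegral_le (I phi)))// -mulrA ler_wpM2l// mulrC -RintegralZl//.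
apply: le_Rintegral => //; first exact: cint_integrable_normc.
  exact: RintegrableZ.
by move=> x _; rewrite [leRHS]mulrC; exact: H0.
Qed.

Definition wgt (s : R) xi := (1 + enorm xi ^+ 2) `^ s.

Lemma wgt_base_ge1 xi : 1 <= 1 + enorm xi ^+ 2.
Proof. by rewrite lerDl sqr_ge0. Qed.

Lemma wgt_gt0 s xi : 0 < wgt s xi.
Proof. by rewrite powR_gt0// (lt_le_trans ltr01)// wgt_base_ge1. Qed.

Lemma wgt_le s1 s2 xi : s1 <= s2 -> wgt s1 xi <= wgt s2 xi.
Proof. by move=> s12; rewrite ler_powR// wgt_base_ge1. Qed.

Lemma wgt_le1 s xi : s <= 0 -> wgt s xi <= 1.
Proof. by move=> s0; rewrite -(powRr0 (1 + enorm xi ^+ 2)); apply: ler_powR => //; exact: wgt_base_ge1. Qed.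

Lemma measurable_wgt s : measurable_fun setT (wgt s).
Proof.
apply: (measurableT_comp (measurable_powR s)).
by apply: measurable_funD => //; apply: measurable_funX; exact: measurable_enorm.
Qed.

Definition hweight : X -> R := wgt (- (1 / 2)).

(** So the reciprocal weight costs a Schwartz function one power of [1 + enorm xi], as used in
    [schwartz_pairing]. *)
Lemma hweight_mul xi : hweight xi * (1 + enorm xi) >= 1.
Proof.
have b1 := wgt_base_ge1 xi; have e0 := enorm_ge0 xi.
have b0 : 0 < 1 + enorm xi ^+ 2 by exact: lt_le_trans b1.
rewrite /hweight /wgt div1r powRN -ler_pdivrMl ?invr_gt0 ?powR_gt0// invrK mulr1.
rewrite powR12_sqrt ?(ltW b0)//.
rewrite -[leRHS]ger0_norm ?addr_ge0// -sqrtr_sqr ler_sqrt ?sqr_ge0// sqrrD; lra.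
Qed.

(** The Fourier side of the Sobolev space of order -1/2. Norms are estimated here, where functions
    may be altered on null sets. *)
Definition wL2 f := cmeasurable f /\ L1 (fun xi => hweight xi * normc (f xi) ^+ 2).

Definition wnorm2 f := \int[mu]_xi (hweight xi * normc (f xi) ^+ 2).

Lemma wnorm2_ge0 f : 0 <= wnorm2 f.
Proof.
apply: Rintegral_ge0 => x _; rewrite mulr_ge0 ?sqr_ge0//; exact/ltW/wgt_gt0.
Qed.

(* AM-GM splits [f phi] into the weighted square of [f] and the decay of [phi]. *)
Lemma schwartz_pairing phi : is_schwartz phi -> exists P : R, forall f, wL2 f ->
  cint (fun x => f x * phi x) /\ forall la, 0 < la ->
    \int[mu]_x normc (f x * phi x) <= la * wnorm2 f + P / la.
Proof.
move=> sp.
have [B1 B10 H1] := schwartz_decay 0 sp; have [B2 B20 H2] := schwartz_decay 1 sp.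
have ipk := @integrable_poisson_kernel R m.
exists (B1 * B2 * 2 ^+ m * (2 * pi) ^+ m) => f [mf fi].
have K la x : 0 < la -> normc (f x * phi x) <= la * (hweight x * normc (f x) ^+ 2) +
    B1 * B2 * 2 ^+ m / la * poisson_kernel x.
  move=> la0.
  have p1 := H1 x; have p2 := H2 x; rewrite expr0 mul1r in p1; rewrite expr1 in p2.
  have n0 := normc_ge0 (f x); have n1 := normc_ge0 (phi x); rewrite normcM.
  have w0 : 0 < hweight x by exact: wgt_gt0.
  have pk0 := poisson_kernel_gt0 x; have e0 := enorm_ge0 x.
  have pk1 : poisson_kernel x <= 2 ^+ m.
    have pc (z : R) : z ^+ m = \prod_(i < m) z by rewrite prodr_const card_ord.
    rewrite pc; apply: ler_prod => i _.
    have h : 1 <= 1 + x ord0 i ^+ 2 by rewrite lerDl sqr_ge0.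
    have h0 : 0 < 1 + x ord0 i ^+ 2 by exact: lt_le_trans h.
    by rewrite divr_ge0 ?(ltW h0)//= ler_pdivrMr//; lra.
  apply: (@le_trans _ _ (la * (hweight x * normc (f x) ^+ 2) + (hweight x)^-1 * normc (phi x) ^+ 2 / la)).
    rewrite -subr_ge0.
    have -> : la * (hweight x * normc (f x) ^+ 2) + (hweight x)^-1 * normc (phi x) ^+ 2 / la
      - normc (f x) * normc (phi x) = ((la * hweight x * normc (f x) - normc (phi x)) ^+ 2 +
        la * hweight x * normc (f x) * normc (phi x)) / (la * hweight x).
      by field; rewrite !gt_eqF.
    rewrite divr_ge0 ?addr_ge0 ?sqr_ge0 ?mulr_ge0 ?(ltW la0) ?(ltW w0)//.
  rewrite lerD2l [leRHS]mulrAC ler_pM2r ?invr_gt0//.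
  have hw : (hweight x)^-1 <= 1 + enorm x.
    by rewrite -[leLHS]mulr1 -[leLHS]mulrC mulrC ler_pdivrMl// hweight_mul.
  apply: (@le_trans _ _ ((1 + enorm x) * normc (phi x) * normc (phi x))).
    by rewrite -mulrA -expr2 ler_wpM2r// sqr_ge0.
  apply: (@le_trans _ _ (B2 * poisson_kernel x * (B1 * poisson_kernel x))).
    by rewrite ler_pM// mulr_ge0// addr_ge0.
  rewrite (_ : B2 * _ * _ = B1 * B2 * poisson_kernel x * poisson_kernel x); last ring.
  by rewrite ler_pM2r// ler_pM2l// mulr_gt0.
have mfp : cmeasurable (fun x => f x * phi x).
  by apply: cmeasurableM => //; exact: schwartz_cmeasurable.
have iK la : L1 (fun x => la * (hweight x * normc (f x) ^+ 2) + B1 * B2 * 2 ^+ m / la * poisson_kernel x).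
  by apply: RintegrableD; exact: RintegrableZ.
have ci : cint (fun x => f x * phi x).
  by apply: cint_le mfp (fun x => K 1 x ltr01) (iK 1).
split => // la la0.
apply: (@le_trans _ _ (\int[mu]_x (la * (hweight x * normc (f x) ^+ 2) + B1 * B2 * 2 ^+ m / la * poisson_kernel x))).
  apply: le_Rintegral => //; first exact: cint_integrable_normc.
  by move=> x _; exact: K.
rewrite RintegralD//; [|exact: RintegrableZ|exact: RintegrableZ].
rewrite !RintegralZl// integral_poisson_kernel.
by rewrite lerD2l mulrAC.
Qed.

Lemma wL2_schwartz f phi : wL2 f -> is_schwartz phi -> cint (fun x => f x * phi x).
Proof. by move=> wf /schwartz_pairing[P /(_ f wf)[]]. Qed.

Lemma testf_locally_integrable f g (p : X -> R) : clocally_integrable f -> testf p ->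
  cint (fun x => f x * Complex (p x) 0).
Proof.
move=> lf tp; have [B HB] := testf_bounded tp; have [sp [r r0 h]] := tp.
have mp : measurable_fun setT p by apply: continuous_rV_measurable; exact: smooth_continuous.
apply: (@cint_le _ _ _ (fun x => B * (normc (f x) * \1_(ball (0 : X) (r + 1)) x))).
- by apply: cmeasurableM; [exact: lf.1|split => //; exact: measurable_cst].
- move=> x; rewrite normcM /= expr0n addr0 sqrtr_sqr mulrCA ler_wpM2l ?normc_ge0//.
  rewrite indicE; have [xr|xr] := ltP r `|x|.
    by rewrite h// normr0 mulr_ge0// (le_trans _ (HB 0)).
  by rewrite mem_set ?mulr1// rV_ball0 (le_lt_trans xr)// ltrDl.
- exact/RintegrableZ/clocally_integrable_ball.
Qed.

Lemma clocally_integrableB f g : clocally_integrable f -> clocally_integrable g ->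
  clocally_integrable (fun x => f x - g x).
Proof.
move=> [mf lf] [mg lg]; split; first exact: cmeasurableB.
move=> K cK; have [mK _] := compact_rV_bounded cK.
have mn k : cmeasurable k -> measurable_fun K (fun x => (normc (k x))%:E).
  by move=> mk; apply/measurable_EFinP; apply: measurable_funTS; exact: measurable_normc.
apply: (@le_lt_trans _ _ (\int[mu]_(x in K) ((normc (f x))%:E + (normc (g x))%:E))%E).
  apply: ge0_le_integral => //.
  - by move=> x _; rewrite lee_fin normc_ge0.
  - by apply: mn; exact: cmeasurableB.
  - by apply: emeasurable_funD; exact: mn.
  - move=> x _; rewrite -EFinD lee_fin (le_trans (le_normcD _ _))//.
    by case: (g x) => a b /=; rewrite !sqrrN.
rewrite ge0_integralD//.
- by rewrite lte_add_pinfty// ?lf ?lg.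
- by move=> x _; rewrite lee_fin normc_ge0.
- exact: mn.
- by move=> x _; rewrite lee_fin normc_ge0.
- exact: mn.
Qed.

Lemma transformB u v f g : is_fourier_transform u f -> is_fourier_transform v g ->
  wL2 f -> wL2 g -> is_fourier_transform (u - v) (fun x => f x - g x).
Proof.
move=> [lf uf] [lg vg] wf wg; split; first exact: clocally_integrableB.
move=> phi psi e; rewrite -[LHS]/(u psi - v psi) (uf _ _ e) (vg _ _ e).
have sp : is_schwartz phi by exact/asboolP/schwartzP.
rewrite /regular_dist -cintegralB; [|exact: wL2_schwartz wf sp|exact: wL2_schwartz wg sp].
by congr cintegral; apply/funext => x; ring.
Qed.

(** The real and imaginary parts of the difference are orthogonal to all test functions, hence
    vanish a.e. on every ball. *)
Lemma ae_unique_of_testf f g : clocally_integrable f -> clocally_integrable g ->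
  (forall p : X -> R, testf p ->
    cintegral (fun x => f x * Complex (p x) 0) = cintegral (fun x => g x * Complex (p x) 0)) ->
  {ae mu, forall x, f x = g x}.
Proof.
move=> lf lg E.
(* [k] stands for the real or the imaginary part. *)
have H (k : C -> R) : (forall a b, k (a - b) = k a - k b) -> (forall a, `|k a| <= normc a) ->
    measurable_fun setT (fun x => k (f x)) -> measurable_fun setT (fun x => k (g x)) ->
    (forall p : X -> R, testf p -> \int[mu]_x (k (f x) * p x) = \int[mu]_x (k (g x) * p x)) ->
    {ae mu, forall x, k (f x) = k (g x)}.
  move=> kB kn mkf mkg kE; pose d x := k (f x) - k (g x).
  have li h (mh : measurable_fun setT (fun x => k (h x))) r : clocally_integrable h ->
      L1 (fun x => k (h x) * \1_(ball (0 : X) r) x).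
    move=> lh; apply: Rintegrable_le (clocally_integrable_ball r lh).
      have mB : measurable (ball (0 : X) r) by exact: measurable_rV_ball.
      by apply: measurable_funM.
    by move=> x; rewrite normrM [`|\1_ _ _|]ger0_norm// ler_wpM2r.
  have lp h (mh : measurable_fun setT (fun x => k (h x))) (p : X -> R) : clocally_integrable h -> testf p ->
      L1 (fun x => k (h x) * p x).
    move=> lh tp; apply: Rintegrable_le (cint_integrable_normc (testf_locally_integrable h lh tp)).
      by apply: measurable_funM => //; apply: continuous_rV_measurable; exact/smooth_continuous/tp.1.
    by move=> x; rewrite normrM normcM /= expr0n addr0 sqrtr_sqr ler_wpM2r.
  have iZ r : L1 (fun x => d x * \1_(ball (0 : X) r) x).
    rewrite /d (_ : (fun x => _) = (fun x => k (f x) * \1_(ball (0 : X) r) x - k (g x) * \1_(ball (0 : X) r) x)).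
      by apply: RintegrableB; exact: li.
    by apply/funext => x; rewrite mulrBl.
  have md : measurable_fun setT d by exact: measurable_funB.
  have orth (p : X -> R) : testf p -> \int[mu]_x (d x * p x) = 0.
    move=> tp; transitivity (\int[mu]_x (k (f x) * p x - k (g x) * p x)).
      by apply: eq_Rintegral => x _; rewrite mulrBl.
    by rewrite RintegralB ?kE ?subrr//; exact: lp.
  have Z n : \forall x \ae mu, d x * \1_(ball (0 : X) n.+1%:R) x = 0.
    by apply: filterS (ae_eq0_of_testf iZ md orth n.+1%:R) => x /(_ Logic.I)[].
  (* Countably many null sets suffice: [x] lies in the ball whose radius is the successor of the
     truncation of its norm. *)
  have := ae_foralln Z; apply: filterS => x /(_ (Num.truncn `|x|)).
  rewrite indicE mem_set ?mulr1; last by rewrite rV_ball0 truncnS_gt.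
  by move/subr0_eq.
have [mf _] := lf; have [mg _] := lg.
have Ef (p : X -> R) h : \int[mu]_x Re (h x * Complex (p x) 0) = \int[mu]_x (Re (h x) * p x).
  by apply: eq_Rintegral => x _; rewrite cReM /= mulr0 subr0.
have Eg (p : X -> R) h : \int[mu]_x Im (h x * Complex (p x) 0) = \int[mu]_x (Im (h x) * p x).
  by apply: eq_Rintegral => x _; rewrite cImM /= mulr0 add0r.
have HR : {ae mu, forall x, Re (f x) = Re (g x)}.
  apply: H; [by move=> a b; rewrite cReD cReN|exact: Re_le_normc|exact: mf.1|exact: mg.1|].
  by move=> p /E[]; rewrite !Ef.
have HI : {ae mu, forall x, Im (f x) = Im (g x)}.
  apply: H; [by move=> a b; rewrite cImD cImN|exact: Im_le_normc|exact: mf.2|exact: mg.2|].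
  by move=> p /E[_]; rewrite !Eg.
by apply: filterS2 HR HI => x; exact: complex_ext.
Qed.

(** The transform of a test function is again a Schwartz function, so [u] can be evaluated on it
    through either transform. *)
Lemma transform_ae_unique u f g : is_fourier_transform u f -> is_fourier_transform u g ->
  {ae mu, forall x, f x = g x}.
Proof.
move=> [lf uf] [lg ug]; apply: ae_unique_of_testf => // p tp.
have tp0 : ctestf (fun x => Complex (p x) 0) by split => //; exact: testf0.
have s1 : (fun x => Complex (p x) 0) \in @schwartz_pred R m.
  by apply/asboolP; exact: ctestf_schwartz.
have s2 : fourier (fun x => Complex (p x) 0) \in @schwartz_pred R m.
  by apply/asboolP; exact: fourier_schwartz.
have := uf (Schwartz s1) (Schwartz s2) (frefl _).
by rewrite (ug (Schwartz s1) (Schwartz s2) (frefl _)) => /esym.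
Qed.

(** The norm is defined with a chosen transform; by a.e. uniqueness every transform computes it. *)
Lemma sobolev_sqnormE s u f : is_fourier_transform u f ->
  sobolev_sqnorm s u = (\int[mu]_xi (wgt s xi * normc (f xi) ^+ 2)%:E)%E.
Proof.
move=> uf.
have ug : is_fourier_transform u (fourier_transform u).
  by rewrite /fourier_transform; case: xgetP => [g _ //|/(_ f)].
rewrite /sobolev_sqnorm; apply: ae_eq_integral => //.
- apply/measurable_EFinP; apply: measurable_funM; first exact: measurable_wgt.
  by apply: measurable_funX; apply: measurable_normc; exact: ug.1.1.
- apply/measurable_EFinP; apply: measurable_funM; first exact: measurable_wgt.
  by apply: measurable_funX; apply: measurable_normc; exact: uf.1.1.
- by apply: filterS (transform_ae_unique ug uf) => x -> _.
Qed.

Lemma sobolev_transform s u : sobolev s u -> exists f,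
  [/\ is_fourier_transform u f, cmeasurable f & L1 (fun xi => wgt s xi * normc (f xi) ^+ 2)].
Proof.
move=> [_ [f uf] uoo]; exists f; have mf := uf.1.1; split => //.
rewrite (sobolev_sqnormE s uf) in uoo; apply: ge0_Rintegrable uoo.
- apply: measurable_funM; first exact: measurable_wgt.
  by apply: measurable_funX; exact: measurable_normc.
- by move=> xi; rewrite mulr_ge0 ?sqr_ge0 ?ltW ?wgt_gt0.
Qed.

Lemma sobolev_normE u f : is_fourier_transform u f -> wL2 f ->
  sobolev_norm (- (1 / 2)) u = Num.sqrt (wnorm2 f).
Proof.
move=> uf [_ wf]; rewrite /sobolev_norm (sobolev_sqnormE _ uf).
by rewrite -EFin_Rintegral.
Qed.

Lemma wL2_of_wgt s f : - (1 / 2) <= s -> cmeasurable f ->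
  L1 (fun xi => wgt s xi * normc (f xi) ^+ 2) -> wL2 f.
Proof.
move=> s2 mf fi; split => //; apply: Rintegrable_le fi.
  apply: measurable_funM; first exact: measurable_wgt.
  by apply: measurable_funX; exact: measurable_normc.
move=> xi; rewrite ger0_norm ?mulr_ge0 ?sqr_ge0 ?normc_ge0 ?(ltW (wgt_gt0 _ _))//.
by rewrite ler_wpM2r ?sqr_ge0// wgt_le.
Qed.

(** The pointwise inequality [(a + b)^2 <= 2 (a^2 + b^2)] takes the place of the triangle
    inequality, so that square roots appear only at the very end. *)
Lemma wnorm2D_le f g h : wL2 f -> wL2 g -> cmeasurable h -> (forall x, normc (h x) <= normc (f x) + normc (g x)) ->
  wL2 h /\ wnorm2 h <= 2 * (wnorm2 f + wnorm2 g).
Proof.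
move=> [mf fi] [mg gi] mh hfg.
have K x : hweight x * normc (h x) ^+ 2 <= 2 * (hweight x * normc (f x) ^+ 2 + hweight x * normc (g x) ^+ 2).
  rewrite -mulrDr [leRHS]mulrCA ler_wpM2l ?(ltW (wgt_gt0 _ _))//.
  apply: (@le_trans _ _ ((normc (f x) + normc (g x)) ^+ 2)).
    by rewrite lerXn2r ?nnegrE ?addr_ge0 ?normc_ge0.
  by have := sqr_ge0 (normc (f x) - normc (g x)); rewrite sqrrB sqrrD; lra.
have ih : L1 (fun xi => hweight xi * normc (h xi) ^+ 2).
  apply: (@Rintegrable_le _ _ _ _ _ (fun x => 2 * (hweight x * normc (f x) ^+ 2 + hweight x * normc (g x) ^+ 2))).
  - apply: measurable_funM; first exact: measurable_wgt.
    by apply: measurable_funX; exact: measurable_normc.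
  - by move=> x; rewrite ger0_norm ?K// mulr_ge0 ?sqr_ge0 ?(ltW (wgt_gt0 _ _)).
  - by apply: RintegrableZ; exact: RintegrableD.
split => //; rewrite /wnorm2 -RintegralD// -RintegralZl//; last exact: RintegrableD.
by apply: le_Rintegral => //; apply: RintegrableZ; exact: RintegrableD.
Qed.

End transforms.

(** * Poincare inequality and negative norms of functions with zero cell means *)

Section poincare.
Context (R : realType) (m : nat).
Local Notation X := 'rV[R]_m.
Local Notation mu := (lebesgue_rV R m).
Local Notation leb := (@lebesgue_measure R).
Local Notation L1 f := (mu.-integrable setT (EFin \o f)).

Definition half_itv : set R := `[2^-1, 1]%classic.

(** With [c] the increment, [2 c] is the mean of [dphi] on an interval of length 1/2; integrating
    the square of [dphi - 2 c] gives the bound. *)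
Lemma ftc_jensen (phi dphi : R -> R) :
  (forall s, derivable phi s 1 /\ 'D_1 phi s = dphi s) -> continuous dphi ->
  (((phi 1 - phi 2^-1) ^+ 2)%:E <= (2^-1)%:E * \int[leb]_(s in half_itv) (dphi s ^+ 2)%:E)%E.
Proof.
move=> dp cd; pose I := half_itv.
have lt1 : 2^-1 < 1 :> R by rewrite invf_lt1// ltr1n.
have cI : compact I by exact: segment_compact.
have mI : measurable I by exact: measurable_itv.
have lI : leb I = (2^-1)%:E.
  by rewrite lebesgue_measure_itv/= lte_fin lt1 -EFinD; congr (_%:E); field.
have int (f : R -> R) : continuous f -> leb.-integrable I (EFin \o f).
  by move=> cf; apply: continuous_compact_integrable => //; exact: continuous_subspaceT.
have cphi : continuous phi.
  by move=> s; apply: differentiable_continuous; apply/derivable1_diffP; exact: (dp s).1.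
pose c := phi 1 - phi 2^-1.
have E1 : \int[leb]_(s in I) dphi s = c.
  rewrite /Rintegral (@continuous_FTC2 R dphi phi)//.
  - exact: continuous_subspaceT.
  - split; first by move=> s _; exact: (dp s).1.
      exact/cvg_at_right_filter/cphi.
    exact/cvg_at_left_filter/cphi.
  - by move=> s _; rewrite derive1E (dp s).2.
have cd2 : continuous (fun s => dphi s ^+ 2).
  by move=> s; apply: (@continuous_comp _ _ _ dphi (fun x => x ^+ 2)); [exact: cd|exact: exprn_continuous].
have i1 := int _ cd; have i2 := int _ cd2.
have ic : leb.-integrable I (EFin \o (fun=> (2 * c) ^+ 2)) by exact/int/cst_continuous.
have i3 : leb.-integrable I (EFin \o (fun s => - (4 * c) * dphi s)).
  by apply: int => s; apply: cvgM; [exact: cvg_cst|exact: cd].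
have i4 : leb.-integrable I (EFin \o (fun s => dphi s ^+ 2 + - (4 * c) * dphi s)).
  by apply: int => s; apply: cvgD; [exact: cd2|apply: cvgM; [exact: cvg_cst|exact: cd]].
have E2 : \int[leb]_(s in I) (dphi s ^+ 2 + - (4 * c) * dphi s + (2 * c) ^+ 2) =
    \int[leb]_(s in I) (dphi s ^+ 2) - 2 * c ^+ 2.
  transitivity (\int[leb]_(s in I) (dphi s ^+ 2) + - (4 * c) * c + (2 * c) ^+ 2 * 2^-1); last by field.
  rewrite RintegralD// RintegralD// RintegralZl// E1 Rintegral_cst//.
  by congr (_ + _ * _); rewrite [X in fine X]lI.
have : 0 <= \int[leb]_(s in I) (dphi s ^+ 2 + - (4 * c) * dphi s + (2 * c) ^+ 2).
  apply: Rintegral_ge0 => s _.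
  rewrite (_ : _ + _ = (dphi s - 2 * c) ^+ 2) ?sqr_ge0//; ring.
rewrite E2 subr_ge0 => H.
have -> : (\int[leb]_(s in half_itv) (dphi s ^+ 2)%:E)%E = (\int[leb]_(s in I) (dphi s ^+ 2))%:E.
  by rewrite /Rintegral fineK//; exact: integrable_fin_num.
by rewrite -EFinM lee_fin ler_pdivlMl.
Qed.

Definition gradsq (G : X -> R) (z : X) : R := \sum_i pd i G z ^+ 2.

Lemma gradsq_ge0 G z : 0 <= gradsq G z.
Proof. by apply: sumr_ge0 => i _; exact: sqr_ge0. Qed.

Lemma smooth_sum (I : Type) (r : seq I) (F : I -> X -> R) :
  (forall k, smooth (F k)) -> smooth (fun x => \sum_(k <- r) F k x).
Proof.
move=> sF; elim: r => [|k r IH].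
  by under eq_fun do rewrite big_nil; exact: smooth_cst.
by under eq_fun do rewrite big_cons; exact: smoothD.
Qed.

Lemma smooth_gradsq G : smooth G -> smooth (gradsq G).
Proof.
move=> sG; apply: smooth_sum => i.
by under eq_fun do rewrite expr2; apply: smoothM; exact: smooth_pd.
Qed.

Lemma derive_dirE (G : X -> R) (z v : X) : differentiable G z -> 'D_v G z = \sum_i v ord0 i * pd i G z.
Proof.
move=> dG; rewrite deriveE// {1}[v]row_sum_delta linear_sum.
by apply: eq_bigr => i _; rewrite linearZ /pd deriveE.
Qed.

(** By Lagrange's identity the defect is half a double sum of squares. *)
Lemma cauchy_schwarz_sum n (a b : 'I_n -> R) :
  (\sum_i a i * b i) ^+ 2 <= (\sum_i a i * a i) * (\sum_i b i ^+ 2).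
Proof.
rewrite -subr_ge0.
have -> : (\sum_i a i * a i) * (\sum_i b i ^+ 2) - (\sum_i a i * b i) ^+ 2 =
    2^-1 * \sum_i \sum_j (a i * b j - a j * b i) ^+ 2.
  have E : \sum_i \sum_j (a i * b j - a j * b i) ^+ 2 =
      2 * ((\sum_i a i * a i) * (\sum_i b i ^+ 2) - (\sum_i a i * b i) ^+ 2).
    transitivity (\sum_i \sum_j ((a i * a i) * (b j ^+ 2) + (b i ^+ 2) * (a j * a j)
        - 2 * ((a i * b i) * (a j * b j)))).
      by apply: eq_bigr => i _; apply: eq_bigr => j _; ring.
    under eq_bigr do rewrite sumrB big_split/= -!mulr_sumr.
    by rewrite sumrB big_split/= -mulr_sumr -!mulr_suml; ring.
  by rewrite E mulKf.
by rewrite mulr_ge0// sumr_ge0// => i _; rewrite sumr_ge0// => j _; exact: sqr_ge0.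
Qed.

Lemma derive_dir_le (G : X -> R) (z v : X) : differentiable G z ->
  ('D_v G z) ^+ 2 <= enorm v ^+ 2 * gradsq G z.
Proof. by move=> dG; rewrite derive_dirE// enorm_sqr; exact: cauchy_schwarz_sum. Qed.

(* Only the half of the segment that stays away from [x] is used: for fixed [x] and
   [s >= 1/2] the change of variables [y |-> x + s (y - x)] costs a factor [2 ^ m]. *)
Lemma segment_gradsq (G : X -> R) (x v : X) : smooth G ->
  (((G (x + v) - G (x + 2^-1 *: v)) ^+ 2)%:E <=
   (2^-1 * enorm v ^+ 2)%:E * \int[leb]_(s in half_itv) (gradsq G (x + s *: v))%:E)%E.
Proof.
move=> sG; have dG := smooth_differentiable sG.
have cl : continuous (fun s : R => x + s *: v).
  by move=> s; apply: cvgD; [exact: cvg_cst|exact: scalel_continuous].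
pose dphi s := 'D_v G (x + s *: v).
have cdv : continuous (fun z => 'D_v G z).
  rewrite (_ : (fun z => _) = fun z => \sum_i v ord0 i * pd i G z).
    by apply: smooth_continuous; apply: smooth_sum => i; apply: smoothM; [exact: smooth_cst|exact: smooth_pd].
  by apply/funext => z; rewrite derive_dirE.
have := @ftc_jensen (fun s => G (x + s *: v)) dphi.
have d (s : R) : derivable (fun s : R => G (x + s *: v)) s 1 /\ 'D_1 (fun s : R => G (x + s *: v)) s = dphi s.
  by have [] := is_derive_line (dG (x + s *: v)).
have cd : continuous dphi.
  by move=> s; exact: (@continuous_comp _ _ _ (fun s : R => x + s *: v) _ s (cl s) (cdv _)).
move=> /(_ d cd); rewrite scale1r => /le_trans; apply.
rewrite EFinM -muleA; apply: lee_wpmul2l; first by rewrite lee_fin.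
have ms : measurable_fun half_itv (fun s => gradsq G (x + s *: v)).
  apply: measurable_funTS; apply: continuous_measurable_fun => s.
  apply: (@continuous_comp _ _ _ (fun s : R => x + s *: v) (gradsq G)); first exact: cl.
  exact/smooth_continuous/smooth_gradsq.
rewrite -ge0_integralZl//; last 3 first.
- exact/measurable_EFinP.
- by move=> s _; rewrite lee_fin gradsq_ge0.
- by rewrite lee_fin sqr_ge0.
apply: ge0_le_integral => //.
- exact: measurable_itv.
- by move=> s _; rewrite lee_fin sqr_ge0.
- apply/measurable_EFinP; apply: measurable_funTS; apply: continuous_measurable_fun => s.
  by apply: (@continuous_comp _ _ _ dphi (fun x => x ^+ 2)); [exact: cd|exact: exprn_continuous].
- by apply/measurable_EFinP; apply: measurable_funM.
- by move=> s _; rewrite -EFinM lee_fin derive_dir_le.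
exact: measurable_itv.
Qed.

Section cell.
Variables (T U : set X) (d : R) (G : X -> R).
Hypothesis mT : measurable T.
Hypothesis mU : measurable U.
Hypothesis Td : forall x y, T x -> T y -> enorm (x - y) <= d.
Hypothesis TU : forall x y s, T x -> T y -> 0 <= s <= 1 -> U (x + s *: (y - x)).
Hypothesis sG : smooth G.

Let F z : R := gradsq G z * \1_U z.
(** The increment from the midpoint to [y]. Passing through the midpoint, [G x - G y] is a
    difference of two such increments, each on the half-segment away from its own base point. *)
Let D (x y : X) : R := \1_T x * \1_T y * (G y - G (x + 2^-1 *: (y - x))) ^+ 2.

Let mF : measurable_fun setT F.
Proof.
apply: measurable_funM => //.
by apply: continuous_rV_measurable; exact/smooth_continuous/smooth_gradsq.
Qed.

Let F0 z : 0 <= F z. Proof. by rewrite mulr_ge0 ?gradsq_ge0. Qed.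

Let D_le x y : ((D x y)%:E <= (2^-1 * d ^+ 2 * \1_T x)%:E *
  \int[leb]_(s in half_itv) (F (x + s *: (y - x)))%:E)%E.
Proof.
have I0 : (0 <= \int[leb]_(s in half_itv) (F (x + s *: (y - x)))%:E)%E.
  by apply: integral_ge0 => s _; rewrite lee_fin F0.
have [xT|xT] := pselect (T x); last first.
  by rewrite /D indicE memNset// !mul0r mule_ge0// lee_fin mulr0.
have [yT|yT] := pselect (T y); last first.
  rewrite /D (_ : \1_T y = 0) ?mulr0 ?mul0r; last by rewrite indicE memNset.
  by rewrite mule_ge0// lee_fin mulr_ge0// mulr_ge0// sqr_ge0.
rewrite /D !indicE !mem_set// mulr1 !mul1r mulr1.
have := segment_gradsq x (y - x) sG; rewrite [x + (y - x)]addrC subrK => /le_trans; apply.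
apply: lee_pmul.
- by rewrite lee_fin mulr_ge0// sqr_ge0.
- by apply: integral_ge0 => s _; rewrite lee_fin gradsq_ge0.
- rewrite lee_fin ler_wpM2l// lerXn2r ?nnegrE ?enorm_ge0//.
    exact: le_trans (enorm_ge0 _) (Td yT xT).
  exact: Td.
- rewrite le_eqVlt; apply/orP; left; apply/eqP; apply: eq_integral => s.
  rewrite inE /half_itv/= in_itv/= => /andP[s0 s1].
  rewrite /F indicE mem_set ?mulr1//; apply: TU => //.
  by rewrite s1 (le_trans _ s0).
Qed.

Let mFseg x : measurable_fun setT (fun p : X * measurableTypeR R => F (x + p.2 *: (p.1 - x))).
Proof.
apply: (measurableT_comp mF); apply: measurable_fun_rVP => i.
under eq_fun do rewrite !mxE.
apply: measurable_funD => //; apply: measurable_funM => //.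
apply: measurable_funB => //.
exact: (measurable_coor_fun i measurable_fst).
Qed.

Let H x (p : X * measurableTypeR R) : R := F (x + p.2 *: (p.1 - x)) * \1_half_itv p.2.

Let mh : measurable (half_itv : set (measurableTypeR R)). Proof. exact: measurable_itv. Qed.

Let mH x : measurable_fun setT (H x).
Proof.
apply: measurable_funM; first exact: mFseg.
have mi : measurable_fun setT (\1_half_itv : measurableTypeR R -> R) by exact: measurable_indic.
exact: (measurableT_comp mi measurable_snd).
Qed.

Let H0 x p : 0 <= H x p. Proof. by rewrite mulr_ge0. Qed.

Let HE x y : (\int[leb]_(s in half_itv) (F (x + s *: (y - x)))%:E = \int[leb]_s (H x (y, s))%:E)%E.
Proof.
rewrite integral_mkcond; apply: eq_integral => s _.
by rewrite patchE /H indicE; case: ifP => _; rewrite ?mulr1 ?mulr0.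
Qed.

Let mline (x : X) : measurable_fun setT (fun y : X => \int[leb]_(s in half_itv) (F (x + s *: (y - x)))%:E)%E.
Proof.
rewrite (_ : (fun y => _) = (fun y => \int[leb]_s (H x (y, s))%:E)%E); last exact/funext/HE.
have := @measurable_fun_fubini_tonelli_F _ _ _ _ _ leb (fun p => (H x p)%:E).
apply; last by move=> p; rewrite lee_fin.
by apply/measurable_EFinP; exact: (mH x).
Qed.

Let line_int x : (\int[mu]_y \int[leb]_(s in half_itv) (F (x + s *: (y - x)))%:E <=
  (2^-1 * 2 ^+ m)%:E * \int[mu]_z (F z)%:E)%E.
Proof.
have lt1 : 2^-1 < 1 :> R by rewrite invf_lt1// ltr1n.
have lh : leb half_itv = (2^-1)%:E.
  by rewrite lebesgue_measure_itv/= lte_fin lt1 -EFinD; congr (_%:E); field.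
have IF0 : (0 <= \int[mu]_z (F z)%:E)%E by apply: integral_ge0 => z _; rewrite lee_fin.
apply: (@le_trans _ _ (\int[mu]_y \int[leb]_s (H x (y, s))%:E)%E).
  by rewrite le_eqVlt; apply/orP; left; apply/eqP; apply: eq_integral => y _; exact: HE.
rewrite (@fubini_tonelli _ _ _ _ _ mu leb (fun p => (H x p)%:E)); last 2 first.
- by apply/measurable_EFinP; exact: (mH x).
- by move=> p; rewrite lee_fin.
apply: (@le_trans _ _ (\int[leb]_s ((2 ^+ m)%:E * (\int[mu]_z (F z)%:E) * (\1_half_itv s)%:E))%E).
  apply: ge0_le_integral => //.
  - by move=> s _; apply: integral_ge0 => y _; rewrite lee_fin.
  - have := @measurable_fun_fubini_tonelli_G _ _ _ _ _ mu (fun p => (H x p)%:E).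
    apply; last by move=> p; rewrite lee_fin.
by apply/measurable_EFinP; exact: (mH x).
  - apply: emeasurable_funM => //; apply/measurable_EFinP; exact: measurable_indic.
  move=> s _; have [hs|hs] := pselect (half_itv s); last first.
    rewrite integral0_eq//; first by rewrite mule_ge0// mule_ge0// lee_fin.
    by move=> y _; rewrite /H /= indicE memNset// mulr0.
  have /andP[s0 s1] : 2^-1 <= s <= 1 by move: hs; rewrite /half_itv/= in_itv.
  have sp : 0 < s by apply: lt_le_trans s0; rewrite invr_gt0.
  rewrite indicE mem_set// mule1.
  have -> : (\int[mu]_y (H x (y, s))%:E = \int[mu]_y (EFin \o F) (s *: y + (1 - s) *: x)%R)%E.
    apply: eq_integral => y _; rewrite /H /= indicE mem_set// mulr1; congr ((F _)%:E).
    by rewrite scalerBr scalerBl scale1r addrCA.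
  rewrite integral_rV_affine ?gt_eqF//; last exact/measurable_EFinP.
  rewrite lee_wpmul2r// lee_fin gtr0_norm//.
  by rewrite -exprVn lerXn2r ?nnegrE ?invr_ge0 ?(ltW sp)// invf_ple ?posrE.
rewrite ge0_integralZl//; last 2 first.
- by apply/measurable_EFinP; exact: measurable_indic.
- by rewrite mule_ge0// lee_fin.
have -> : (\int[leb]_s (\1_half_itv s)%:E = (2^-1)%:E)%E.
  by rewrite integral_indic// setIT; exact: lh.
by rewrite muleC muleA -EFinM le_eqVlt eqxx.
Qed.

Let mD : measurable_fun setT (fun p : X * X => D p.1 p.2).
Proof.
have mG : measurable_fun setT G by apply: continuous_rV_measurable; exact: smooth_continuous.
have mi : measurable_fun setT (\1_T : X -> R) by exact: measurable_indic.
apply: measurable_funM; first apply: measurable_funM.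
- exact: (measurableT_comp mi measurable_fst).
- exact: (measurableT_comp mi measurable_snd).
apply: measurable_funX; apply: measurable_funB.
  exact: (measurableT_comp mG measurable_snd).
apply: (measurableT_comp mG); apply: measurable_fun_rVP => i.
under eq_fun do rewrite !mxE.
apply: measurable_funD; first exact: (measurable_coor_fun i measurable_fst).
apply: measurable_funM => //; apply: measurable_funB.
  exact: (measurable_coor_fun i measurable_snd).
exact: (measurable_coor_fun i measurable_fst).
Qed.

Let D0 x y : 0 <= D x y. Proof. by rewrite mulr_ge0 ?sqr_ge0// mulr_ge0. Qed.

(** The constant collects 1/2 from [ftc_jensen], and from [line_int] the length 1/2 of the parameter
    interval and the Jacobian bound [2 ^+ m]. Integrating over the base point gives [mu T]. *)
Let int_D : (\int[mu]_x \int[mu]_y (D x y)%:E <=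
  (4^-1 * 2 ^+ m * d ^+ 2)%:E * (mu T * \int[mu]_z (F z)%:E))%E.
Proof.
have IF0 : (0 <= \int[mu]_z (F z)%:E)%E by apply: integral_ge0 => z _; rewrite lee_fin.
apply: (@le_trans _ _ (\int[mu]_x ((4^-1 * 2 ^+ m * d ^+ 2)%:E * (\int[mu]_z (F z)%:E) * (\1_T x)%:E))%E).
  apply: ge0_le_integral => //.
  - by move=> x _; apply: integral_ge0 => y _; rewrite lee_fin D0.
  - have := @measurable_fun_fubini_tonelli_F _ _ _ _ _ mu (fun p : X * X => (D p.1 p.2)%:E).
    by apply; [exact/measurable_EFinP|move=> p; rewrite lee_fin D0].
  - by apply: emeasurable_funM => //; apply/measurable_EFinP; exact: measurable_indic.
  move=> x _.
  apply: (@le_trans _ _ (\int[mu]_y ((2^-1 * d ^+ 2 * \1_T x)%:E *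
    \int[leb]_(s in half_itv) (F (x + s *: (y - x)))%:E))%E).
    apply: ge0_le_integral => //.
    + by move=> y _; rewrite lee_fin D0.
    + by apply/measurable_EFinP; exact: (measurable_slice1 mD).
    + by apply: emeasurable_funM => //; exact: mline.
  have c0 : (0 <= (2^-1 * d ^+ 2 * \1_T x)%:E)%E by rewrite lee_fin mulr_ge0// mulr_ge0// sqr_ge0.
  rewrite ge0_integralZl//; last first.
    by move=> y _; apply: integral_ge0 => s _; rewrite lee_fin.
  apply: (le_trans (lee_wpmul2l c0 (line_int x))).
  rewrite muleA [leRHS]muleAC -!EFinM le_eqVlt; apply/orP; left; apply/eqP.
  by congr (_%:E * _)%E; field.
rewrite ge0_integralZl//; last 2 first.
- by apply/measurable_EFinP; exact: measurable_indic.
- by rewrite mule_ge0// lee_fin; apply: mulr_ge0; [exact: mulr_ge0|exact: sqr_ge0].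
by rewrite integral_indic// setIT -muleA [(_ * mu T)%E]muleC.
Qed.

(** Splitting at the midpoint costs a factor 2, and the two halves have equal integrals by symmetry;
    [2 (1/4 + 1/4)] leaves the constant [2 ^+ m * d ^+ 2]. Since [U] only has to contain the
    segments, [T] may be nonconvex. *)
Lemma poincare : (\int[mu]_x \int[mu]_y (\1_T x * \1_T y * (G x - G y) ^+ 2)%:E <=
  (2 ^+ m * d ^+ 2)%:E * (mu T * \int[mu]_z (gradsq G z * \1_U z)%:E))%E.
Proof.
have mG : measurable_fun setT G by apply: continuous_rV_measurable; exact: smooth_continuous.
have mi : measurable_fun setT (\1_T : X -> R) by exact: measurable_indic.
have mD2 : measurable_fun setT (fun p : X * X => D p.2 p.1).
  by apply: (measurableT_comp mD (measurable_fun_pair measurable_snd measurable_fst)).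
have mid (x y : X) : y + 2^-1 *: (x - y) = x + 2^-1 *: (y - x).
  by apply/rowP => i; rewrite !mxE; field.
have K x y : \1_T x * \1_T y * (G x - G y) ^+ 2 <= 2 * (D x y + D y x) :> R.
  rewrite /D mid [\1_T y * \1_T x]mulrC -mulrDr [leRHS]mulrCA ler_wpM2l ?mulr_ge0//.
  set c := G (y + _); have := sqr_ge0 (G x + G y - 2 * c); rewrite !expr2; nra.
apply: (@le_trans _ _ (\int[mu]_x (\int[mu]_y (2 * (D x y + D y x))%:E))%E).
  apply: ge0_le_integral => //.
  - by move=> x _; apply: integral_ge0 => y _; rewrite lee_fin mulr_ge0 ?sqr_ge0// mulr_ge0.
  - have := @measurable_fun_fubini_tonelli_F _ _ _ _ _ mu (fun p : X * X => (\1_T p.1 * \1_T p.2 * (G p.1 - G p.2) ^+ 2)%:E).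
    apply => //; last by move=> p; rewrite lee_fin mulr_ge0 ?sqr_ge0// mulr_ge0.
    apply/measurable_EFinP; apply: measurable_funM; first apply: measurable_funM.
    + exact: (measurableT_comp mi measurable_fst).
    + exact: (measurableT_comp mi measurable_snd).
    apply: measurable_funX; apply: measurable_funB.
      exact: (measurableT_comp mG measurable_fst).
    exact: (measurableT_comp mG measurable_snd).
  - have := @measurable_fun_fubini_tonelli_F _ _ _ _ _ mu (fun p : X * X => (2 * (D p.1 p.2 + D p.2 p.1))%:E).
    apply => //; last by move=> p; rewrite lee_fin mulr_ge0// addr_ge0.
    by apply/measurable_EFinP; apply: measurable_funM => //; exact: measurable_funD.
  move=> x _; apply: ge0_le_integral => //.
  - by move=> y _; rewrite lee_fin mulr_ge0 ?sqr_ge0// mulr_ge0.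
  - apply/measurable_EFinP; apply: measurable_funM; first exact: measurable_funM.
    by apply: measurable_funX; exact: measurable_funB.
  - apply/measurable_EFinP; apply: measurable_funM => //; apply: measurable_funD.
      exact: (measurable_slice1 mD).
    exact: (measurable_slice2 mD).
  - by move=> y _; rewrite lee_fin.
have sl1 x : measurable_fun setT (fun y => (D x y)%:E) by apply/measurable_EFinP; exact: (measurable_slice1 mD).
have sl2 x : measurable_fun setT (fun y => (D y x)%:E) by apply/measurable_EFinP; exact: (measurable_slice2 mD).
have E1 x : (\int[mu]_y (2 * (D x y + D y x))%:E = 2%:E * (\int[mu]_y (D x y)%:E + \int[mu]_y (D y x)%:E))%E.
  rewrite -ge0_integralD//; last 2 first.
  - by move=> y _; rewrite lee_fin D0.
  - by move=> y _; rewrite lee_fin D0.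
  rewrite -ge0_integralZl//.
  - by apply: emeasurable_funD.
  - by move=> y _; rewrite -EFinD lee_fin addr_ge0.
under eq_integral do rewrite E1.
have mI1 : measurable_fun setT (fun x => \int[mu]_y (D x y)%:E)%E.
  have := @measurable_fun_fubini_tonelli_F _ _ _ _ _ mu (fun p : X * X => (D p.1 p.2)%:E).
  by apply; [exact/measurable_EFinP|move=> p; rewrite lee_fin D0].
have mI2 : measurable_fun setT (fun x => \int[mu]_y (D y x)%:E)%E.
  have := @measurable_fun_fubini_tonelli_F _ _ _ _ _ mu (fun p : X * X => (D p.2 p.1)%:E).
  by apply; [exact/measurable_EFinP|move=> p; rewrite lee_fin D0].
have p1 x : (0 <= \int[mu]_y (D x y)%:E)%E by apply: integral_ge0 => y _; rewrite lee_fin D0.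
have p2 x : (0 <= \int[mu]_y (D y x)%:E)%E by apply: integral_ge0 => y _; rewrite lee_fin D0.
rewrite ge0_integralZl//; last 2 first.
- exact: (emeasurable_funD mI1 mI2).
- by move=> x _; rewrite adde_ge0.
have fub : (\int[mu]_x \int[mu]_y (D y x)%:E = \int[mu]_x \int[mu]_y (D x y)%:E)%E.
  have := @fubini_tonelli _ _ _ _ _ mu mu (fun p : X * X => (D p.2 p.1)%:E).
  by apply; [exact/measurable_EFinP|move=> p; rewrite lee_fin D0].
have split_int : (\int[mu]_x (\int[mu]_y (D x y)%:E + \int[mu]_y (D y x)%:E) =
    \int[mu]_x \int[mu]_y (D x y)%:E + \int[mu]_x \int[mu]_y (D y x)%:E)%E.
  exact: (ge0_integralD mu measurableT (fun x _ => p1 x) mI1 (fun x _ => p2 x) mI2).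
have int_D_swap := eq_ind_r (fun z => (z <= _)%E) int_D fub.
rewrite split_int.
have two0 : (0 <= 2%:E :> \bar R)%E by rewrite lee_fin.
apply: (le_trans (lee_wpmul2l two0 (leeD int_D int_D_swap))).
rewrite -ge0_muleDl; last 2 first.
- by rewrite lee_fin mulr_ge0 ?sqr_ge0// mulr_ge0.
- by rewrite lee_fin mulr_ge0 ?sqr_ge0// mulr_ge0.
rewrite muleA -EFinD -EFinM le_eqVlt; apply/orP; left; apply/eqP.
by congr (_%:E * _)%E; field.
Qed.
End cell.
End poincare.

(** * Oscillation on one cell *)

Section cell_estimate.
Context (R : realType) (m : nat).
Local Notation X := 'rV[R]_m.
Local Notation mu := (lebesgue_rV R m).
Local Notation L1 f := (mu.-integrable setT (EFin \o f)).

Variables (T U : set X) (d : R).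
Hypothesis mT : measurable T.
Hypothesis mU : measurable U.
Hypothesis T_gt0 : (0 < mu T)%E.
Hypothesis T_fin : (mu T < +oo)%E.
Hypothesis Td : forall x y, T x -> T y -> enorm (x - y) <= d.
Hypothesis TU : forall x y s, T x -> T y -> 0 <= s <= 1 -> U (x + s *: (y - x)).

Let p : R := fine (mu T).

Let pE : mu T = p%:E. Proof. by rewrite fineK// ge0_fin_numE. Qed.

Let p_gt0 : 0 < p. Proof. by rewrite -lte_fin -pE. Qed.

Let iT : L1 (\1_T : X -> R). Proof. exact: integrable_indic_fin. Qed.

Let int_indic : \int[mu]_x (\1_T x : R) = p.
Proof. by rewrite /Rintegral integral_indic// setIT. Qed.

Definition cell_mean (v : X -> R) : R := (\int[mu]_x (v x * \1_T x)) / fine (mu T).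

Definition oscillation (v : X -> R) (x : X) : R := (v x - cell_mean v) * \1_T x.

Lemma integrable_indicM v : L1 v -> L1 (fun x => v x * \1_T x).
Proof.
move=> iv; apply: (@RintegrableM_bounded _ _ _ _ _ _ 1) => // x.
by rewrite ger0_norm// indicE; case: (x \in T).
Qed.

Lemma oscillation_integrable v : L1 v -> L1 (oscillation v).
Proof.
move=> iv; rewrite (_ : oscillation v = fun x => v x * \1_T x - cell_mean v * \1_T x).
  by apply: RintegrableB; [exact: integrable_indicM|exact: RintegrableZ].
by apply/funext => x; rewrite /oscillation mulrBl.
Qed.

Lemma oscillation_int0 v : L1 v -> \int[mu]_x oscillation v x = 0.
Proof.
move=> iv; transitivity (\int[mu]_x (v x * \1_T x - cell_mean v * \1_T x)).
  by apply: eq_Rintegral => x _; rewrite /oscillation mulrBl.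
rewrite RintegralB//; [|exact: integrable_indicM|exact: RintegrableZ].
by rewrite RintegralZl// int_indic /cell_mean divfK ?subrr// gt_eqF.
Qed.

Let indic_sqr x : (\1_T x : R) ^+ 2 = \1_T x.
Proof. by rewrite indicE; case: (x \in T); rewrite ?expr1n ?expr0n. Qed.

Lemma oscillation_sqrE v x : oscillation v x ^+ 2 =
  v x ^+ 2 * \1_T x + (- (2 * cell_mean v)) * (v x * \1_T x) + cell_mean v ^+ 2 * \1_T x.
Proof. by rewrite /oscillation exprMn indic_sqr; ring. Qed.

Lemma oscillation_sqr v : L1 v -> L1 (fun x => v x ^+ 2) ->
  L1 (fun x => oscillation v x ^+ 2) /\
  \int[mu]_x oscillation v x ^+ 2 <= \int[mu]_x (v x ^+ 2 * \1_T x).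
Proof.
move=> iv iv2; have i1 := integrable_indicM iv2; have i2 := integrable_indicM iv.
have i3 : L1 (fun x => (- (2 * cell_mean v)) * (v x * \1_T x)) by exact: RintegrableZ.
have i4 : L1 (fun x => cell_mean v ^+ 2 * \1_T x) by exact: RintegrableZ.
have -> : (fun x => oscillation v x ^+ 2) = (fun x => v x ^+ 2 * \1_T x +
    (- (2 * cell_mean v)) * (v x * \1_T x) + cell_mean v ^+ 2 * \1_T x).
  by apply/funext => x; rewrite oscillation_sqrE.
have i12 := RintegrableD i1 i3.
split; first exact: RintegrableD.
rewrite RintegralD// RintegralD// !RintegralZl// int_indic.
have -> : \int[mu]_x (v x * \1_T x) = cell_mean v * p.
  by rewrite /cell_mean divfK// gt_eqF.
have := mulr_ge0 (sqr_ge0 (cell_mean v)) (ltW p_gt0); lra.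
Qed.

(** The oscillation has integral 0, so [G] may be replaced by its deviation from its mean on the
    cell. AM-GM with the free parameter [la] separates the factors, and [poincare] bounds the
    variance of [G]. *)
Lemma cell_estimate (v G : X -> R) (B la : R) : 0 < la ->
  L1 v -> L1 (fun x => v x ^+ 2) -> smooth G -> (forall x, `|G x| <= B) -> L1 (gradsq G) ->
  \int[mu]_x (oscillation v x * G x) <=
  la / 2 * \int[mu]_x oscillation v x ^+ 2 +
  2 ^+ m * d ^+ 2 / (4 * la) * \int[mu]_x (gradsq G x * \1_U x).
Proof.
move=> la0 iv iv2 sG GB iG.
have mG : measurable_fun setT G by apply: continuous_rV_measurable; exact: smooth_continuous.
have G2B x : `|G x ^+ 2| <= B ^+ 2.
  by rewrite normrX lerXn2r ?nnegrE// (le_trans _ (GB x)).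
have iGT : L1 (fun x => \1_T x * G x) by exact: RintegrableM_bounded GB.
have iG2T : L1 (fun x => \1_T x * G x ^+ 2).
  by apply: RintegrableM_bounded G2B => //; exact: measurable_funX.
pose c := \int[mu]_x (\1_T x * G x); pose s := \int[mu]_x (\1_T x * G x ^+ 2).
pose Q := \int[mu]_x (gradsq G x * \1_U x).
have iQ : L1 (fun x => gradsq G x * \1_U x).
  apply: (@RintegrableM_bounded _ _ _ _ _ _ 1) => // x.
  by rewrite ger0_norm// indicE; case: (x \in U).
(* The double integral of squared differences is twice the unnormalised variance. *)
have II : (\int[mu]_x \int[mu]_y (\1_T x * \1_T y * (G x - G y) ^+ 2)%:E =
    (2 * p * s - 2 * c ^+ 2)%:E)%E.
  have inner x : (\int[mu]_y (\1_T x * \1_T y * (G x - G y) ^+ 2)%:E =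
      (p * (\1_T x * G x ^+ 2) + (- (2 * c)) * (\1_T x * G x) + s * \1_T x)%:E)%E.
    have j1 : L1 (fun y => \1_T x * G x ^+ 2 * \1_T y) by exact: RintegrableZ.
    have j2 : L1 (fun y => (- (2 * (\1_T x * G x))) * (\1_T y * G y)) by exact: RintegrableZ.
    have j3 : L1 (fun y => \1_T x * (\1_T y * G y ^+ 2)) by exact: RintegrableZ.
    have j12 := RintegrableD j1 j2.
    transitivity (\int[mu]_y (\1_T x * G x ^+ 2 * \1_T y + (- (2 * (\1_T x * G x))) * (\1_T y * G y) +
        \1_T x * (\1_T y * G y ^+ 2))%:E)%E.
      by apply: eq_integral => y _; congr (_%:E); ring.
    rewrite -EFin_Rintegral; last exact: RintegrableD.
    rewrite RintegralD// RintegralD// !RintegralZl// int_indic -/c -/s.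
    by congr (_%:E); ring.
  under eq_integral do rewrite inner.
  have j1 : L1 (fun x => p * (\1_T x * G x ^+ 2)) by exact: RintegrableZ.
  have j2 : L1 (fun x => (- (2 * c)) * (\1_T x * G x)) by exact: RintegrableZ.
  have j3 : L1 (fun x => s * \1_T x) by exact: RintegrableZ.
  have j12 := RintegrableD j1 j2.
  rewrite -EFin_Rintegral; last exact: RintegrableD.
  rewrite RintegralD// RintegralD// !RintegralZl// int_indic -/c -/s.
  by congr (_%:E); ring.
have := poincare mT mU Td TU sG; rewrite II pE -EFin_Rintegral// -/Q -!EFinM lee_fin => P.
have io := oscillation_integrable iv; have [io2 _] := oscillation_sqr iv iv2.
have iD : L1 (fun x => (p * G x - c) ^+ 2 * \1_T x) /\
    \int[mu]_x ((p * G x - c) ^+ 2 * \1_T x) = p * (p * s - c ^+ 2).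
  have -> : (fun x => (p * G x - c) ^+ 2 * \1_T x) = (fun x => p ^+ 2 * (\1_T x * G x ^+ 2) +
      (- (2 * p * c)) * (\1_T x * G x) + c ^+ 2 * \1_T x).
    by apply/funext => x; ring.
  have j1 : L1 (fun x => p ^+ 2 * (\1_T x * G x ^+ 2)) by exact: RintegrableZ.
  have j2 : L1 (fun x => (- (2 * p * c)) * (\1_T x * G x)) by exact: RintegrableZ.
  have j3 : L1 (fun x => c ^+ 2 * \1_T x) by exact: RintegrableZ.
  have j12 := RintegrableD j1 j2.
  split; first exact: RintegrableD.
  by rewrite RintegralD// RintegralD// !RintegralZl// int_indic -/c -/s; ring.
have ioG : L1 (fun x => oscillation v x * G x) by exact: RintegrableM_bounded GB.
(* AM-GM multiplied through by [p]: here [p * G x - c] is [p] times the deviation of [G] from its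
   mean. *)
have key x : p * (oscillation v x * G x) <= c * oscillation v x +
    (la * p / 2 * oscillation v x ^+ 2 + (2 * la * p)^-1 * ((p * G x - c) ^+ 2 * \1_T x)).
  rewrite -subr_ge0.
  have -> : c * oscillation v x + (la * p / 2 * oscillation v x ^+ 2 +
      (2 * la * p)^-1 * ((p * G x - c) ^+ 2 * \1_T x)) - p * (oscillation v x * G x) =
      (2 * la * p)^-1 * \1_T x * (la * p * (v x - cell_mean v) - (p * G x - c)) ^+ 2.
    rewrite /oscillation exprMn indic_sqr; field.
    by rewrite !gt_eqF.
  by rewrite mulr_ge0 ?sqr_ge0// mulr_ge0// invr_ge0 !mulr_ge0 ?ltW.
have k1 : L1 (fun x => c * oscillation v x) by exact: RintegrableZ.
have k2 : L1 (fun x => la * p / 2 * oscillation v x ^+ 2) by exact: RintegrableZ.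
have k3 : L1 (fun x => (2 * la * p)^-1 * ((p * G x - c) ^+ 2 * \1_T x)) by apply: RintegrableZ; exact: iD.1.
have k23 := RintegrableD k2 k3.
have : p * \int[mu]_x (oscillation v x * G x) <=
    la * p / 2 * \int[mu]_x oscillation v x ^+ 2 + (2 * la * p)^-1 * (p * (p * s - c ^+ 2)).
  rewrite -RintegralZl//.
  apply: (@le_trans _ _ (\int[mu]_x (c * oscillation v x +
    (la * p / 2 * oscillation v x ^+ 2 + (2 * la * p)^-1 * ((p * G x - c) ^+ 2 * \1_T x))))).
    apply: le_Rintegral => //; first exact: RintegrableZ.
    exact: RintegrableD.
  rewrite RintegralD// RintegralD// !RintegralZl//; last exact: iD.1.
  by rewrite oscillation_int0// mulr0 add0r iD.2.
move=> H; rewrite -(ler_pM2l p_gt0) (le_trans H)// [leRHS]mulrDr.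
set O := \int[mu]_x oscillation v x ^+ 2.
have -> : p * (la / 2 * O) = la * p / 2 * O by ring.
rewrite lerD2l.
have -> : (2 * la * p)^-1 * (p * (p * s - c ^+ 2)) = (4 * la)^-1 * (2 * p * s - 2 * c ^+ 2).
  by field; rewrite !gt_eqF.
have -> : p * (2 ^+ m * d ^+ 2 / (4 * la) * Q) = (4 * la)^-1 * (2 ^+ m * d ^+ 2 * (p * Q)).
  by field; rewrite gt_eqF.
by rewrite ler_wpM2l// invr_ge0 mulr_ge0// ltW.
Qed.
End cell_estimate.

(** * Summation over the cells *)

Section negative_norm.
Context (R : realType) (m : nat).
Local Notation X := 'rV[R]_m.
Local Notation mu := (lebesgue_rV R m).
Local Notation L1 f := (mu.-integrable setT (EFin \o f)).

Variables (N : nat) (T U : 'I_N -> set X) (d : R).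
Hypothesis d0 : 0 < d.
Hypothesis mT : forall l, measurable (T l).
Hypothesis mU : forall l, measurable (U l).
Hypothesis T_gt0 : forall l, (0 < mu (T l))%E.
Hypothesis T_fin : forall l, (mu (T l) < +oo)%E.
Hypothesis Td : forall l x y, T l x -> T l y -> enorm (x - y) <= d.
Hypothesis TU : forall l x y s, T l x -> T l y -> 0 <= s <= 1 -> U l (x + s *: (y - x)).
Hypothesis U_disj : forall k l x, U k x -> U l x -> k = l.

Let T_disj k l x : T k x -> T l x -> k = l.
Proof.
move=> Tk Tl; apply: (@U_disj _ _ x).
  by have := @TU _ x x 0 Tk Tk; rewrite subrr scaler0 addr0; apply; rewrite lexx ler01.
by have := @TU _ x x 0 Tl Tl; rewrite subrr scaler0 addr0; apply; rewrite lexx ler01.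
Qed.

Lemma sum_disj (A : 'I_N -> set X) (a : 'I_N -> R) x :
  (forall k l, A k x -> A l x -> k = l) ->
  (exists2 l, A l x & forall b : 'I_N -> R, \sum_k b k * \1_(A k) x = b l) \/
  (forall k, ~ A k x).
Proof.
move=> Ad; have [[l Al]|nA] := pselect (exists l, A l x); last first.
  by right => k Ak; apply: nA; exists k.
left; exists l => // b; rewrite (bigD1 l)//= indicE mem_set// mulr1 big1 ?addr0// => k kl.
by rewrite indicE memNset ?mulr0// => Ak; move: kl; rewrite (Ad _ _ Ak Al) eqxx.
Qed.

Variable v : X -> R.
Hypothesis iv : L1 v.
Hypothesis iv2 : L1 (fun x => v x ^+ 2).

Definition fluctuation (x : X) : R := \sum_l oscillation (T l) v x.

Lemma fluctuation_sqr x : fluctuation x ^+ 2 = \sum_l oscillation (T l) v x ^+ 2.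
Proof.
rewrite /fluctuation /oscillation.
have [[l Tl E]|nT] := sum_disj (fun=> 0) (fun k l => @T_disj k l x).
  rewrite E; under eq_bigr => k _.
    rewrite exprMn (_ : \1_(T k) x ^+ 2 = \1_(T k) x); last first.
      by rewrite indicE; case: (x \in T k); rewrite ?expr1n ?expr0n.
    over.
  by rewrite E.
by rewrite !big1 ?expr0n// => k _; rewrite indicE memNset ?mulr0 ?expr0n//; exact: nT.
Qed.

Lemma fluctuation_integrable : L1 fluctuation.
Proof. by have [] := Rintegral_sum (fun l => oscillation_integrable (mT l) (T_fin l) iv). Qed.

Lemma sum_indic_le1 (A : 'I_N -> set X) x : (forall k l, A k x -> A l x -> k = l) ->
  \sum_k (\1_(A k) x : R) <= 1.
Proof.
move=> Ad; have [[l Al E]|nA] := sum_disj (fun=> 0) Ad.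
  by have := E (fun=> 1); under eq_bigr do rewrite mul1r; move=> ->.
by rewrite big1// => k _; rewrite indicE memNset//; exact: nA.
Qed.

(** Subtracting the mean does not increase the L2 norm on a cell, and the disjoint cells contribute
    separately. *)
Lemma fluctuation_sqr_integrable : L1 (fun x => fluctuation x ^+ 2) /\
  \int[mu]_x fluctuation x ^+ 2 <= \int[mu]_x v x ^+ 2.
Proof.
have H l := oscillation_sqr (mT l) (T_gt0 l) (T_fin l) iv iv2.
have [i1 e1] := Rintegral_sum (fun l => (H l).1).
have E : (fun x => fluctuation x ^+ 2) = (fun x => \sum_l oscillation (T l) v x ^+ 2).
  by apply/funext => x; rewrite fluctuation_sqr.
have [i2 e2] := Rintegral_sum (fun l => integrable_indicM (mT l) iv2).
rewrite E; split => //; rewrite e1.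
apply: (@le_trans _ _ (\sum_l \int[mu]_x (v x ^+ 2 * \1_(T l) x))).
  by apply: ler_sum => l _; exact: (H l).2.
rewrite -e2; apply: le_Rintegral => // x _.
rewrite -mulr_sumr ler_piMr ?sqr_ge0//; apply: sum_indic_le1 => k l; exact: T_disj.
Qed.

(* The gradient terms add up because the sets [U l] are disjoint. *)
Lemma fluctuation_estimate (G : X -> R) (B la : R) : 0 < la ->
  smooth G -> (forall x, `|G x| <= B) -> L1 (gradsq G) ->
  \int[mu]_x (fluctuation x * G x) <=
  la / 2 * \int[mu]_x fluctuation x ^+ 2 + 2 ^+ m * d ^+ 2 / (4 * la) * \int[mu]_x gradsq G x.
Proof.
move=> la0 sG GB iG.
have mG : measurable_fun setT G by apply: continuous_rV_measurable; exact: smooth_continuous.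
have H l := oscillation_sqr (mT l) (T_gt0 l) (T_fin l) iv iv2.
have i0 l : L1 (fun x => oscillation (T l) v x * G x).
  apply: RintegrableM_bounded mG GB.
  exact: (oscillation_integrable (mT l) (T_fin l) iv).
have [i1 e1] := Rintegral_sum i0.
have [i2 e2] := Rintegral_sum (fun l => (H l).1).
have [i3 e3] := Rintegral_sum (fun l => integrable_indicM (mU l) iG).
have -> : \int[mu]_x (fluctuation x * G x) = \sum_l \int[mu]_x (oscillation (T l) v x * G x).
  by rewrite -e1; apply: eq_Rintegral => x _; rewrite /fluctuation mulr_suml.
have -> : \int[mu]_x fluctuation x ^+ 2 = \sum_l \int[mu]_x oscillation (T l) v x ^+ 2.
  by rewrite -e2; apply: eq_Rintegral => x _; rewrite fluctuation_sqr.
apply: (@le_trans _ _ (\sum_l (la / 2 * \int[mu]_x oscillation (T l) v x ^+ 2 +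
   2 ^+ m * d ^+ 2 / (4 * la) * \int[mu]_x (gradsq G x * \1_(U l) x)))).
  apply: ler_sum => l _.
  exact: (cell_estimate (mT l) (mU l) (T_gt0 l) (T_fin l) (@Td l) (@TU l) la0 iv iv2 sG GB iG).
rewrite big_split/= -!mulr_sumr lerD2l ler_wpM2l//.
  by rewrite divr_ge0 ?mulr_ge0 ?sqr_ge0// ltW// mulr_gt0.
rewrite -e3; apply: le_Rintegral => // x _.
by rewrite -mulr_sumr ler_piMr ?gradsq_ge0//; apply: sum_indic_le1 => k l; exact: U_disj.
Qed.

End negative_norm.

(** * Duality and interpolation *)

Section dual_estimate.
Context (R : realType) (m : nat).
Local Notation X := 'rV[R]_m.
Local Notation mu := (lebesgue_rV R m).
Local Notation L1 f := (mu.-integrable setT (EFin \o f)).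
Implicit Types (g a b : X -> R).

(** The square of the order -1/2 density is the order -1 density; this makes the interpolation with
    L2 a pointwise inequality. *)
Lemma hweight_sqr (xi : X) : hweight xi ^+ 2 = (1 + enorm xi ^+ 2)^-1.
Proof.
have b1 := wgt_base_ge1 xi; have b0 : 0 < 1 + enorm xi ^+ 2 by exact: lt_le_trans b1.
by rewrite /hweight /wgt div1r powRN powR12_sqrt ?(ltW b0)// exprVn sqr_sqrtr// ltW.
Qed.

Lemma truncated_integrable g (r : R) (w : X -> R) (B : R) :
  measurable_fun setT g -> measurable_fun setT w -> (forall x, `|g x| <= B) ->
  (forall x, 0 <= w x <= 1) -> 0 < r ->
  compactly_integrable (fun x => \1_(ball (0 : X) r) x * (w x * g x)).
Proof.
move=> mg mw gB w01 r0.
have mB : measurable (ball (0 : X) r) by exact: measurable_rV_ball.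
have bs : bounded_support (fun x => \1_(ball (0 : X) r) x * (w x * g x)).
  exists r => // x xr; rewrite indicE memNset ?mul0r// rV_ball0.
  by apply/negP; rewrite -leNgt ltW.
split => //; apply: (@bounded_support_integrable _ _ B) => //.
  by apply: measurable_funM => //; exact: measurable_funM.
move=> x; rewrite !normrM -[leRHS]mul1r ler_pM//.
  by rewrite ger0_norm// indicE; case: (x \in _).
have /andP[w0 w1] := w01 x; rewrite ger0_norm// -[leRHS]mul1r ler_pM//.
Qed.

Lemma ci_sqr_integrable a (B : R) : compactly_integrable a -> (forall x, `|a x| <= B) ->
  L1 (fun x => a x ^+ 2).
Proof.
move=> [ia [r r0 h]] aB; apply: (@bounded_support_integrable _ _ (B ^+ 2)).
- by apply: measurable_funX; exact: Rintegrable_measurable ia.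
- by move=> x; rewrite normrX lerXn2r ?nnegrE// (le_trans _ (aB x)).
- by exists r => // x /h ->; rewrite expr0n.
Qed.

(** A partial derivative of [G] is a combination of transforms of [x_i a] and [x_i b]. Bessel's
    inequality bounds each, and summing over [i] restores the squared Euclidean norm. *)
Lemma gradsq_trig a b : compactly_integrable a -> compactly_integrable b ->
  (exists B, forall x, `|a x| <= B) -> (exists B, forall x, `|b x| <= B) ->
  L1 (fun x => enorm x ^+ 2 * (a x ^+ 2 + b x ^+ 2)) ->
  let G := fun x => Fcos a x + Fsin b x in
  L1 (gradsq G) /\ \int[mu]_x gradsq G x <=
    2 * (2 * pi) ^+ m * \int[mu]_x (enorm x ^+ 2 * (a x ^+ 2 + b x ^+ 2)).
Proof.
move=> ca cb [Ba aB] [Bb bB] iab G.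
have pdG i x : pd i G x = - Fsin (fun x : X => x ord0 i * a x) x + Fcos (fun x : X => x ord0 i * b x) x.
  rewrite /G pdD; [|by move=> y; exact/smooth_differentiable/smooth_Fcos|by move=> y; exact/smooth_differentiable/smooth_Fsin].
  by rewrite pd_Fcos// pd_Fsin.
have bnd c (B : R) i : compactly_integrable c -> (forall x, `|c x| <= B) ->
    L1 (fun x : X => (x ord0 i * c x) ^+ 2).
  move=> cc cB; have [ic [r r0 h]] := cc.
  apply: (@ci_sqr_integrable _ (r * B)); first exact: ci_coord.
  move=> x; have [xr|/h ->] := leP `|x| r; last first.
    by rewrite mulr0 normr0 mulr_ge0 ?(ltW r0)// (le_trans _ (cB 0)).
  by rewrite normrM ler_pM// (le_trans (coord_le_norm _ _)).
have ia i := (ci_coord i ca).1; have ib i := (ci_coord i cb).1.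
have ia2 i := bnd a Ba i ca aB; have ib2 i := bnd b Bb i cb bB.
pose Q i x := Fcos (fun x : X => x ord0 i * a x) x ^+ 2 + Fsin (fun x : X => x ord0 i * a x) x ^+ 2 +
  (Fcos (fun x : X => x ord0 i * b x) x ^+ 2 + Fsin (fun x : X => x ord0 i * b x) x ^+ 2).
have iQ i : L1 (Q i) by apply: RintegrableD; exact: integrable_Fsqr.
have QE i : \int[mu]_x Q i x <= (2 * pi) ^+ m *
    \int[mu]_x ((x ord0 i * a x) ^+ 2 + (x ord0 i * b x) ^+ 2).
  rewrite RintegralD//; [|exact: integrable_Fsqr|exact: integrable_Fsqr].
  by rewrite [X in _ <= _ * X]RintegralD// mulrDr lerD// bessel_R.
have [iS eS] := Rintegral_sum iQ.
have K x : gradsq G x <= 2 * \sum_i Q i x.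
  rewrite mulr_sumr; apply: ler_sum => i _; rewrite pdG /Q.
  set p := Fsin _ x; set q := Fcos _ x; set p' := Fcos _ x; set q' := Fsin _ x.
  have := sqr_ge0 (p + q); have := sqr_ge0 p'; have := sqr_ge0 q'.
  by rewrite !expr2; nra.
have sG : smooth G by apply: smoothD; [exact: smooth_Fcos|exact: smooth_Fsin].
have iS2 : L1 (fun x => 2 * \sum_i Q i x) by exact: RintegrableZ.
have iG : L1 (gradsq G).
  apply: Rintegrable_le iS2.
    by apply: continuous_rV_measurable; exact/smooth_continuous/smooth_gradsq.
  by move=> x; rewrite ger0_norm ?gradsq_ge0.
split => //; apply: (@le_trans _ _ (\int[mu]_x (2 * \sum_i Q i x))).
  by apply: le_Rintegral => // x _; exact: K.
rewrite RintegralZl// eS -mulrA ler_wpM2l//.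
apply: (le_trans (ler_sum _ (fun i _ => QE i))).
rewrite -mulr_sumr ler_wpM2l ?exprn_ge0 ?mulr_ge0 ?pi_ge0//.
have iab' i : L1 (fun x : X => (x ord0 i * a x) ^+ 2 + (x ord0 i * b x) ^+ 2) by exact: RintegrableD.
have [iT eT] := Rintegral_sum iab'; rewrite -eT.
rewrite le_eqVlt; apply/orP; left; apply/eqP; apply: eq_Rintegral => x _.
by rewrite enorm_sqr /dotp mulr_suml; apply: eq_bigr => i _; rewrite !exprMn; ring.
Qed.

Variables (g : X -> R) (d : R).
Hypothesis d0 : 0 < d.
Hypothesis ig : L1 g.
Hypothesis ig2 : L1 (fun x => g x ^+ 2).
Hypothesis gG : forall (G : X -> R) (B la : R), 0 < la ->
  smooth G -> (forall x, `|G x| <= B) -> L1 (gradsq G) ->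
  \int[mu]_x (g x * G x) <=
  la / 2 * \int[mu]_x g x ^+ 2 + 2 ^+ m * d ^+ 2 / (4 * la) * \int[mu]_x gradsq G x.

Let w (xi : X) : R := (1 + enorm xi ^+ 2)^-1.

Let w_gt0 xi : 0 < w xi. Proof. by rewrite invr_gt0 (lt_le_trans ltr01)// wgt_base_ge1. Qed.

Let w01 xi : 0 <= w xi <= 1.
Proof.
rewrite ltW ?w_gt0//= invf_le1 ?wgt_base_ge1//.
by rewrite (lt_le_trans ltr01)// wgt_base_ge1.
Qed.

Let mw : measurable_fun setT w.
Proof.
rewrite (_ : w = fun xi => hweight xi ^+ 2); last by apply/funext => xi; rewrite hweight_sqr.
by apply: measurable_funX; exact: measurable_wgt.
Qed.

Let q xi := Fcos g xi ^+ 2 + Fsin g xi ^+ 2.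

Let iq : L1 q. Proof. exact: integrable_Fsqr. Qed.

Let q0 xi : 0 <= q xi. Proof. by rewrite addr_ge0 ?sqr_ge0. Qed.

(** [G] is built from the transforms of [g], weighted by [w] and cut off to a ball, so that its
    pairing with [g] is exactly the truncated order -1 energy. The gradient term is bounded by the
    same energy and absorbed. *)
Let dual_ball (r : R) : 0 < r ->
  \int[mu]_xi (\1_(ball (0 : X) r) xi * (w xi * q xi)) <=
  (4 * pi) ^+ m * d ^+ 2 * \int[mu]_x g x ^+ 2.
Proof.
move=> r0; pose a xi := \1_(ball (0 : X) r) xi * (w xi * Fcos g xi).
pose b xi := \1_(ball (0 : X) r) xi * (w xi * Fsin g xi).
have mB : measurable (ball (0 : X) r) by exact: measurable_rV_ball.
have ca : compactly_integrable a.
  exact: truncated_integrable (measurable_Fcos ig) mw (fun x => Fcos_bound x ig) w01 r0.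
have cb : compactly_integrable b.
  exact: truncated_integrable (measurable_Fsin ig) mw (fun x => Fsin_bound x ig) w01 r0.
have i01 xi : (0 : R) <= \1_(ball (0 : X) r) xi <= (1 : R) by rewrite indicE; case: (xi \in _); rewrite ?ler01 ?lexx.
have bd (h : X -> R) B : (forall xi, `|h xi| <= B) ->
    exists B, forall xi, `|\1_(ball (0 : X) r) xi * (w xi * h xi)| <= B.
  move=> hB; exists B => xi; have /andP[w0 w1] := w01 xi; have /andP[j0 j1] := i01 xi.
  rewrite !normrM (ger0_norm w0) (ger0_norm j0) -[leRHS]mul1r ler_pM// ?mulr_ge0//.
  by rewrite -[leRHS]mul1r ler_pM.
have Ba := bd _ _ (fun x => Fcos_bound x ig); have Bb := bd _ _ (fun x => Fsin_bound x ig).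
pose E xi := \1_(ball (0 : X) r) xi * (w xi * q xi).
have iE : L1 E.
  apply: Rintegrable_le iq; first by apply: measurable_funM => //; apply: measurable_funM => //; exact: Rintegrable_measurable iq.
  move=> xi; have /andP[w0 w1] := w01 xi; have /andP[j0 j1] := i01 xi.
  rewrite ger0_norm ?mulr_ge0// -[leRHS]mul1r ler_pM// ?mulr_ge0//.
  by rewrite -[leRHS]mul1r ler_pM.
have ew xi : enorm xi ^+ 2 * w xi <= 1.
  rewrite -[X in X <= _]mulrC ler_pdivrMl ?mulr1; last by rewrite (lt_le_trans ltr01)// wgt_base_ge1.
  by rewrite lerDr.
(* One factor [w] compensates [enorm xi ^+ 2], the other one remains in [E]. *)
have Eab xi : enorm xi ^+ 2 * (a xi ^+ 2 + b xi ^+ 2) <= E xi.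
  have /andP[w0 w1] := w01 xi; have /andP[j0 j1] := i01 xi.
  have -> : enorm xi ^+ 2 * (a xi ^+ 2 + b xi ^+ 2) =
      \1_(ball (0 : X) r) xi * (enorm xi ^+ 2 * w xi) * E xi by rewrite /a /b /E /q; ring.
  rewrite ler_piMl// ?mulr_ge0//.
  by rewrite -[leRHS]mul1r ler_pM// mulr_ge0 ?sqr_ge0.
have ma := Rintegrable_measurable ca.1; have mb := Rintegrable_measurable cb.1.
have iab : L1 (fun xi => enorm xi ^+ 2 * (a xi ^+ 2 + b xi ^+ 2)).
  apply: Rintegrable_le iE.
    apply: measurable_funM; first by apply: measurable_funX; exact: measurable_enorm.
    by apply: measurable_funD; exact: measurable_funX.
  by move=> xi; rewrite ger0_norm ?Eab// mulr_ge0 ?addr_ge0 ?sqr_ge0.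
have [iG GE] := gradsq_trig ca cb Ba Bb iab.
set G := (fun x => _) in iG GE.
have GB x : `|G x| <= \int[mu]_x `|a x| + \int[mu]_x `|b x|.
  by rewrite (le_trans (ler_normD _ _))// lerD// ?Fcos_bound ?Fsin_bound//; [exact: ca.1|exact: cb.1].
have sG : smooth G by apply: smoothD; [exact: smooth_Fcos|exact: smooth_Fsin].
have P0 : 0 < (2 * pi) ^+ m :> R by rewrite exprn_gt0// mulr_gt0// pi_gt0.
(* Chosen so that the gradient term becomes exactly half of the energy on the left. *)
pose la : R := 2 ^+ m * d ^+ 2 * (2 * pi) ^+ m.
have la0 : 0 < la by rewrite mulr_gt0// mulr_gt0 ?exprn_gt0.
have := gG la0 sG GB iG.
have gcE : \int[mu]_x (g x * G x) = \int[mu]_xi E xi.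
  have j1 : L1 (fun x => g x * Fcos a x) by apply: RintegrableM_bounded (measurable_Fcos ca.1) (fun x => Fcos_bound x ca.1).
  have j2 : L1 (fun x => g x * Fsin b x) by apply: RintegrableM_bounded (measurable_Fsin cb.1) (fun x => Fsin_bound x cb.1).
  have j3 : L1 (fun x => a x * Fcos g x) by apply: RintegrableM_bounded ca.1 (measurable_Fcos ig) (fun x => Fcos_bound x ig).
  have j4 : L1 (fun x => b x * Fsin g x) by apply: RintegrableM_bounded cb.1 (measurable_Fsin ig) (fun x => Fsin_bound x ig).
  transitivity (\int[mu]_x (g x * Fcos a x + g x * Fsin b x)).
    by apply: eq_Rintegral => x _; rewrite mulrDr.
  rewrite RintegralD// (Fcos_swap ig ca.1) (Fsin_swap ig cb.1) -RintegralD//.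
  by apply: eq_Rintegral => xi _; rewrite /a /b /E /q; ring.
have E0 : 0 <= \int[mu]_xi E xi.
  by apply: Rintegral_ge0 => xi _; rewrite !mulr_ge0// ltW.
have GE' : \int[mu]_x gradsq G x <= 2 * (2 * pi) ^+ m * \int[mu]_xi E xi.
  apply: (le_trans GE); rewrite ler_wpM2l ?mulr_ge0 ?(ltW P0)//.
  by apply: le_Rintegral => // xi _; exact: Eab.
rewrite gcE => H.
have c0 : 0 <= 2 ^+ m * d ^+ 2 / (4 * la).
  by apply: divr_ge0; [apply: mulr_ge0; [exact: exprn_ge0|exact: sqr_ge0]|rewrite mulr_ge0// ltW].
have := ler_wpM2l c0 GE'.
have -> : 2 ^+ m * d ^+ 2 / (4 * la) * (2 * (2 * pi) ^+ m * \int[mu]_xi E xi) = 2^-1 * \int[mu]_xi E xi.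
  by rewrite /la; field; rewrite !gt_eqF// ?exprn_gt0.
have -> : (4 * pi) ^+ m * d ^+ 2 * \int[mu]_x g x ^+ 2 = la * \int[mu]_x g x ^+ 2.
  rewrite /la (_ : 4 * pi = 2 * (2 * pi)) ?exprMn; ring.
by move: H; set S := \int[mu]_x g x ^+ 2; set T := \int[mu]_xi E xi; lra.
Qed.

(** Fatou's lemma removes the cut-off, giving order -1 energy of size [d ^+ 2]; Bessel's inequality
    gives order 0 energy of size 1. Weighting them by [1/(2 d)] and [d/2] yields the single power of
    [d]. *)
Lemma dual_estimate : L1 (fun xi => hweight xi * q xi) /\
  \int[mu]_xi (hweight xi * q xi) <= (4 * pi) ^+ m * d * \int[mu]_x g x ^+ 2.
Proof.
have mq := Rintegrable_measurable iq.
have H : (\int[mu]_xi (w xi * q xi)%:E <= ((4 * pi) ^+ m * d ^+ 2 * \int[mu]_x g x ^+ 2)%:E)%E.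
  apply: (@fatou_bound _ _ _ mu (fun n xi => \1_(ball (0 : X) n.+1%:R) xi * (w xi * q xi))).
  - move=> n; have mB : measurable (ball (0 : X) n.+1%:R) by exact: measurable_rV_ball.
    by apply: measurable_funM => //; exact: measurable_funM.
  - by move=> n xi; rewrite !mulr_ge0// ltW.
  - move=> xi; rewrite -[X in _ --> X]mul1r; apply: cvgM; last exact: cvg_cst.
    apply: cvg_near_cst; exists (Num.truncn `|xi|) => // n /= xn.
    rewrite indicE mem_set// rV_ball0 (lt_le_trans (truncnS_gt _))// ler_nat ltnS.
    exact: xn.
  - move=> n; rewrite -EFin_Rintegral ?lee_fin; first exact: dual_ball.
    have mB : measurable (ball (0 : X) n.+1%:R) by exact: measurable_rV_ball.
    apply: Rintegrable_le iq; first by apply: measurable_funM => //; exact: measurable_funM.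
    move=> xi; have /andP[w0 w1] := w01 xi.
    rewrite ger0_norm ?mulr_ge0// -[leRHS]mul1r ler_pM// ?mulr_ge0//.
    by rewrite -[leRHS]mul1r ler_pM.
have iwq : L1 (fun xi => w xi * q xi).
  apply: ge0_Rintegrable; [exact: measurable_funM|by move=> xi; rewrite mulr_ge0// ltW|].
  by apply: le_lt_trans H _; rewrite ltry.
have H' : \int[mu]_xi (w xi * q xi) <= (4 * pi) ^+ m * d ^+ 2 * \int[mu]_x g x ^+ 2.
  by rewrite -lee_fin EFin_Rintegral.
(* The difference of the two sides is a multiple of the square of [hweight xi - d]. *)
have K xi : hweight xi * q xi <= d / 2 * q xi + (2 * d)^-1 * (w xi * q xi).
  rewrite /w -hweight_sqr mulrA -mulrDl ler_wpM2r// -subr_ge0.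
  have -> : d / 2 + (2 * d)^-1 * hweight xi ^+ 2 - hweight xi = (2 * d)^-1 * (hweight xi - d) ^+ 2.
    by field; rewrite gt_eqF.
  by rewrite mulr_ge0 ?sqr_ge0// invr_ge0 mulr_ge0// ltW.
have iK : L1 (fun xi => d / 2 * q xi + (2 * d)^-1 * (w xi * q xi)).
  by apply: RintegrableD; exact: RintegrableZ.
have ih : L1 (fun xi => hweight xi * q xi).
  apply: Rintegrable_le iK; first by apply: measurable_funM => //; exact: measurable_wgt.
  by move=> xi; rewrite ger0_norm ?K// mulr_ge0// ltW// wgt_gt0.
split => //; apply: (@le_trans _ _ (\int[mu]_xi (d / 2 * q xi + (2 * d)^-1 * (w xi * q xi)))).
  exact: le_Rintegral.
rewrite RintegralD//; [|exact: RintegrableZ|exact: RintegrableZ].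
rewrite !RintegralZl//.
have S0 : 0 <= \int[mu]_x g x ^+ 2 by apply: Rintegral_ge0 => x _; exact: sqr_ge0.
have B1 : \int[mu]_xi q xi <= (4 * pi) ^+ m * \int[mu]_x g x ^+ 2.
  apply: (le_trans (bessel_R ig ig2)); rewrite ler_wpM2r// lerXn2r ?nnegrE ?mulr_ge0 ?pi_ge0//.
  by rewrite ler_wpM2r ?pi_ge0// ler_nat.
have d2 : 0 <= d / 2 by rewrite divr_ge0 ?ltW.
have d3 : 0 <= (2 * d)^-1 by rewrite invr_ge0 mulr_ge0// ltW.
apply: (le_trans (lerD (ler_wpM2l d2 B1) (ler_wpM2l d3 H'))).
rewrite le_eqVlt; apply/orP; left; apply/eqP; field.
by rewrite gt_eqF.
Qed.

End dual_estimate.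

(** * Mollification of a distribution *)

Section complex_bessel.
Context (R : realType) (m : nat).
Local Notation X := 'rV[R]_m.
Local Notation C := R[i].
Local Notation Re := (@complex.Re R).
Local Notation Im := (@complex.Im R).
Local Notation mu := (lebesgue_rV R m).
Local Notation L1 f := (mu.-integrable setT (EFin \o f)).
Implicit Types (f g h phi psi : X -> C) (x xi : X).

Lemma normc_fourier_sqr_le h xi : cint h -> normc (fourier h xi) ^+ 2 <=
  2 * (2 * pi) ^- m * ((Fcos (Re \o h) xi ^+ 2 + Fsin (Re \o h) xi ^+ 2) +
    (Fcos (Im \o h) xi ^+ 2 + Fsin (Im \o h) xi ^+ 2)).
Proof.
move=> ih; rewrite normc_sqr fourierE//= -fc_sqr !exprMn -mulrDr -[leRHS]mulrA mulrCA.
rewrite ler_wpM2l ?sqr_ge0//.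
set a := Fcos _ xi; set b := Fsin _ xi; set c := Fcos _ xi; set e := Fsin _ xi.
by have := sqr_ge0 (a - b); have := sqr_ge0 (c + e); rewrite !sqrrB !sqrrD; lra.
Qed.

Lemma cint_sqr h : cmeasurable h -> L1 (fun x => normc (h x) ^+ 2) ->
  L1 (fun x => Re (h x) ^+ 2) /\ L1 (fun x => Im (h x) ^+ 2).
Proof.
move=> [mr mi] ih; split; apply: Rintegrable_le ih.
- exact: measurable_funX.
- by move=> x; rewrite ger0_norm ?sqr_ge0// normc_sqr lerDl sqr_ge0.
- exact: measurable_funX.
- by move=> x; rewrite ger0_norm ?sqr_ge0// normc_sqr lerDr sqr_ge0.
Qed.

(** The factor 2 comes from bounding the mixed terms between the real and imaginary parts of [h]. *)
Lemma complex_bessel h : cint h -> L1 (fun x => normc (h x) ^+ 2) ->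
  L1 (fun xi => normc (fourier h xi) ^+ 2) /\
  \int[mu]_xi normc (fourier h xi) ^+ 2 <= 2 * \int[mu]_x normc (h x) ^+ 2.
Proof.
move=> ih ih2; have [i1 i2] := ih; have [j1 j2] := cint_sqr (cint_cmeasurable ih) ih2.
have k1 := integrable_Fsqr i1 j1; have k2 := integrable_Fsqr i2 j2.
have k12 := RintegrableD k1 k2.
have k3 := RintegrableZ (2 * (2 * pi) ^- m) k12.
have k4 : L1 (fun xi => normc (fourier h xi) ^+ 2).
  apply: Rintegrable_le k3.
    by apply: measurable_funX; apply: measurable_normc; exact: cmeasurable_fourier.
  by move=> xi; rewrite ger0_norm ?sqr_ge0//; exact: normc_fourier_sqr_le.
split => //; apply: (le_trans (le_Rintegral measurableT k4 k3 _)).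
  by move=> xi _; exact: normc_fourier_sqr_le.
rewrite RintegralZl// RintegralD// -mulrA ler_wpM2l//.
have P0 : 0 < (2 * pi) ^+ m :> R by rewrite exprn_gt0// mulr_gt0// pi_gt0.
rewrite ler_pdivrMl//; apply: (le_trans (lerD (bessel_R i1 j1) (bessel_R i2 j2))).
rewrite -mulrDr ler_wpM2l ?(ltW P0)// -RintegralD//.
by apply: le_Rintegral => //; [exact: RintegrableD|move=> x _; rewrite normc_sqr].
Qed.

Lemma cintegral_opp f : cint f -> cintegral (fun x => f (- x)) = cintegral f.
Proof. by move=> [i1 i2]; apply: complex_ext => /=; exact: Rintegral_opp. Qed.

Lemma cint_opp f : cint f -> cint (fun x => f (- x)).
Proof.
move=> [i1 i2]; have N1 : (-1 : R) != 0 by rewrite oppr_eq0 oner_neq0.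
have E (g : X -> R) : L1 g -> L1 (fun x => g (- x)).
  move=> ig; have := affine_integrable 0 N1 ig.
  by congr (mu.-integrable _ _); apply/funext => x; rewrite /= scaleN1r addr0.
by split; [exact: (E (fun x => Re (f x)))|exact: (E (fun x => Im (f x)))].
Qed.

Lemma cint_expi h xi : cint h ->
  cint (fun x => Complex (cos (- dotp xi x)) (sin (- dotp xi x)) * h x).
Proof.
move=> ih; split.
- have := (integrableM_cos xi ih.1, integrableM_sin xi ih.2).
  move=> [/RintegrableD H /H{}H]; move: H; congr (mu.-integrable _ _); apply/funext => x /=.
  by rewrite cReM/= cosN sinN dotpC; congr (_%:E); ring.
- have := (integrableM_cos xi ih.2, integrableM_sin xi ih.1).
  move=> [/RintegrableB H /H{}H]; move: H; congr (mu.-integrable _ _); apply/funext => x /=.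
  by rewrite cImM/= cosN sinN dotpC; congr (_%:E); ring.
Qed.

Lemma fourier_opp f xi : cint f -> fourier (fun x => f (- x)) xi = fourier f (- xi).
Proof.
move=> ci; rewrite /fourier; congr (_ * _).
rewrite -cintegral_opp; last exact: cint_expi (cint_opp ci).
by congr cintegral; apply/funext => x; rewrite opprK dotpNr dotpNl.
Qed.

Lemma cmul_inv_fourier_swap h phi : cint h -> cint phi ->
  cintegral (fun x => inv_fourier h x * phi x) = cintegral (fun x => h x * inv_fourier phi x).
Proof.
move=> ih ip; have cm g k : cint g -> cint k -> cint (fun x => fourier g x * k x).
  move=> cg ck; set B := 2 * fc R m * (\int[mu]_x `|Re (g x)| + \int[mu]_x `|Im (g x)|).
  apply: (@cint_le _ _ _ (fun x => B * normc (k x))).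
  - by apply: cmeasurableM; [exact: cmeasurable_fourier|exact: cint_cmeasurable].
  - by move=> x; rewrite normcM ler_wpM2r ?normc_ge0// normc_fourier_le.
  - by apply: RintegrableZ; exact: cint_integrable_normc.
have ipN := cint_opp ip.
transitivity (cintegral (fun x => fourier h x * phi (- x))).
  rewrite -(cintegral_opp (cm _ _ ih ipN)); congr cintegral; apply/funext => x.
  by rewrite opprK.
rewrite -(cmul_fourier_swap ih ipN); congr cintegral; apply/funext => x.
by rewrite fourier_opp.
Qed.

(** The two transforms differ by a reflection, so the other composition [inv_fourierK] implies this
    one. *)
Lemma fourierK psi : ctestf psi -> inv_fourier (fourier psi) = psi.
Proof.
move=> tp; have ci := schwartz_cint (inv_fourier_schwartz tp).
rewrite -[RHS](inv_fourierK tp); apply/funext => x; rewrite /inv_fourier.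
rewrite -(fourier_opp _ (schwartz_cint (fourier_schwartz tp))).
by congr fourier; apply/funext => y; rewrite opprK.
Qed.

End complex_bessel.

(** * The mollifier and its Fourier multiplier *)

Section mollifier.
Context (R : realType) (m : nat).
Local Notation X := 'rV[R]_m.
Local Notation C := R[i].
Local Notation Re := (@complex.Re R).
Local Notation Im := (@complex.Im R).
Local Notation mu := (lebesgue_rV R m).
Local Notation L1 f := (mu.-integrable setT (EFin \o f)).

(** A box of half-side [e * al] has Euclidean radius at most [e * m / (m + 1)], strictly below [e],
    also for [m = 0]. *)
Let al : R := m.+1%:R^-1.

Let al0 : 0 < al. Proof. by rewrite invr_gt0. Qed.

(** The steepness [e^-1] makes all bumps exact rescaled translates of one profile. *)
Definition bump (e : R) (x y : X) : R :=
  box_bump (fun i => x ord0 i - e * al) (fun i => x ord0 i + e * al) e^-1 y.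

Definition bump_mass : R := \int[mu]_y bump 1 0 y.

Definition moll (e : R) (x y : X) : R := (e ^+ m * bump_mass)^-1 * bump e x y.

Lemma testf_bump e x : 0 < e -> testf (bump e x).
Proof. by move=> e0; apply: testf_box_bump; rewrite invr_gt0. Qed.

(** A zero integral would make the nonnegative bump vanish a.e., but it is positive on a ball of
    positive measure. *)
Lemma bump_mass_gt0 : 0 < bump_mass.
Proof.
have ib := testf_integrable (testf_bump (0 : X) ltr01).
rewrite lt0r; apply/andP; split; last by apply: Rintegral_ge0 => y _; exact: box_bump_ge0.
apply/eqP => I0.
have A0 : mu (ball (0 : X) al) = 0%E.
  have mb : measurable_fun setT (EFin \o bump 1 (0 : X)).
    by apply/measurable_EFinP; exact: Rintegrable_measurable ib.
  have I1 : (\int[mu]_y `|(EFin \o bump 1 (0 : X)) y| = 0)%E.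
    transitivity bump_mass%:E; last by rewrite I0.
    rewrite /bump_mass EFin_Rintegral//; apply: eq_integral => y _ /=.
    by rewrite ger0_norm// box_bump_ge0.
  have /negligibleS ae0 := (ae_eq_integral_abs mu measurableT mb).1 I1.
  apply: measure_negligible; first exact: measurable_rV_ball.
  apply: ae0 => y yb /(_ Logic.I)[]; apply/eqP; rewrite gt_eqF// box_bump_gt0 ?invr_gt0//.
  by move: yb; rewrite ball_box// => yb i; have := yb i; rewrite mul1r.
have := @open_measure_gt0 R m (ball 0 al); rewrite A0 ltxx; move=> H.
suff : false by []; apply: H; first exact: ball_open.
by exists 0; exact: ballxx.
Qed.

Lemma bump_scale e x y : 0 < e -> bump e x (e *: y + x) = bump 1 0 y.
Proof.
move=> e0; rewrite /bump /box_bump; apply: eq_bigr => i _; rewrite !mxE.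
congr (theta 1 _ * theta 1 _); field; rewrite gt_eqF//.
Qed.

Lemma testf_moll e x : 0 < e -> testf (moll e x).
Proof. by move=> e0; apply: testfZ; exact: testf_bump. Qed.

Lemma moll_scale e x y : 0 < e -> e ^+ m * moll e x (e *: y + x) = moll 1 0 y.
Proof.
move=> e0; rewrite /moll bump_scale// expr1n mul1r invfM !mulrA mulfV ?mul1r//.
by rewrite gt_eqF// exprn_gt0.
Qed.

Lemma moll_opp y : moll 1 0 (- y) = moll 1 0 y.
Proof.
congr (_ * _); apply: eq_bigr => i _; rewrite !mxE mulrC.
by congr (theta 1 _ * theta 1 _); ring.
Qed.

Lemma moll_ge0 e x y : 0 < e -> 0 <= moll e x y.
Proof.
move=> e0; rewrite mulr_ge0 ?box_bump_ge0// invr_ge0 mulr_ge0 ?exprn_ge0 ?ltW//.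
exact: bump_mass_gt0.
Qed.

Lemma moll_le e x y : 0 < e -> moll e x y != 0 -> enorm (y - x) <= e * (m%:R / m.+1%:R).
Proof.
move=> e0; apply: contra_neqT; rewrite -ltNge => exy.
rewrite /moll /bump box_bump_eq0 ?mulr0// ?invr_gt0// => bx.
have : enorm (y - x) <= m%:R * (e * al).
  apply: (le_trans (enorm_le_norm _)); rewrite ler_wpM2l//.
  apply: norm_le_coord => [|i]; first by rewrite mulr_ge0// ltW.
  by have := bx i; rewrite !mxE ler_distl => /andP[/ltW -> /ltW ->].
by move/(lt_le_trans exy); rewrite mulrCA ltxx.
Qed.

Lemma int_moll : \int[mu]_y moll 1 0 y = 1.
Proof.
have ib := testf_integrable (testf_bump (0 : X) ltr01).
by rewrite /moll RintegralZl// expr1n mul1r mulVf// gt_eqF// bump_mass_gt0.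
Qed.

(** The Fourier multiplier of mollification at scale 1, normalised to be 1 at the origin. It is real
    because the profile is even. *)
Definition chi (eta : X) : R := Fcos (moll 1 0) eta.

Let imoll e x : 0 < e -> L1 (moll e x).
Proof. by move=> e0; exact/testf_integrable/testf_moll. Qed.

Lemma Fsin_moll eta : Fsin (moll 1 0) eta = 0.
Proof.
apply: Rintegral_opp0; first exact/integrableM_sin/imoll.
by move=> y; rewrite moll_opp dotpNl sinN mulrN.
Qed.

Lemma moll_change e x (k : X -> R) (B : R) : 0 < e -> measurable_fun setT k -> (forall y, `|k y| <= B) ->
  \int[mu]_y (moll e x y * k y) = \int[mu]_y (moll 1 0 y * k (e *: y + x)).
Proof.
move=> e0 mk kB; have ik : L1 (fun y => moll e x y * k y) by exact: RintegrableM_bounded (imoll x e0) mk kB.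
have em : e ^+ m != 0 by rewrite gt_eqF// exprn_gt0.
have e1 := lt0r_neq0 e0; have := Rintegral_affine x e1 ik.
rewrite (gtr0_norm e0) => /(congr1 ( *%R (e ^+ m))); rewrite mulrA mulfV// mul1r => <-.
rewrite -RintegralZl//; last exact: affine_integrable ik.
by apply: eq_Rintegral => y _; rewrite mulrA moll_scale.
Qed.

(** Translation to [x] gives the phase and the scale [e] dilates [chi]; the sine transform of the
    even profile vanishes. *)
Lemma Fcos_mollE e x xi : 0 < e -> Fcos (moll e x) xi = cos (dotp x xi) * chi (e *: xi).
Proof.
move=> e0; rewrite /Fcos (@moll_change _ _ _ 1)//; last 2 first.
- exact: measurable_cos_dotp.
- by move=> y; exact: normr_cos_le1.
have i1 := integrableM_cos (e *: xi) (imoll 0 ltr01).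
have i2 := integrableM_sin (e *: xi) (imoll 0 ltr01).
transitivity (\int[mu]_y (cos (dotp x xi) * (moll 1 0 y * cos (dotp y (e *: xi))) -
   sin (dotp x xi) * (moll 1 0 y * sin (dotp y (e *: xi))))).
  by apply: eq_Rintegral => y _; rewrite dotpDl cosD dotpZl dotpZr; ring.
rewrite RintegralB; [|by []|exact: RintegrableZ|exact: RintegrableZ].
rewrite !RintegralZl// -[X in _ - _ * X]/(Fsin (moll 1 0) (e *: xi)) Fsin_moll mulr0 subr0.
by [].
Qed.

Lemma Fsin_mollE e x xi : 0 < e -> Fsin (moll e x) xi = sin (dotp x xi) * chi (e *: xi).
Proof.
move=> e0; rewrite /Fsin (@moll_change _ _ _ 1)//; last 2 first.
- exact: measurable_sin_dotp.
- by move=> y; exact: normr_sin_le1.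
have i1 := integrableM_cos (e *: xi) (imoll 0 ltr01).
have i2 := integrableM_sin (e *: xi) (imoll 0 ltr01).
transitivity (\int[mu]_y (sin (dotp x xi) * (moll 1 0 y * cos (dotp y (e *: xi))) +
   cos (dotp x xi) * (moll 1 0 y * sin (dotp y (e *: xi))))).
  by apply: eq_Rintegral => y _; rewrite dotpDl sinD dotpZl dotpZr; ring.
rewrite RintegralD; [|by []|exact: RintegrableZ|exact: RintegrableZ].
rewrite !RintegralZl// -[X in _ + _ * X]/(Fsin (moll 1 0) (e *: xi)) Fsin_moll mulr0 addr0.
by [].
Qed.

Lemma chi_le1 eta : `|chi eta| <= 1.
Proof.
rewrite (le_trans (Fcos_bound _ (imoll 0 ltr01)))//.
apply: (@le_trans _ _ (\int[mu]_y moll 1 0 y)); last by rewrite int_moll.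
by rewrite le_eqVlt; apply/orP; left; apply/eqP; apply: eq_Rintegral => y _; rewrite ger0_norm ?moll_ge0.
Qed.

Lemma chi_cvg1 (e : nat -> R) xi : e j @[j --> \oo] --> (0 : R) -> chi (e j *: xi) @[j --> \oo] --> (1 : R).
Proof.
move=> e0; have cc : continuous chi by exact/smooth_continuous/smooth_Fcos/testf_ci/testf_moll.
have -> : 1 = chi 0.
  transitivity (\int[mu]_y moll 1 0 y); first by rewrite int_moll.
  by apply: eq_Rintegral => y _; rewrite dotpC /dotp big1 ?cos0 ?mulr1// => i _; rewrite mxE mul0r.
apply: continuous_cvg; first exact: cc.
by rewrite -(scale0r xi); apply: cvgZr_tmp.
Qed.

Lemma chi_schwartz e : 0 < e -> is_schwartz (fun xi => Complex (chi (e *: xi)) 0).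
Proof.
move=> e0; have := trig_decay_schwartz (trig_decayD 1 0 (testf_moll (0 : X) e0) (@testf0 R m)) (trig_decayD 0 0 (@testf0 R m) (@testf0 R m)).
congr (is_schwartz _); apply/funext => xi; rewrite !mul0r !addr0 mul1r Fcos_mollE//.
by rewrite /dotp big1 ?cos0 ?mul1r// => i _; rewrite mxE mul0r.
Qed.

(** Decay of order one trades powers of the scale for Sobolev orders down to -1, which covers the
    range of [t]. *)
Lemma chi_decay : exists2 K : R, 0 < K & forall eta : X, chi eta ^+ 2 * (1 + enorm eta ^+ 2) <= K.
Proof.
have := trig_decay_bound 1 (trig_decayD 1 0 (testf_moll (0 : X) ltr01) (@testf0 R m)).
move=> [B HB]; exists (B ^+ 2 + 1) => [|eta]; first by rewrite ltr_wpDl// sqr_ge0.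
have := HB eta; rewrite mul1r mul0r addr0 expr1 -/(chi eta) => H.
have e1 := enorm_le_sum eta; have e0 := enorm_ge0 eta.
have H2 : (1 + enorm eta) * `|chi eta| <= B.
  by rewrite (le_trans _ H)// ler_wpM2r// lerD2l.
have : ((1 + enorm eta) * `|chi eta|) ^+ 2 <= B ^+ 2.
  rewrite lerXn2r ?nnegrE ?mulr_ge0 ?addr_ge0//.
  by rewrite (le_trans _ H2)// mulr_ge0 ?addr_ge0.
rewrite exprMn real_normK ?num_real// => H3.
apply: (@le_trans _ _ (B ^+ 2)); last by rewrite lerDl.
rewrite (le_trans _ H3)// mulrC ler_wpM2r ?sqr_ge0// sqrrD expr1n.
by lra.
Qed.

End mollifier.

(** * Regularized distributions and supports *)

Section regularization.
Context (R : realType) (m : nat).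
Local Notation X := 'rV[R]_m.
Local Notation C := R[i].
Local Notation Re := (@complex.Re R).
Local Notation Im := (@complex.Im R).
Local Notation mu := (lebesgue_rV R m).
Local Notation L1 f := (mu.-integrable setT (EFin \o f)).
Local Notation S := (schwartz R m).
Implicit Types (f g h : X -> C) (x y xi : X) (u : sdist R m) (psi : S) (e : R).

Lemma enormN x : enorm (- x) = enorm x.
Proof. by rewrite /enorm dotpNl dotpNr opprK. Qed.

Lemma continuous_enorm : continuous (@enorm R m).
Proof.
have sd : smooth (fun x : X => dotp x x).
  by apply: smooth_sum => i; apply: smoothM; exact: smooth_coord.
move=> x; apply: (@continuous_comp _ _ _ (fun x : X => dotp x x) (@Num.sqrt R)).
  exact: smooth_continuous.
exact: sqrt_continuous.
Qed.

Lemma closed_enorm x (r : R) : closed [set y | enorm (y - x) <= r].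
Proof.
apply: (@closed_comp _ _ (fun y => enorm (y - x)) [set z | z <= r]); last exact: closed_le.
move=> y _; apply: (@continuous_comp _ _ _ (fun y : X => y - x) (@enorm R m)).
  by apply: continuousB; [move=> ?; exact: cvg_id|exact: cst_continuous].
exact: continuous_enorm.
Qed.

Definition cmoll e x : X -> C := fun y => Complex (moll e x y) 0.

Lemma ctestf_cmoll e x : 0 < e -> ctestf (cmoll e x).
Proof. by move=> e0; split; [exact: testf_moll|exact: testf0]. Qed.

Lemma cmoll_schwartz e x : 0 < e -> cmoll e x \in @schwartz_pred R m.
Proof. by move=> e0; apply/asboolP; exact/ctestf_schwartz/ctestf_cmoll. Qed.

Lemma compact_cmoll e x : 0 < e -> fun_supp (cmoll e x) `<=` [set y | enorm (y - x) < e] /\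
  compact (fun_supp (cmoll e x)).
Proof.
(* The closed Euclidean ball of this radius contains the closure of the support and lies inside the
   open ball of radius [e]. *)
move=> e0; pose r := e * (m%:R / m.+1%:R).
have sub : fun_supp (cmoll e x) `<=` [set y | enorm (y - x) <= r].
  rewrite /fun_supp closureE; apply: smallest_sub; first exact: closed_enorm.
  move=> y /= h; apply: moll_le => //; apply: contra_neq h => h.
  by rewrite /cmoll h.
split.
  move=> y /sub /= /le_lt_trans; apply.
  by rewrite -[ltRHS]mulr1 ltr_pM2l// ltr_pdivrMr ?mul1r ?ltr_nat.
apply: bounded_closed_compact; last exact: closed_closure.
apply: (@bounded_set_le _ _ _ (r + `|x|)) => y /sub /= yx.
rewrite -[y](subrK x) (le_trans (ler_normD _ _))// lerD2r.
exact: le_trans (norm_le_enorm _) yx.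
Qed.

Lemma transform_eval u f psi : is_fourier_transform u f -> ctestf psi ->
  u psi = cintegral (fun xi => f xi * inv_fourier psi xi).
Proof.
move=> [_ uf] tp.
have s : inv_fourier psi \in @schwartz_pred R m by apply/asboolP; exact: inv_fourier_schwartz.
by apply: (uf (Schwartz s) psi) => x /=; rewrite inv_fourierK.
Qed.

Lemma compact_supp_ctestf psi : compact (fun_supp psi) -> ctestf psi.
Proof.
move=> cK; have /asboolP[sr si _] := schwartzP psi.
have [r r0 h] := bounded_setP (compact_bounded cK).
have z x : r < `|x| -> psi x = 0.
  move=> xr; apply: contraTeq xr => px; rewrite -leNgt ltW//; apply: h.
  exact: subset_closure.
by split; (split; first by []); exists r => // x /z ->.
Qed.

Definition cutoff f e xi : C := f xi * Complex (chi (e *: xi)) 0.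

(* The convolution of the distribution with transform [f] and the mollifier at scale
   [e], see [mollifiedE]. *)
Definition mollified f e : X -> C := inv_fourier (cutoff f e).

Lemma cutoff_cint f e : wL2 f -> 0 < e -> cint (cutoff f e).
Proof. by move=> wf e0; have := wL2_schwartz wf (chi_schwartz m e0). Qed.

(** The inverse transform of the mollifier centred at [x] is [chi (e *: xi)] times a normalised
    phase, so both sides are the same integral against [f]. *)
Lemma mollifiedE u f e x (e0 : 0 < e) : is_fourier_transform u f -> wL2 f ->
  mollified f e x = u (Schwartz (cmoll_schwartz x e0)).
Proof.
move=> uf wf; rewrite (transform_eval uf)/=; last exact: ctestf_cmoll.
rewrite -[LHS]/(fourier (cutoff f e) (- x)) [LHS]/fourier -cintegralZ; last exact/cint_expi/cutoff_cint.
congr cintegral; apply/funext => xi.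
rewrite inv_fourierE; last exact: ctestf_cmoll.
rewrite (_ : Re \o _ = moll e x)// (_ : Im \o _ = fun=> 0)//.
have z : (fun=> 0) = (fun y : X => 0 * moll e x y) :> (X -> R) by apply/funext => y; rewrite mul0r.
have im := testf_integrable (testf_moll x e0).
rewrite z FcosZ// FsinZ// !mul0r Fcos_mollE// Fsin_mollE// subr0 add0r.
rewrite /cutoff dotpNl opprK -/(fc R m); case: (f xi) => a b.
by apply: complex_ext => /=; ring.
Qed.

(** Since [chi (e_ j *: xi)] is bounded by 1 and tends to 1, [|k|] dominates and the integral of [k]
    is a limit of zeros. *)
Lemma cutoff_limit k (e_ : nat -> R) : cint k -> e_ j @[j --> \oo] --> (0 : R) ->
  (forall j, cintegral (cutoff k (e_ j)) = 0) -> cintegral k = 0.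
Proof.
move=> [k1 k2] e0 H.
have mchi j : measurable_fun setT (fun xi : X => chi (e_ j *: xi)).
  have mc : measurable_fun setT (@chi R m).
    by apply: continuous_rV_measurable; exact/smooth_continuous/smooth_Fcos/testf_ci/testf_moll.
  apply: (measurableT_comp mc); apply: measurable_fun_rVP => i.
  under eq_fun do rewrite !mxE.
  by apply: measurable_funM => //; exact: measurable_coor.
have key (p : X -> R) : L1 p -> (forall j, \int[mu]_xi (p xi * chi (e_ j *: xi)) = 0) ->
    \int[mu]_xi p xi = 0.
  move=> ip pz.
  have := @Rdominated_cvg _ _ _ mu (fun j xi => p xi * chi (e_ j *: xi)) p (fun xi => `|p xi|).
  have mp := Rintegrable_measurable ip.
  have A n : measurable_fun setT (fun xi => p xi * chi (e_ n *: xi)) by exact: measurable_funM.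
  have B x : p x * chi (e_ n *: x) @[n --> \oo] --> p x.
    by rewrite -[X in _ --> X]mulr1; apply: cvgM; [exact: cvg_cst|exact: chi_cvg1].
  have D n x : `|p x * chi (e_ n *: x)| <= `|p x|.
    by rewrite normrM ler_piMr// chi_le1.
  move=> /(_ A mp B (integrable_norm ip) D).
  rewrite (_ : (fun n => _) = fun=> 0); last by apply/funext => n.
  by move/(cvg_unique _ (cvg_cst _)) => <-.
apply: complex_ext => /=.
- apply: key k1 _ => j; have [<- _] := H j; apply: eq_Rintegral => xi _.
  by rewrite cReM /= mulr0 subr0.
- apply: key k2 _ => j; have [_ <-] := H j; apply: eq_Rintegral => xi _.
  by rewrite cImM /= mulr0 add0r.
Qed.

(** Compactness in near-covering form, applied to the filter of small positive radii, makes the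
    radius uniform over [K]. *)
Lemma lebesgue_number u (K : set X) : compact K -> (forall x, K x -> ~ dist_supp u x) ->
  exists2 r : R, 0 < r & forall x, K x -> exists2 U, vanishes_on u U & ball x r `<=` U.
Proof.
move=> /compact_near_coveringP cK Ku.
pose P (r : R) y := exists2 U, vanishes_on u U & ball y r `<=` U.
have := cK R (at_right (0 : R)) P _.
have H x : K x -> \forall x' \near x & r \near 0^'+, P r x'.
  move=> /Ku; rewrite /dist_supp /= => /existsNP[U /not_implyP[oU /not_implyP[Ux /contrapT uU]]].
  have /nbhs_ballP[e /= e0 eU] := open_nbhs_nbhs (conj oU Ux).
  exists (ball x (e / 2), [set r : R | r < e / 2]) => /=.
    split; first by apply: nbhsx_ballx; rewrite divr_gt0.
    by apply: nbhs_right_lt; rewrite divr_gt0.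
  move=> [y r] /= [xy re]; exists U => // z yz; apply: eU.
  rewrite [e]splitr; apply: ball_triangle xy _; apply: le_ball yz; exact: ltW.
move=> /(_ _ H) near_r.
have : \forall r \near 0^'+, (0 : R) < r /\ K `<=` P r.
  by near=> r; split; [near: r; exact: nbhs_right_gt|near: r].
move=> /filter_ex[r [r0 KP]]; exists r => // x /KP.
Unshelve. all: by end_near. Qed.

(* The regularizations vanish on the support of [psi] once the mollifier is
   narrower than a Lebesgue number of the cover by sets where [u] vanishes, so
   no partition of unity is needed. *)
Lemma vanishes_off_supp u f psi : is_fourier_transform u f -> wL2 f ->
  compact (fun_supp psi) -> (forall x, fun_supp psi x -> ~ dist_supp u x) -> u psi = 0.
Proof.
move=> uf wf cK Ku; have tp := compact_supp_ctestf cK.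
have [r r0 rU] := lebesgue_number cK Ku.
rewrite (transform_eval uf tp).
apply: (@cutoff_limit _ (fun j => r * j.+1%:R^-1)).
- exact: wL2_schwartz wf (inv_fourier_schwartz tp).
- by rewrite -[X in _ --> X](mulr0 r); apply: cvgM; [exact: cvg_cst|exact: cvg_harmonic].
move=> j; set e := r * _.
have e0 : 0 < e by rewrite mulr_gt0// invr_gt0.
have er : e <= r by rewrite ler_piMr ?(ltW r0)// invf_le1// ler1n.
transitivity (cintegral (fun xi => cutoff f e xi * inv_fourier psi xi)).
  by congr cintegral; apply/funext => xi; rewrite /cutoff; ring.
rewrite -cmul_inv_fourier_swap; [|exact: cutoff_cint|exact: ctestf_cint].
rewrite (_ : (fun x => _) = fun=> 0).
  by apply: complex_ext; rewrite /= /Rintegral integral0.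
apply/funext => x; have [->|px] := eqVneq (psi x) 0; first by rewrite mulr0.
have Kx : fun_supp psi x by exact: subset_closure.
have [U uU xU] := rU _ Kx.
rewrite -/(mollified f e x) (mollifiedE x e0 uf wf) uU ?mul0r//.
  exact: (compact_cmoll x e0).2.
move=> y /(compact_cmoll x e0).1 /= yx; apply: xU.
rewrite -ball_normE /ball_/= distrC (le_lt_trans (norm_le_enorm _))//.
exact: lt_le_trans yx er.
Qed.

Lemma dist_to_le x y (A : set X) : A y -> dist_to x A <= enorm (x - y).
Proof.
move=> Ay; apply: ge_inf; last by exists y.
by exists 0 => _ [z _ <-]; exact: enorm_ge0.
Qed.

(** The value at [x] tests [u] against a function living at distance less than [e] from [x], where
    there is no point of [A]. *)
Lemma mollified_eq0 u f e x (A : set X) : 0 < e -> is_fourier_transform u f -> wL2 f ->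
  dist_supp u `<=` A -> ~ neighborhood A e x -> mollified f e x = 0.
Proof.
move=> e0 uf wf uA nx; rewrite (mollifiedE x e0 uf wf).
apply: (vanishes_off_supp uf wf); first exact: (compact_cmoll x e0).2.
move=> y /(compact_cmoll x e0).1 /= yx /uA Ay; apply: nx.
by rewrite /neighborhood/= (le_lt_trans (dist_to_le _ Ay))// -opprB enormN.
Qed.

End regularization.

(** * Norm bounds for mollifications *)

Section mollified_norms.
Context (R : realType) (m : nat).
Local Notation X := 'rV[R]_m.
Local Notation C := R[i].
Local Notation Re := (@complex.Re R).
Local Notation Im := (@complex.Im R).
Local Notation mu := (lebesgue_rV R m).
Local Notation L1 f := (mu.-integrable setT (EFin \o f)).
Implicit Types (f g h v : X -> C) (x y xi : X) (e t : R).

Lemma enormZ e x : enorm (e *: x) = `|e| * enorm x.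
Proof.
rewrite /enorm dotpZl dotpZr mulrA -expr2 sqrtrM ?sqr_ge0//.
by rewrite sqrtr_sqr.
Qed.

Lemma powR_anti (a b t : R) : 0 < a -> a <= b -> t <= 0 -> b `^ t <= a `^ t.
Proof.
move=> a0 ab t0; have b0 := lt_le_trans a0 ab.
have [s s0 ->] : exists2 s, 0 <= s & t = - s by exists (- t); rewrite ?oppr_ge0 ?opprK.
rewrite !powRN lef_pV2 ?posrE ?powR_gt0//.
by apply: ge0_ler_powR; rewrite // nnegrE ltW.
Qed.

Lemma normc_real (a : R) : normc (Complex a 0 : C) = `|a|.
Proof. by rewrite /= expr0n addr0 sqrtr_sqr. Qed.

Lemma cmeasurable_chi e : cmeasurable (fun xi : X => Complex (chi (e *: xi)) 0 : C).
Proof.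
split => /=; last exact: measurable_cst.
have mc : measurable_fun setT (@chi R m).
  by apply: continuous_rV_measurable; exact/smooth_continuous/smooth_Fcos/testf_ci/testf_moll.
apply: (measurableT_comp mc); apply: measurable_fun_rVP => i.
under eq_fun do rewrite !mxE.
by apply: measurable_funM => //; exact: measurable_coor.
Qed.

Lemma cmeasurable_cutoff f e : cmeasurable f -> cmeasurable (cutoff f e).
Proof. by move=> mf; apply: cmeasurableM => //; exact: cmeasurable_chi. Qed.

(** Pointwise, [chi (e xi)^2] is at most [K (1 + |e xi|^2)^-1], hence at most [K (1 + |e xi|^2)^t]
    as [-1 <= t]. With [t <= 0] and [e <= 1] this is bounded by [K (e^2 (1 + |xi|^2))^t], which is
    [K e^(2 t)] times the weight of order [t]. *)
Lemma cutoff_bound : exists2 K : R, 0 < K & forall e t f, 0 < e <= 1 -> -1 <= t <= 0 ->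
  cmeasurable f -> L1 (fun xi => wgt t xi * normc (f xi) ^+ 2) ->
  L1 (fun xi => normc (cutoff f e xi) ^+ 2) /\
  \int[mu]_xi normc (cutoff f e xi) ^+ 2 <=
    K * e `^ (2 * t) * \int[mu]_xi (wgt t xi * normc (f xi) ^+ 2).
Proof.
have [K K0 HK] := @chi_decay R m; exists K => // e t f /andP[e0 e1] /andP[t1 t0] mf fi.
have key xi : normc (cutoff f e xi) ^+ 2 <= K * e `^ (2 * t) * (wgt t xi * normc (f xi) ^+ 2).
  rewrite /cutoff normcM normc_real exprMn real_normK ?num_real// [leLHS]mulrC [leRHS]mulrA; apply: ler_wpM2r; first exact: sqr_ge0.
  have b1 := wgt_base_ge1 xi; have b0 : 0 < 1 + enorm xi ^+ 2 by exact: lt_le_trans b1.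
  have c1 := wgt_base_ge1 (e *: xi); have c0 : 0 < 1 + enorm (e *: xi) ^+ 2 by exact: lt_le_trans c1.
  have -> : K * e `^ (2 * t) * wgt t xi = K * (e ^+ 2 * (1 + enorm xi ^+ 2)) `^ t.
    rewrite powRM ?sqr_ge0 ?(ltW b0)// mulrA; congr (_ * _ * _).
    by rewrite powRrM powR_mulrn// ltW.
  apply: (@le_trans _ _ (K * (1 + enorm (e *: xi) ^+ 2)^-1)).
    by rewrite ler_pdivlMr.
  rewrite ler_pM2l//; apply: (@le_trans _ _ ((1 + enorm (e *: xi) ^+ 2) `^ t)).
    by rewrite -powR_inv1 ?(ltW c0)//; exact: ler_powR.
  apply: powR_anti => //; first by rewrite mulr_gt0// exprn_gt0.
  rewrite enormZ gtr0_norm// exprMn mulrDr mulr1 lerD2r.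
  by rewrite expr_le1// ltW.
have iK : L1 (fun xi => K * e `^ (2 * t) * (wgt t xi * normc (f xi) ^+ 2)) by exact: RintegrableZ.
have ic : L1 (fun xi => normc (cutoff f e xi) ^+ 2).
  apply: Rintegrable_le iK; last by move=> xi; rewrite ger0_norm ?sqr_ge0.
  by apply: measurable_funX; apply: measurable_normc; exact: cmeasurable_cutoff.
split => //; rewrite -RintegralZl//.
by apply: le_Rintegral => // xi _; exact: key.
Qed.

Lemma integrable_opp (g : X -> R) : L1 g -> L1 (fun x => g (- x)).
Proof.
have N1 : (-1 : R) != 0 by rewrite oppr_eq0 oner_neq0.
move=> ig; have := affine_integrable 0 N1 ig.
by congr (mu.-integrable _ _); apply/funext => x; rewrite /= scaleN1r addr0.
Qed.

Lemma mollified_L2 f e : cint (cutoff f e) -> L1 (fun xi => normc (cutoff f e xi) ^+ 2) ->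
  L1 (fun x => normc (mollified f e x) ^+ 2) /\
  \int[mu]_x normc (mollified f e x) ^+ 2 <= 2 * \int[mu]_xi normc (cutoff f e xi) ^+ 2.
Proof.
move=> ic ic2; have [i1 e1] := complex_bessel ic ic2.
by split; [exact: (integrable_opp i1)|rewrite -(Rintegral_opp i1) in e1].
Qed.

Lemma cmeasurable_mollified f e : cint (cutoff f e) -> cmeasurable (mollified f e).
Proof.
move=> /cmeasurable_fourier[m1 m2].
have mN : measurable_fun setT (fun x : X => - x).
  by have := @measurable_lin R m (-1) 0; under eq_fun do rewrite scaleN1r addr0.
by split; [exact: (measurableT_comp m1 mN)|exact: (measurableT_comp m2 mN)].
Qed.

(** An inverse transform is a priori only bounded; the bounded support makes it integrable, so that
    its own transform is an honest integral. *)
Lemma mollified_cint f e (A : set X) : cint (cutoff f e) -> bounded_set A ->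
  (forall x, ~ A x -> mollified f e x = 0) -> cint (mollified f e).
Proof.
move=> ic bA hA; have mv := cmeasurable_mollified ic.
have [r r0 Ar] := bounded_setP bA.
have supp x : r < `|x| -> mollified f e x = 0.
  by move=> xr; apply: hA => /Ar; rewrite ltNge ltW.
have B x : normc (mollified f e x) <= _ := normc_fourier_le (- x) ic.
split.
- apply: (bounded_support_integrable mv.1 (fun x => le_trans (Re_le_normc _) (B x))).
  by exists r => // x /supp z; rewrite -[LHS]/(Re (mollified f e x)) z.
- apply: (bounded_support_integrable mv.2 (fun x => le_trans (Im_le_normc _) (B x))).
  by exists r => // x /supp z; rewrite -[LHS]/(Im (mollified f e x)) z.
Qed.

Lemma cint_clocally_integrable f : cint f -> clocally_integrable f.
Proof.
move=> fi; split; first exact: cint_cmeasurable.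
move=> K cK; have [mK _] := compact_rV_bounded cK.
have fn := cint_integrable_normc fi.
have := integrableS measurableT mK (@subsetT _ K) fn => /integrableP[_].
by under eq_integral do rewrite /= ger0_norm ?normc_ge0//.
Qed.

(** Inversion is known for test functions only. Moving both transforms onto a test function reduces
    the claim to [fourierK], and testing determines the two sides a.e. *)
Lemma fourier_mollified f e : cint (cutoff f e) -> cint (mollified f e) ->
  {ae mu, forall xi, fourier (mollified f e) xi = cutoff f e xi}.
Proof.
move=> ic iv; apply: ae_unique_of_testf.
- apply: clocally_integrable_bounded (fun x => normc_fourier_le x iv).
  exact: cmeasurable_fourier.
- exact: cint_clocally_integrable.
move=> p tp; have tp0 : ctestf (fun x => Complex (p x) 0 : C) by split => //; exact: testf0.
rewrite -(cmul_fourier_swap iv (ctestf_cint tp0)) /mollified.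
rewrite (cmul_inv_fourier_swap ic (schwartz_cint (fourier_schwartz tp0))).
by rewrite fourierK.
Qed.

Lemma cutoff_cvg f (e_ : nat -> R) : wL2 f -> e_ j @[j --> \oo] --> (0 : R) ->
  (forall j, wL2 (fun xi => cutoff f (e_ j) xi - f xi)) /\
  wnorm2 (fun xi => cutoff f (e_ j) xi - f xi) @[j --> \oo] --> (0 : R).
Proof.
move=> [mf fi] e0.
have E j xi : normc (cutoff f (e_ j) xi - f xi) = normc (f xi) * `|chi (e_ j *: xi) - 1|.
  rewrite -normc_real -normcM; congr normc; rewrite /cutoff.
  by case: (f xi) => a b; apply: complex_ext => /=; ring.
have md j : cmeasurable (fun xi => cutoff f (e_ j) xi - f xi).
  by apply: cmeasurableB => //; exact: cmeasurable_cutoff.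
have mw j : measurable_fun setT (fun xi => hweight xi * normc (cutoff f (e_ j) xi - f xi) ^+ 2).
  apply: measurable_funM; first exact: measurable_wgt.
  by apply: measurable_funX; exact: measurable_normc.
have w0 (xi : X) : 0 <= hweight xi by exact/ltW/wgt_gt0.
(* The factor 4 is the square of the bound 2 for [|chi - 1|]. *)
have bd j xi : `|hweight xi * normc (cutoff f (e_ j) xi - f xi) ^+ 2| <=
    4 * (hweight xi * normc (f xi) ^+ 2).
  rewrite ger0_norm; last by rewrite mulr_ge0// sqr_ge0.
  rewrite [leRHS]mulrCA E exprMn [_ ^+ 2 * `|_| ^+ 2]mulrC.
  apply: ler_wpM2l => //; apply: ler_wpM2r; first exact: sqr_ge0.
  have -> : 4 = 2 ^+ 2 :> R by rewrite -natrX.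
  rewrite lerXn2r ?nnegrE// (le_trans (ler_normB _ _))// normr1.
  have := chi_le1 (e_ j *: xi); lra.
have i4 : L1 (fun xi => 4 * (hweight xi * normc (f xi) ^+ 2)) by exact: RintegrableZ.
split; first by move=> j; split => //; exact: Rintegrable_le (bd j) i4.
have := Rdominated_cvg mw _ _ i4 bd; move=> /(_ (fun=> 0)).
rewrite /Rintegral integral0 /=; apply; first exact: measurable_cst.
move=> xi.
have A : normc (f xi) * `|chi (e_ j *: xi) - 1| @[j --> \oo] --> (0 : R).
  rewrite -[X in _ --> X](mulr0 (normc (f xi))); apply: cvgM; first exact: cvg_cst.
  rewrite -[X in _ --> X](@normr0 R R); apply: cvg_norm.
  rewrite -[X in _ --> X](subrr (1 : R)); apply: cvgB; last exact: cvg_cst.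
  exact: chi_cvg1.
have -> : (fun j => hweight xi * normc (cutoff f (e_ j) xi - f xi) ^+ 2) =
  (fun j => hweight xi * ((normc (f xi) * `|chi (e_ j *: xi) - 1|) * (normc (f xi) * `|chi (e_ j *: xi) - 1|))).
  by apply/funext => j; rewrite E expr2.
rewrite -[X in _ --> X](mulr0 (hweight xi)); apply: cvgM; first exact: cvg_cst.
by rewrite -[X in _ --> X](mulr0 (0 : R)); exact: cvgM.
Qed.

End mollified_norms.

(** * Piecewise constant approximation and Mosco convergence *)

Section mesh_approximation.
Context (R : realType) (m : nat).
Local Notation X := 'rV[R]_m.
Local Notation C := R[i].
Local Notation Re := (@complex.Re R).
Local Notation Im := (@complex.Im R).
Local Notation mu := (lebesgue_rV R m).
Local Notation L1 f := (mu.-integrable setT (EFin \o f)).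
Implicit Types (f g h v : X -> C) (x y xi : X).

Lemma convex_hull_segment (A : set X) x y (s : R) : A x -> A y -> 0 <= s <= 1 ->
  convex_hull A (x + s *: (y - x)).
Proof.
move=> Ax Ay /andP[s0 s1] K [cK AK].
have := cK y x (Itv01 s0 s1); rewrite !inE => /(_ (AK _ Ay) (AK _ Ax)).
rewrite -[conv _ _ _]/(s *: y + (1 - s) *: x) scalerBl scale1r => h.
rewrite (_ : x + _ = s *: y + (x - s *: x)) ?inE//.
by rewrite scalerBr addrCA.
Qed.

(* An open subset of the convex hull, hence measurable. *)
Definition segments (A : set X) : set X :=
  [set z | exists x y (s : R), [/\ A x, A y, 0 <= s <= 1 & z = x + s *: (y - x)]].

(** Moving both endpoints by the same small vector translates the whole segment, so a point near [z]
    lies on a translated segment. *)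
Lemma open_segments (A : set X) : open A -> open (segments A).
Proof.
move=> oA; rewrite openE => z [x [y [s [Ax Ay s01 ->]]]].
have /nbhs_ballP[e1 /= e10 h1] := open_nbhs_nbhs (conj oA Ax).
have /nbhs_ballP[e2 /= e20 h2] := open_nbhs_nbhs (conj oA Ay).
apply/nbhs_ballP; exists (Num.min e1 e2); first by rewrite /= lt_min e10.
move=> w; rewrite -ball_normE /ball_/= => zw.
pose d := w - (x + s *: (y - x)).
have nd : `|d| < Num.min e1 e2 by rewrite /d distrC.
have bd u e : `|d| < e -> ball u e (u + d).
  by move=> de; rewrite -ball_normE /ball_/= opprD addNKr normrN.
exists (x + d), (y + d), s; split => //.
- by apply: h1; apply: bd; apply: lt_le_trans nd _; rewrite ge_min lexx.
- by apply: h2; apply: bd; apply: lt_le_trans nd _; rewrite ge_min lexx orbT.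
by rewrite opprD addrACA subrr addr0 addrAC /d addrC subrK.
Qed.

Lemma segments_sub_hull (A : set X) : segments A `<=` convex_hull A.
Proof. by move=> _ [x [y [s [Ax Ay s01 ->]]]]; exact: convex_hull_segment. Qed.

Lemma enorm_le_diam (A : set X) x y : bounded_set A -> A x -> A y -> enorm (x - y) <= diam A.
Proof.
move=> /bounded_setP[r r0 Ar] Ax Ay; apply: ub_le_sup; last by exists x, y.
exists (m%:R * (r + r)) => _ [a [b [Aa Ab ->]]].
rewrite (le_trans (enorm_le_norm _))// ler_wpM2l// (le_trans (ler_normB _ _))//.
by rewrite lerD// ltW// Ar.
Qed.

Lemma eq_ae_Rintegral (f g : X -> R) : measurable_fun setT f -> measurable_fun setT g ->
  {ae mu, forall x, f x = g x} -> \int[mu]_x f x = \int[mu]_x g x.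
Proof.
move=> mf mg fg; rewrite /Rintegral; congr fine; apply: ae_eq_integral => //.
- exact/measurable_EFinP.
- exact/measurable_EFinP.
- by apply: filterS fg => x -> _.
Qed.

Lemma ae_integrable (f g : X -> R) : measurable_fun setT f -> L1 g ->
  {ae mu, forall x, f x = g x} -> L1 f.
Proof.
move=> mf ig fg; have mg := Rintegrable_measurable ig.
apply/integrableP; split; first exact/measurable_EFinP.
have /integrableP[_] := ig; congr (_ < _)%E; apply: ae_eq_integral => //.
- by apply: measurableT_comp => //; exact/measurable_EFinP.
- by apply: measurableT_comp => //; exact/measurable_EFinP.
- by apply: filterS fg => x /= -> _.
Qed.

Lemma ae_cintegral f g : cmeasurable f -> cmeasurable g -> {ae mu, forall x, f x = g x} ->
  cintegral f = cintegral g.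
Proof.
move=> [f1 f2] [g1 g2] fg; apply: complex_ext => /=; apply: eq_ae_Rintegral => //.
- by apply: filterS fg => x ->.
- by apply: filterS fg => x ->.
Qed.

Lemma cmeasurable_expi xi : cmeasurable (fun x : X => Complex (cos (- dotp xi x)) (sin (- dotp xi x)) : C).
Proof.
split => /=.
- rewrite (_ : _ \o _ = fun x => cos (dotp x xi)); first exact: measurable_cos_dotp.
  by apply/funext => x /=; rewrite cosN dotpC.
- rewrite (_ : _ \o _ = fun x => - sin (dotp x xi)).
    by apply: measurableT_comp => //; exact: measurable_sin_dotp.
  by apply/funext => x /=; rewrite sinN dotpC.
Qed.

Lemma ae_fourier f g xi : cmeasurable f -> cmeasurable g -> {ae mu, forall x, f x = g x} ->
  fourier f xi = fourier g xi.
Proof.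
move=> mf mg fg; rewrite /fourier; congr (_ * _); apply: ae_cintegral.
- by apply: cmeasurableM => //; exact: cmeasurable_expi.
- by apply: cmeasurableM => //; exact: cmeasurable_expi.
- by apply: filterS fg => x ->.
Qed.

Lemma fourierB f g xi : cint f -> cint g ->
  fourier (fun x => f x - g x) xi = fourier f xi - fourier g xi.
Proof.
move=> fi gi; rewrite /fourier -mulrBr -cintegralB; [|exact: cint_expi|exact: cint_expi].
by congr (_ * cintegral _); apply/funext => x; rewrite mulrBr.
Qed.

Variables (Omega : set X) (M : preconvex_mesh Omega).
Hypothesis Omega_bounded : bounded_set Omega.

Let T l := mesh_cell (p := M) l.

Lemma measurable_cell l : measurable (T l).
Proof. by apply: open_rV_measurable; exact: mesh_cell_open. Qed.

Lemma cell_bounded l : bounded_set (T l).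
Proof.
have [r r0 h] := bounded_setP Omega_bounded.
by apply: (@bounded_set_le _ _ _ r) => x /mesh_cell_sub/h/ltW.
Qed.

Lemma cell_gt0 l : (0 < mu (T l))%E.
Proof. by apply: open_measure_gt0; [exact: mesh_cell_open|exact: mesh_cell_nonempty]. Qed.

Lemma cell_fin l : (mu (T l) < +oo)%E.
Proof. by apply: bounded_finite_measure; [exact: measurable_cell|exact: cell_bounded]. Qed.

Lemma cell_diam l x y : T l x -> T l y -> enorm (x - y) <= mesh_size M.
Proof.
move=> Tx Ty; rewrite (le_trans (enorm_le_diam (cell_bounded l) Tx Ty))//.
exact: (le_bigmax _ (fun l => diam (T l))).
Qed.

Lemma cell_segments_disj k l x : segments (T k) x -> segments (T l) x -> k = l.
Proof.
move=> /segments_sub_hull kx /segments_sub_hull lx; apply/eqP; apply/negPn/negP => kl.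
have := mesh_hull_disjoint kl; rewrite -subset0 => /(_ x); apply; split.
- exact: kx.
- exact: lx.
Qed.

Lemma cell_disj k l x : T k x -> T l x -> k = l.
Proof.
move=> kx lx; apply: (@cell_segments_disj _ _ x).
- by exists x, x, 0; rewrite subrr scaler0 addr0 lexx ler01.
- by exists x, x, 0; rewrite subrr scaler0 addr0 lexx ler01.
Qed.

(** A point of [Omega] lies in the closure of some cell; what the open cells miss is contained in
    the finitely many null boundaries. *)
Lemma ae_cells : {ae mu, forall x, Omega x -> exists l, T l x}.
Proof.
have H l : {ae mu, forall x, ~ (closure (T l) `\` (T l)°) x}.
  exists (closure (T l) `\` (T l)°); split.
  - apply: measurableD; last by apply: open_rV_measurable; exact: open_interior.
    rewrite -[closure _]setCK; apply: measurableC; apply: open_rV_measurable.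
    by apply: closed_openC; exact: closed_closure.
  - exact: mesh_boundary_null.
  - by move=> x /= /contrapT.
have HH : {ae mu, forall x, forall l, ~ (closure (T l) `\` (T l)°) x} by exact: filter_forall H.
apply: filterS HH => x Hx.
rewrite {1}(mesh_cover M) => /interior_subset[l _ cl]; exists l.
apply: contrapT => nT; apply: (Hx l); split; first exact: cl.
by move=> /interior_subset.
Qed.

Definition mesh_average (k : X -> R) x : R := \sum_l cell_mean (T l) k * \1_(T l) x.

Definition cmesh_average v x : C :=
  Complex (mesh_average (fun y => Re (v y)) x) (mesh_average (fun y => Im (v y)) x).

Lemma cell_sumE (b : 'I_(mesh_card M) -> R) l x : T l x -> \sum_k b k * \1_(T k) x = b l.
Proof.
move=> Tl; rewrite (bigD1 l)//= indicE mem_set// mulr1 big1 ?addr0// => k kl.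
by rewrite indicE memNset ?mulr0// => Tk; move: kl; rewrite (cell_disj Tk Tl) eqxx.
Qed.

Lemma cell_sum0 (b : 'I_(mesh_card M) -> R) x : ~ Omega x -> \sum_k b k * \1_(T k) x = 0.
Proof.
by move=> nx; rewrite big1// => k _; rewrite indicE memNset ?mulr0// => /mesh_cell_sub.
Qed.

Lemma measurable_cell_sum (b : 'I_(mesh_card M) -> R) :
  measurable_fun setT (fun x => \sum_k b k * \1_(T k) x).
Proof.
apply: measurable_sum => k; apply: measurable_funM => //.
by apply: measurable_indic; exact: measurable_cell.
Qed.

Lemma cell_sum_ci (b : 'I_(mesh_card M) -> R) :
  compactly_integrable (fun x => \sum_k b k * \1_(T k) x) /\
  forall x, `|\sum_k b k * \1_(T k) x| <= \sum_k `|b k|.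
Proof.
have bd x : `|\sum_k b k * \1_(T k) x| <= \sum_k `|b k|.
  rewrite (le_trans (ler_norm_sum _ _ _))//; apply: ler_sum => k _.
  by rewrite normrM ler_piMr// ger0_norm// indicE; case: (x \in _).
have bs : bounded_support (fun x => \sum_k b k * \1_(T k) x).
  have [r r0 h] := bounded_setP Omega_bounded; exists r => // x rx.
  by apply: cell_sum0 => /h; rewrite ltNge ltW.
by split => //; split => //; exact: bounded_support_integrable (measurable_cell_sum b) bd bs.
Qed.

(* A member of the discrete space agrees a.e. with a combination of indicators of
   cells; it is arbitrary on the null set not covered by the cells. *)
Lemma piecewise_constantP (u : sdist R m) : piecewise_constant M u ->
  exists g, [/\ cint g, L1 (fun x => normc (g x) ^+ 2), forall x, ~ Omega x -> g x = 0 &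
    u = regular_dist g].
Proof.
move=> [f [mf fc f0 ->]].
pose c k := f (xget 0 (T k)).
have cE k x : T k x -> f x = c k.
  by move=> Tx; apply: (fc k) => //; exact: (xgetPex 0 (ex_intro _ x Tx)).
pose a x := \sum_k Re (c k) * \1_(T k) x; pose b x := \sum_k Im (c k) * \1_(T k) x.
have [ca aB] := cell_sum_ci (fun k => Re (c k)); have [cb bB] := cell_sum_ci (fun k => Im (c k)).
pose g x := Complex (a x) (b x).
have ig : cint g by split; [exact: ca.1|exact: cb.1].
exists g; split => //.
- have i1 := ci_sqr_integrable ca aB; have i2 := ci_sqr_integrable cb bB.
  have := RintegrableD i1 i2; congr (mu.-integrable _ _).
  by apply/funext => x; rewrite -[RHS]/((normc (g x) ^+ 2)%:E) normc_sqr.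
- by move=> x nx; rewrite /g /a /b !cell_sum0.
apply/funext => phi; apply: ae_cintegral.
- by apply: cmeasurableM => //; apply: schwartz_cmeasurable; exact/asboolP/schwartzP.
- apply: cmeasurableM; first exact: cint_cmeasurable.
  by apply: schwartz_cmeasurable; exact/asboolP/schwartzP.
apply: filterS ae_cells => x Hx; congr (_ * _).
have [/Hx[l Tl]|nx] := pselect (Omega x); last by rewrite f0// /g /a /b !cell_sum0.
by rewrite (cE l)// /g /a /b !(cell_sumE _ Tl); case: (c l).
Qed.

Lemma cmesh_average_piecewise v : piecewise_constant M (regular_dist (cmesh_average v)).
Proof.
exists (cmesh_average v); split => //.
- by split; exact: measurable_cell_sum.
- by move=> l x y Tx Ty; rewrite /cmesh_average /mesh_average !(cell_sumE _ Tx) !(cell_sumE _ Ty).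
- by move=> x nx; rewrite /cmesh_average /mesh_average !cell_sum0.
Qed.

Lemma cmesh_average_cint v : cint (cmesh_average v).
Proof. by split; exact: (cell_sum_ci _).1.1. Qed.

Lemma cmesh_average_L2 v : L1 (fun x => normc (cmesh_average v x) ^+ 2).
Proof.
have [ca aB] := cell_sum_ci (fun l => cell_mean (T l) (fun y => Re (v y))).
have [cb bB] := cell_sum_ci (fun l => cell_mean (T l) (fun y => Im (v y))).
have := RintegrableD (ci_sqr_integrable ca aB) (ci_sqr_integrable cb bB).
congr (mu.-integrable _ _); apply/funext => x.
by rewrite -[RHS]/((normc (cmesh_average v x) ^+ 2)%:E) normc_sqr.
Qed.

Lemma fluctuation_ae (k : X -> R) : (forall x, ~ Omega x -> k x = 0) ->
  {ae mu, forall x, fluctuation T k x = k x - mesh_average k x}.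
Proof.
move=> k0; apply: filterS ae_cells => x Hx.
have [/Hx[l Tl]|nx] := pselect (Omega x).
  rewrite /fluctuation /oscillation /mesh_average (cell_sumE _ Tl).
  by rewrite (cell_sumE (fun l => k x - cell_mean (T l) k) Tl).
rewrite /fluctuation /oscillation /mesh_average k0// (cell_sum0 _ nx).
by rewrite (cell_sum0 (fun l => 0 - cell_mean (T l) k) nx) subr0.
Qed.

Lemma mesh_dual_estimate (k : X -> R) (d : R) : 0 < d -> mesh_size M <= d ->
  L1 k -> L1 (fun x => k x ^+ 2) ->
  let q xi := Fcos (fluctuation T k) xi ^+ 2 + Fsin (fluctuation T k) xi ^+ 2 in
  L1 (fun xi => hweight xi * q xi) /\
  \int[mu]_xi (hweight xi * q xi) <= (4 * pi) ^+ m * d * \int[mu]_x k x ^+ 2.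
Proof.
move=> d0 Md ik ik2 q.
have Td l x y : T l x -> T l y -> enorm (x - y) <= d.
  by move=> Tx Ty; exact: le_trans (cell_diam Tx Ty) Md.
have mU l : measurable (segments (T l)).
  by apply: open_rV_measurable; apply: open_segments; exact: mesh_cell_open.
have TU l x y (s : R) : T l x -> T l y -> 0 <= s <= 1 -> segments (T l) (x + s *: (y - x)).
  by move=> Tx Ty s01; exists x, y, s.
have ifl := fluctuation_integrable measurable_cell cell_fin ik.
have [ifl2 le2] := fluctuation_sqr_integrable measurable_cell cell_gt0 cell_fin TU cell_segments_disj ik ik2.
have := dual_estimate d0 ifl ifl2.
have E : forall (G : X -> R) (B la : R), 0 < la -> smooth G -> (forall x, `|G x| <= B) ->
    L1 (gradsq G) -> \int[mu]_x (fluctuation T k x * G x) <=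
    la / 2 * \int[mu]_x fluctuation T k x ^+ 2 + 2 ^+ m * d ^+ 2 / (4 * la) * \int[mu]_x gradsq G x.
  move=> G B la la0 sG GB iG.
  exact: (fluctuation_estimate d0 measurable_cell mU cell_gt0 cell_fin Td TU cell_segments_disj ik ik2 la0 sG GB iG).
move=> /(_ E)[h1 h2]; split => //; apply: (le_trans h2).
by rewrite ler_wpM2l// mulr_ge0 ?(ltW d0)// exprn_ge0// mulr_ge0// pi_ge0.
Qed.

(** The first two factors come from [normc_fourier_sqr_le], the last one from [dual_estimate]. *)
Definition mesh_const : R := 2 * (2 * pi) ^- m * (4 * pi) ^+ m.

(** Up to sign and a null set the error is the fluctuation of [v] over the mesh;
    [mesh_dual_estimate] is applied to its real and imaginary parts separately. *)
Lemma mesh_approximation v (d : R) : 0 < d -> mesh_size M <= d ->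
  cint v -> L1 (fun x => normc (v x) ^+ 2) -> (forall x, ~ Omega x -> v x = 0) ->
  wL2 (fun xi => fourier (cmesh_average v) xi - fourier v xi) /\
  wnorm2 (fun xi => fourier (cmesh_average v) xi - fourier v xi) <=
    mesh_const * d * \int[mu]_x normc (v x) ^+ 2.
Proof.
move=> d0 Md iv iv2 v0; have [i1 i2] := iv; have [j1 j2] := cint_sqr (cint_cmeasurable iv) iv2.
pose g x := Complex (fluctuation T (fun y => Re (v y)) x) (fluctuation T (fun y => Im (v y)) x).
have ig : cint g by split; [exact: (fluctuation_integrable measurable_cell cell_fin i1)|exact: (fluctuation_integrable measurable_cell cell_fin i2)].
have ia := cmesh_average_cint v.
have gE : {ae mu, forall x, g x = v x - cmesh_average v x}.
  have r0 : forall x, ~ Omega x -> Re (v x) = 0 by move=> x /v0 ->.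
  have s0 : forall x, ~ Omega x -> Im (v x) = 0 by move=> x /v0 ->.
  apply: filterS2 (fluctuation_ae r0) (fluctuation_ae s0) => x e1 e2.
  by apply: complex_ext; rewrite ?cReD ?cImD ?cReN ?cImN /= ?e1 ?e2.
have FE xi : fourier (cmesh_average v) xi - fourier v xi = - fourier g xi.
  rewrite (ae_fourier xi (cint_cmeasurable ig) _ gE); last exact/cmeasurableB/cint_cmeasurable/ia/cint_cmeasurable.
  by rewrite fourierB// opprB.
have nE xi : normc (fourier (cmesh_average v) xi - fourier v xi) = normc (fourier g xi).
  by rewrite FE; case: (fourier g xi) => a b /=; rewrite !sqrrN.
pose q1 xi := Fcos (fluctuation T (fun y => Re (v y))) xi ^+ 2 + Fsin (fluctuation T (fun y => Re (v y))) xi ^+ 2.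
pose q2 xi := Fcos (fluctuation T (fun y => Im (v y))) xi ^+ 2 + Fsin (fluctuation T (fun y => Im (v y))) xi ^+ 2.
have [k1 l1] : L1 (fun xi => hweight xi * q1 xi) /\ \int[mu]_xi (hweight xi * q1 xi) <= _ := mesh_dual_estimate d0 Md i1 j1.
have [k2 l2] : L1 (fun xi => hweight xi * q2 xi) /\ \int[mu]_xi (hweight xi * q2 xi) <= _ := mesh_dual_estimate d0 Md i2 j2.
have K xi : hweight xi * normc (fourier (cmesh_average v) xi - fourier v xi) ^+ 2 <=
    2 * (2 * pi) ^- m * (hweight xi * q1 xi + hweight xi * q2 xi).
  rewrite nE -mulrDr [leRHS]mulrCA ler_wpM2l ?(ltW (wgt_gt0 _ _))//.
  exact: normc_fourier_sqr_le.
have mF : cmeasurable (fun xi => fourier (cmesh_average v) xi - fourier v xi).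
  by apply: cmeasurableB; exact: cmeasurable_fourier.
have iK : L1 (fun xi => 2 * (2 * pi) ^- m * (hweight xi * q1 xi + hweight xi * q2 xi)).
  exact: (RintegrableZ _ (RintegrableD k1 k2)).
have iF : L1 (fun xi => hweight xi * normc (fourier (cmesh_average v) xi - fourier v xi) ^+ 2).
  apply: Rintegrable_le iK.
    apply: measurable_funM; first exact: measurable_wgt.
    by apply: measurable_funX; exact: measurable_normc.
  by move=> xi; rewrite ger0_norm ?K// mulr_ge0 ?sqr_ge0 ?normc_ge0 ?(ltW (wgt_gt0 _ _)).
split => //; apply: (le_trans (le_Rintegral measurableT iF iK (fun xi _ => K xi))).
have k12 := RintegrableD k1 k2.
have -> : \int[mu]_xi (2 * (2 * pi) ^- m * (hweight xi * q1 xi + hweight xi * q2 xi)) =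
    2 * (2 * pi) ^- m * (\int[mu]_xi (hweight xi * q1 xi) + \int[mu]_xi (hweight xi * q2 xi)).
  by rewrite -(RintegralD measurableT k1 k2); exact: RintegralZl.
rewrite /mesh_const -!mulrA ler_wpM2l// ler_wpM2l//.
  by rewrite invr_ge0 exprn_ge0// mulr_ge0// pi_ge0.
apply: (le_trans (lerD l1 l2)); rewrite -mulrDr -mulrA ler_wpM2l ?exprn_ge0 ?mulr_ge0 ?pi_ge0//.
rewrite ler_wpM2l ?(ltW d0)// -RintegralD//.
by apply: le_Rintegral => //; [exact: RintegrableD|move=> x _; rewrite normc_sqr].
Qed.

End mesh_approximation.

(** * Weak limits and recovery sequences *)

Section mosco_ingredients.
Context (R : realType) (m : nat).
Local Notation X := 'rV[R]_m.
Local Notation C := R[i].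
Local Notation Re := (@complex.Re R).
Local Notation Im := (@complex.Im R).
Local Notation mu := (lebesgue_rV R m).
Local Notation L1 f := (mu.-integrable setT (EFin \o f)).
Local Notation S := (schwartz R m).
Local Notation H := (@sobolev R m (- (1 / 2))).
Local Notation nrm := (@sobolev_norm R m (- (1 / 2))).
Implicit Types (f g h : X -> C) (x y xi : X) (u v w : sdist R m).

Lemma wL2_fourier g : cint g -> L1 (fun x => normc (g x) ^+ 2) -> wL2 (fourier g).
Proof.
move=> ig ig2; have [i1 _] := complex_bessel ig ig2; have mF := cmeasurable_fourier ig.
split => //; apply: Rintegrable_le i1.
  apply: measurable_funM; first exact: measurable_wgt.
  by apply: measurable_funX; exact: measurable_normc.
move=> xi; have w0 := ltW (wgt_gt0 (- (1 / 2)) xi).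
rewrite ger0_norm; last by rewrite mulr_ge0 ?sqr_ge0.
rewrite ler_piMl ?sqr_ge0//; apply: wgt_le1; lra.
Qed.

Lemma sobolev_regular g : cint g -> L1 (fun x => normc (g x) ^+ 2) -> H (regular_dist g).
Proof.
move=> ig ig2; have tg := fourier_is_transform ig; split.
- exact: regular_dist_tempered.
- by exists (fourier g).
- rewrite (sobolev_sqnormE _ tg); have [_ ih] := wL2_fourier ig ig2.
  by rewrite -EFin_Rintegral// ltry.
Qed.

Lemma sobolev_wL2 u : H u -> exists2 f, is_fourier_transform u f & wL2 f.
Proof. by move=> /sobolev_transform[f [uf mf fi]]; exists f. Qed.

Lemma wnorm2_ae f g : cmeasurable f -> wL2 g -> {ae mu, forall xi, f xi = g xi} ->
  wL2 f /\ wnorm2 f = wnorm2 g.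
Proof.
move=> mf [mg ig] fg.
have mh h : cmeasurable h -> measurable_fun setT (fun xi => hweight xi * normc (h xi) ^+ 2).
  move=> ?; apply: measurable_funM; first exact: measurable_wgt.
  by apply: measurable_funX; exact: measurable_normc.
split; first by split => //; apply: ae_integrable ig _; [exact: mh|apply: filterS fg => xi ->].
apply: eq_ae_Rintegral; [exact: mh|exact: mh|by apply: filterS fg => xi ->].
Qed.

Lemma wL2B f g : wL2 f -> wL2 g -> wL2 (fun xi => f xi - g xi).
Proof.
move=> wf wg; apply: (wnorm2D_le wf wg _ _).1.
  by apply: cmeasurableB; [exact: wf.1|exact: wg.1].
move=> xi; rewrite (le_trans (le_normcD _ _))// lerD2l.
by case: (g xi) => a b /=; rewrite !sqrrN.
Qed.

Lemma nrmBE u v f g : is_fourier_transform u f -> wL2 f -> is_fourier_transform v g -> wL2 g ->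
  nrm (u - v) = Num.sqrt (wnorm2 (fun xi => f xi - g xi)).
Proof.
move=> uf wf vg wg; rewrite (@sobolev_normE _ _ _ (fun xi => f xi - g xi))//.
  exact: transformB.
exact: wL2B.
Qed.

(** Optimising the parameter in [schwartz_pairing] turns its quadratic bound into one that is linear
    in the norm. *)
Lemma bounded_evaluation (psi : S) : ctestf psi -> bounded_functional H nrm (fun u => u psi).
Proof.
move=> tp; split; first by [].
have [P HP] := schwartz_pairing (inv_fourier_schwartz tp).
exists (2 * (1 + `|P|)) => u Hu; have [f uf wf] := sobolev_wL2 Hu.
rewrite (sobolev_normE uf wf) (transform_eval uf tp).
have [ci bd] := HP _ wf; have N0 := wnorm2_ge0 f.
set I := normc _.
have IP la : 0 < la -> I <= 2 * (la * wnorm2 f + `|P| / la).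
  move=> la0; rewrite (le_trans (normc_cintegral_le ci))// ler_wpM2l//.
  by rewrite (le_trans (bd la la0))// lerD2l ler_wpM2r ?invr_ge0 ?(ltW la0)// ler_norm.
have [N1|N1] := ltP 0 (wnorm2 f).
  have s0 : 0 < Num.sqrt (wnorm2 f) by rewrite sqrtr_gt0.
  (* The parameter 1 over the norm makes the first term equal to the norm and the second [|P|] times
     the norm. *)
  have := IP (Num.sqrt (wnorm2 f))^-1; rewrite invr_gt0 => /(_ s0) /le_trans; apply.
  rewrite invrK -{2}[wnorm2 f]sqr_sqrtr// expr2 mulKf ?gt_eqF//.
  by rewrite -mulrA ler_wpM2l// mulrDl mul1r.
have N00 : wnorm2 f = 0 by apply/le_anti; rewrite N1.
rewrite N00 sqrtr0 mulr0 leNgt; apply/negP => I0.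
(* For zero norm any large parameter will do; this one makes the right-hand side strictly smaller
   than [I]. *)
have := IP ((2 * `|P| + 1) / I); rewrite N00 mulr0 add0r => /(_ _).
have P1 : 0 < 2 * `|P| + 1 by rewrite ltr_wpDl// mulr_ge0.
rewrite divr_gt0// => /(_ isT); apply/negP; rewrite -ltNge invf_div mulrA mulrCA.
by rewrite gtr_pMr// ltr_pdivrMr// mul1r ltrDl.
Qed.

Lemma dist_supp_weak_limit (Gamma : set X) (Gamma_ : nat -> set X) (eta : nat -> R)
    (W_ : nat -> set (sdist R m)) (sub : nat -> nat) (w_ : nat -> sdist R m) w :
  Gamma !=set0 -> compact Gamma -> (forall j, Gamma_ j `<=` neighborhood Gamma (eta j)) ->
  eta j @[j --> \oo] --> (0 : R) ->
  (forall j u, W_ j u -> exists g, [/\ cint g, L1 (fun x => normc (g x) ^+ 2),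
     forall x, ~ Gamma_ j x -> g x = 0 & u = regular_dist g]) ->
  {homo sub : i j / (i < j)%N} -> (forall j, W_ (sub j) (w_ j)) ->
  weak_cvg H nrm w_ w -> dist_supp w `<=` Gamma.
Proof.
move=> G0 cG Geta eta0 HW hsub Wsub ww x wx; apply: contrapT => nGx.
have oG : open (~` Gamma) by apply: closed_openC; exact: compact_closed (@norm_hausdorff _ _) cG.
have /nbhs_ballP[r /= r0 rG] := open_nbhs_nbhs (conj oG nGx).
have r20 : 0 < r / 2 by rewrite divr_gt0.
apply: (wx (ball x (r / 2))); [exact: ball_open|exact: ballxx|move=> psi cK Kx].
have tp := compact_supp_ctestf cK.
(* Halving the radius keeps the test function at distance at least [r / 2] from [Gamma], beyond the
   reach of [eta j] for large [j]. *)
have dist_far y : ball x (r / 2) y -> r / 2 <= dist_to y Gamma.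
  move=> xy; apply: lb_le_inf; first by have [z Gz] := G0; exists (enorm (y - z)), z.
  move=> _ [z Gz <-]; apply: le_trans (norm_le_enorm _); rewrite leNgt; apply/negP => yz.
  apply: (rG z) Gz; rewrite [r]splitr; apply: ball_triangle xy _.
  by rewrite -ball_normE.
(* Strict monotonicity of the subsequence lets eventual statements about [eta j] pass to
   [eta (sub j)]. *)
have sub_ge j : (j <= sub j)%N.
  by elim: j => // j IH; apply: (leq_ltn_trans IH); exact: hsub.
have ev : \forall j \near \oo, w_ j psi = 0.
  have : \forall j \near \oo, eta j < r / 2.
    by have := eta0 => /cvgr_lt; apply.
  move=> [N _ HN]; exists N => // j /= Nj.
  have ej : eta (sub j) < r / 2 by apply: HN => /=; exact: leq_trans Nj (sub_ge j).
  have [g [_ _ g0 ->]] := HW _ _ (Wsub j).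
  rewrite /regular_dist (_ : (fun x => _) = fun=> 0).
    by apply: complex_ext; rewrite /= /Rintegral integral0.
  apply/funext => y; have [->|py] := eqVneq (psi y) 0; first by rewrite mulr0.
  rewrite g0 ?mul0r// => /Geta; rewrite /neighborhood/= => yG.
  have Ky : fun_supp psi y by exact: subset_closure.
  have := dist_far y (Kx _ Ky).
  by rewrite leNgt (lt_trans yG ej).
have := ww _ (bounded_evaluation tp).
have E : \forall j \near \oo, normc (w psi) = normc (w_ j psi - w psi).
  by apply: filterS ev => j ->; rewrite sub0r; case: (w psi) => a b /=; rewrite !sqrrN.
move=> lim0.
have lim1 : normc (w_ j psi - w psi) @[j --> \oo] --> normc (w psi).
  by apply: cvg_trans; [exact: near_eq_cvg E|exact: cvg_cst].
by apply: eq0_normc; apply: (cvg_unique _ lim1 lim0); exact: Rhausdorff.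
Qed.

(** Two uses of [wnorm2D_le] on three errors of at most [s / 16] give
    [2 (1/16 + 2 (1/16 + 1/16)) = 10/16] of [s]. *)
Lemma lt_of_sixteenths (a b p q g s : R) : g <= 2 * (a + b) -> b <= 2 * (p + q) ->
  a <= s / 16 -> p < s / 16 -> q < s / 16 -> 0 < s / 16 -> g < s.
Proof. lra. Qed.

(** The error has three parts: mesh averaging, mollification and density. The approximant [v], hence
    the constant [c], is fixed before [j], so the smallness of the mesh can be chosen relative to
    [c]. *)
Lemma recovery_near (Gamma : set X) (Gamma_ : nat -> set X) (eps : nat -> R)
    (M : forall j, preconvex_mesh (Gamma_ j)) (t : R) w (e : R) :
  (forall j, bounded_set (Gamma_ j)) -> (forall j, 0 < eps j) ->
  eps j @[j --> \oo] --> (0 : R) ->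
  (forall j, neighborhood Gamma (eps j) `<=` Gamma_ j) ->
  - (1 / 2) <= t <= 0 ->
  dense_in nrm (sobolev_on t Gamma) (sobolev_on (- (1 / 2)) Gamma) ->
  (forall k, 0 < k -> \forall j \near \oo, mesh_size (M j) <= k * eps j `^ (- 2 * t)) ->
  sobolev_on (- (1 / 2)) Gamma w -> 0 < e ->
  \forall j \near \oo, exists2 v, piecewise_constant (M j) v & nrm (v - w) < e.
Proof.
move=> Gb eps_gt0 eps0 Geps /andP[t1 t2] dense Mo Ww e0.
have [Hw _] := Ww; have [fw wfw wLw] := sobolev_wL2 Hw.
have e40 : 0 < e / 4 by rewrite divr_gt0.
have [v [Hv vG] vw] := dense w Ww _ e40.
have [f [vf mf fi]] := sobolev_transform Hv.
have wf := wL2_of_wgt t1 mf fi.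
have D1 : wnorm2 (fun xi => f xi - fw xi) < e ^+ 2 / 16.
  move: vw; rewrite (nrmBE vf wf wfw wLw) => vw.
  rewrite -[wnorm2 _]sqr_sqrtr ?wnorm2_ge0// (_ : e ^+ 2 / 16 = (e / 4) ^+ 2); last by field.
  by rewrite ltrXn2r ?nnegrE ?sqrtr_ge0 ?(ltW e40).
have [K K0 HK] := @cutoff_bound R m.
pose I := \int[mu]_xi (wgt t xi * normc (f xi) ^+ 2).
have I0 : 0 <= I by apply: Rintegral_ge0 => xi _; rewrite mulr_ge0 ?sqr_ge0 ?(ltW (wgt_gt0 _ _)).
have mc0 : 0 < mesh_const R m.
  by rewrite /mesh_const !mulr_gt0 ?invr_gt0 ?exprn_gt0 ?mulr_gt0 ?pi_gt0.
pose c := mesh_const R m * (2 * K * I).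
have c0 : 0 <= c by rewrite mulr_ge0 ?(ltW mc0)// mulr_ge0// mulr_ge0// ltW.
(* The denominator is [c + 1] because [c] vanishes when [v] has norm 0. *)
pose k := e ^+ 2 / 16 / (c + 1).
have e16 : 0 < e ^+ 2 / 16 by rewrite divr_gt0// exprn_gt0.
have k0 : 0 < k by rewrite divr_gt0// ltr_wpDl.
have kc : k * c <= e ^+ 2 / 16.
  by rewrite /k mulrAC ler_pdivrMr ?ltr_wpDl// ler_wpM2l ?(ltW e16)// lerDl.
have [wc cvc] := cutoff_cvg wf eps0.
have N1 : \forall j \near \oo, wnorm2 (fun xi => cutoff f (eps j) xi - f xi) < e ^+ 2 / 16.
  by move/cvgr_lt: cvc; apply.
have N2 : \forall j \near \oo, eps j < 1 by move/cvgr_lt: eps0; apply.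
have N3 := Mo k k0.
near=> j.
have ej0 := eps_gt0 j.
have ej1 : 0 < eps j <= 1 by rewrite ej0/= ltW//; near: j.
have Mj : mesh_size (M j) <= k * eps j `^ (- 2 * t) by near: j.
have Cj : wnorm2 (fun xi => cutoff f (eps j) xi - f xi) < e ^+ 2 / 16 by near: j.
have ic := cutoff_cint wf ej0.
have t11 : -1 <= t <= 0 by rewrite t2 andbT; lra.
have [ic2 lec] := HK _ _ _ ej1 t11 mf fi; rewrite -/I in lec.
pose vj := mollified f (eps j).
have vj0 x : ~ Gamma_ j x -> vj x = 0.
  move=> nx; apply: (mollified_eq0 ej0 vf wf vG) => /Geps; exact: nx.
have iv : cint vj by exact: mollified_cint ic (Gb j) vj0.
have [iv2 lev] := mollified_L2 ic ic2.
have d0 : 0 < k * eps j `^ (- 2 * t) by rewrite mulr_gt0// powR_gt0.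
have [wA leA] := mesh_approximation (Gb j) d0 Mj iv iv2 vj0.
pose u := regular_dist (cmesh_average (M j) vj).
have ia := cmesh_average_cint (M j) (Gb j) vj.
exists u; first exact: cmesh_average_piecewise.
have Ae : wnorm2 (fun xi => fourier (cmesh_average (M j) vj) xi - fourier vj xi) <= e ^+ 2 / 16.
  apply: (le_trans leA); apply: le_trans kc.
  apply: (@le_trans _ _ (mesh_const R m * (k * eps j `^ (- 2 * t)) * (2 * (K * eps j `^ (2 * t) * I)))).
    apply: ler_wpM2l; first by rewrite mulr_ge0 ?(ltW mc0) ?(ltW d0).
    by apply: (le_trans lev); rewrite ler_wpM2l.
  rewrite /c [X in X <= _](_ : _ = k * (mesh_const R m * (2 * K * I)) * (eps j `^ (- 2 * t) * eps j `^ (2 * t))); last by ring.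
  by rewrite mulNr powRN mulVf ?mulr1// gt_eqF// powR_gt0.
have mB : cmeasurable (fun xi => fourier vj xi - f xi).
  by apply: cmeasurableB => //; exact: cmeasurable_fourier.
have aeB : {ae mu, forall xi, fourier vj xi - f xi = cutoff f (eps j) xi - f xi}.
  by apply: filterS (fourier_mollified ic iv) => xi ->.
have [wB eB] := wnorm2_ae mB (wc j) aeB.
have wC := wL2B wf wLw.
have tri (z1 z2 z3 : C) : normc (z1 - z3) <= normc (z1 - z2) + normc (z2 - z3).
  by rewrite (_ : z1 - z3 = (z1 - z2) + (z2 - z3)) ?le_normcD//; ring.
have [wBC leBC] := wnorm2D_le wB wC (cmeasurableB (cmeasurable_fourier iv) wLw.1)
  (fun xi => tri (fourier vj xi) (f xi) (fw xi)).
have [wABC leABC] := wnorm2D_le wA wBC (cmeasurableB (cmeasurable_fourier ia) wLw.1)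
  (fun xi => tri (fourier (cmesh_average (M j) vj) xi) (fourier vj xi) (fw xi)).
have -> : nrm (u - w) = Num.sqrt (wnorm2 (fun xi => fourier (cmesh_average (M j) vj) xi - fw xi)).
  apply: nrmBE wfw wLw; first exact: fourier_is_transform.
  by apply: wL2_fourier => //; exact: cmesh_average_L2.
rewrite -(ger0_norm (ltW e0)) -sqrtr_sqr ltr_sqrt ?exprn_gt0//.
rewrite eB in leBC.
exact: lt_of_sixteenths leABC leBC Ae Cj D1 e16.
Unshelve. all: by end_near. Qed.

End mosco_ingredients.

Theorem theorem5p3 (R : realType) (n : nat) (hn : n = 2%N \/ n = 3%N)
  (Gamma : set 'rV[R]_n.-1) (Gamma_neq0 : Gamma !=set0)
  (Gamma_compact : compact Gamma)
  (Gamma_ : nat -> set 'rV[R]_n.-1)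
  (Gamma_open : forall j, open (Gamma_ j))
  (Gamma_bounded : forall j, bounded_set (Gamma_ j))
  (eps eta : nat -> R)
  (eps_eta : forall j, 0 < eps j < eta j)
  (Gamma_incl : forall j, [/\ Gamma `<=` neighborhood Gamma (eps j),
     neighborhood Gamma (eps j) `<=` Gamma_ j &
     Gamma_ j `<=` neighborhood Gamma (eta j)])
  (eta_cvg0 : eta j @[j --> \oo] --> (0 : R))
  (M : forall j, preconvex_mesh (Gamma_ j))
  (t : R) (t_range : - (1 / 2) <= t <= 0)
  (t_dense : dense_in (sobolev_norm (- (1 / 2)))
     (sobolev_on t Gamma) (sobolev_on (- (1 / 2)) Gamma))
  (h_o : (fun j => mesh_size (M j)) =o_\oo (fun j => eps j `^ (- 2 * t))) :
  mosco_cvg (sobolev (- (1 / 2))) (sobolev_norm (- (1 / 2)))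
    (fun j => piecewise_constant (M j)) (sobolev_on (- (1 / 2)) Gamma).
Proof.
have eps_gt0 j : 0 < eps j by case/andP: (eps_eta j).
have eps0 : eps j @[j --> \oo] --> (0 : R).
  apply: (@squeeze_cvgr _ _ _ _ (cst 0) eta); [|exact: cvg_cst|exact: eta_cvg0].
  by near=> j; case/andP: (eps_eta j) => e0 ee; rewrite (ltW e0) (ltW ee).
have Mo k : 0 < k -> \forall j \near \oo, mesh_size (M j) <= k * eps j `^ (- 2 * t).
  move=> k0; have := (eqoP _ _ _).1 h_o k k0; apply: filterS => j.
  rewrite [X in _ <= k * X]ger0_norm ?powR_ge0// => /(le_trans _); apply.
  exact: ler_norm.
split.
- move=> j u /(piecewise_constantP (Gamma_bounded j))[g [ig ig2 _ ->]].
  exact: sobolev_regular.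
- by move=> w [].
- move=> w Ww.
  have Geps j : neighborhood Gamma (eps j) `<=` Gamma_ j by case: (Gamma_incl j).
  have rec e := recovery_near Gamma_bounded eps_gt0 eps0 Geps t_range t_dense Mo Ww (e := e).
  pose W j := [set u | piecewise_constant (M j) u].
  (* [recovery_near] gives approximants that depend on the tolerance. Choosing in each discrete
     space an element within [1/(j+1)] of the infimum of the distances to [w] yields one sequence
     for all tolerances. *)
  pose E j := [set sobolev_norm (- (1 / 2)) (u - w) | u in W j].
  have infE j : has_inf (E j).
    split; last by exists 0 => _ [u _ <-]; exact: sqrtr_ge0.
    exists (sobolev_norm (- (1 / 2)) (regular_dist (cmesh_average (M j) 0) - w)).
    by exists (regular_dist (cmesh_average (M j) 0)) => //; exact: cmesh_average_piecewise.
  have pick j : exists u, W j u /\ sobolev_norm (- (1 / 2)) (u - w) < inf (E j) + j.+1%:R^-1.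
    have j0 : 0 < j.+1%:R^-1 :> R by rewrite invr_gt0.
    by have [_ [u Wu <-] h] := inf_adherent j0 (infE j); exists u.
  have [w_ Hw] := choice pick.
  exists w_; split; first by move=> j; exact: (Hw j).1.
  apply/cvgrPdist_lt => e e0.
  have e20 : 0 < e / 2 by rewrite divr_gt0.
  have rece := rec _ e20.
  have harm : \forall j \near \oo, j.+1%:R^-1 < e / 2.
    by have /cvgr_lt := @cvg_harmonic R; apply.
  near=> j.
  rewrite sub0r normrN ger0_norm ?sqrtr_ge0// (lt_trans (Hw j).2)// [ltRHS]splitr.
  have [u Wu ue] : exists2 v, piecewise_constant (M j) v & sobolev_norm (- (1 / 2)) (v - w) < e / 2.
    by near: j.
  apply: ltrD; last by near: j.
  apply: le_lt_trans ue; apply: ge_inf; first exact: (infE j).2.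
  by exists u.
- move=> sub w_ w hsub Wsub Hw ww; split => //.
  have Geta j : Gamma_ j `<=` neighborhood Gamma (eta j) by case: (Gamma_incl j).
  apply: (@dist_supp_weak_limit R n.-1 Gamma Gamma_ eta (fun j => piecewise_constant (M j)) sub w_ w) => //.
  by move=> j u; apply: piecewise_constantP; exact: Gamma_bounded.
Unshelve. all: by end_near. Qed.
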